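(* Let $T>0$ be fixed. Then there exists a desired state $y_d \in L^2(0,1)$ such that all of the following hold for the optimal control problem (P) with data $T$ and $y_d$ (see context): (1) the optimal objective function value of (P) is positive; (2) the analytic function $\bar p(\cdot,1)\colon [0,T)\to\mathbb{R}$ (the trace at $x=1$ of the adjoint state $\bar p$ associated with the unique optimal control $\bar u$ of (P)) changes infinitely often from positive to negative values and back; (3) the right-continuous representative $\bar u\colon [0,T)\to\{-1,1\}$ of the optimal control of (P) switches its function value an infinite number of times on $[0,T)$.
   Context: Problem (P): for given $T>0$ and $y_d\in L^2(0,1)$, minimize $\frac12\|y(T,\cdot)-y_d\|_{L^2(0,1)}^2$ over all pairs $(y,u)$ with $y\in L^2(0,T;H^1(0,1))\cap H^1(0,T;H^1(0,1)^* )$ and $u\in L^2(0,T)$, subject to the state equation $$\partial_t y-\partial_x^2 y=0 \text{ in } (0,T)\times(0,1),\quad \partial_x y=0 \text{ on } (0,T)\times\{0\},\quad \partial_x y=u \text{ on } (0,T)\times\{1\},\quad y=0 \text{ on } \{0\}\times(0,1),$$ and the control constraint $u\in U_{\mathrm{ad}}:=\{v\in L^2(0,T) : -1\le v\le 1 \text{ a.e. in }(0,T)\}$. Parabolic boundary value problems are understood in the weak sense: the state equation means $y(0,\cdot)=0$ and, for a.a. $t\in(0,T)$, $\langle\partial_t y(t),v\rangle+\int_0^1\partial_x y(t,x)\,v'(x)\,dx=u(t)\,v(1)$ for all $v\in H^1(0,1)$. Evaluations at fixed $t$ or at $x\in\{0,1\}$ are in the sense of temporal/spatial traces. Adjoint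 state: given an optimal control $\bar u$ with associated state $\bar y$, the adjoint state $\bar p\in L^2(0,T;H^1(0,1))\cap H^1(0,T;H^1(0,1)^* )$ is the weak solution of $$-\partial_t\bar p-\partial_x^2\bar p=0 \text{ in } (0,T)\times(0,1),\quad \partial_x\bar p=0 \text{ on } (0,T)\times\{0\} \text{ and on } (0,T)\times\{1\},\quad \bar p(T,\cdot)=\bar y(T,\cdot)-y_d \text{ on } (0,1).$$ Known facts (bang-bang principle) that make the statement meaningful: if the optimal objective function value of (P) is positive, then (P) has precisely one optimal control $\bar u$; the trace $\bar p(\cdot,1)$ of the associated adjoint state is (has a representative that is) analytic and not identically zero on $[0,T)$; $\bar u=-\operatorname{sgn}(\bar p(\cdot,1))$ a.e. in $(0,T)$; and $\bar u$ has a unique right-continuous representative $\bar u\colon[0,T)\to\mathbb{R}$, which takes values in $\{-1,1\}$ and changes its function value at at most countably many points of $[0,T)$, which can accumulate only at $T$. *)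

(* Defs.v *)
From HB Require Import structures.
From mathcomp Require Export all_boot all_order all_algebra.
From mathcomp Require Export all_classical all_reals all_analysis.
Export Order.TTheory GRing.Theory Num.Theory.
Export numFieldNormedType.Exports.

Set Implicit Arguments.
Unset Strict Implicit.
Unset Printing Implicit Defensive.

Local Open Scope classical_set_scope.
Local Open Scope ring_scope.

(** Functions of (t, x) are curried maps [R -> R -> R].  Elements of Lebesgue
    and Sobolev spaces are Borel measurable representatives, considered on the
    open interval / rectangle only; all notions below are invariant under
    modification on null sets.  Weak derivatives and traces, which are
    determined only up to null sets or through a continuous representative,
    are given as relations. *)

Section FunctionSpaces.
Variable R : realType.
Local Notation mu := (@lebesgue_measure R).

Definition in_L2 d (X : measurableType d) (m : set X -> \bar R) (D : set X)
    (f : X -> R) : Prop :=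
  measurable_fun D f /\ (\int[m]_(x in D) ((f x) ^+ 2)%:E < +oo)%E.

(** Real-valued functions in C_c^oo(a, b), extended by zero. *)
Definition test_function (a b : R) (phi : R -> R) : Prop :=
  (forall n x, derivable (derive1n n phi) x 1) /\
  exists K : set R, [/\ compact K, K `<=` `]a, b[ &
                        forall x, ~ K x -> phi x = 0].

(** [in_H1 v dv]: [v] is in H^1(0,1), and [dv] is its weak derivative. *)
Definition in_H1 (v dv : R -> R) : Prop :=
  [/\ in_L2 mu `]0, 1[ v, in_L2 mu `]0, 1[ dv &
      forall phi, test_function 0 1 phi ->
        \int[mu]_(x in `]0, 1[) (v x * (derive1 phi x)) =
        - \int[mu]_(x in `]0, 1[) (dv x * phi x)].

(** [space_trace v x0 c]: the trace of [v] at [x0] in [0,1] is [c]. *)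
Definition space_trace (v : R -> R) (x0 c : R) : Prop :=
  exists w : R -> R,
    [/\ {within `[0, 1], continuous w},
        {ae mu, forall x, x \in `]0, 1[ -> w x = v x} & w x0 = c].

(** The norm of the dual of H^1(0,1), for the norm
    (||v||_{L^2}^2 + ||v'||_{L^2}^2)^(1/2) on H^1(0,1). *)
Definition dual_norm (F : (R -> R) -> R) : \bar R :=
  ereal_sup [set r : \bar R | exists v dv,
    [/\ in_H1 v dv,
        (\int[mu]_(x in `]0, 1[) ((v x) ^+ 2)) +
          (\int[mu]_(x in `]0, 1[) ((dv x) ^+ 2)) <= 1 &
        r = `|F v|%:E]].

(** The values of [F] outside H^1(0,1) are irrelevant; boundedness forces [F]
    to respect almost everywhere equality. *)
Definition in_H1_dual (F : (R -> R) -> R) : Prop :=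
  (forall a v dv w dw, in_H1 v dv -> in_H1 w dw ->
     F (fun x => a * v x + w x) = a * F v + F w) /\
  (dual_norm F < +oo)%E.

(** L^2(0,T; H^1(0,1)); [dy] is the weak derivative in space of [y]. *)
Definition in_L2H1 (T : R) (y dy : R -> R -> R) : Prop :=
  [/\ in_L2 (mu \x mu)%E (`]0, T[ `*` `]0, 1[) (fun z => y z.1 z.2),
      in_L2 (mu \x mu)%E (`]0, T[ `*` `]0, 1[) (fun z => dy z.1 z.2) &
      {ae mu, forall t, t \in `]0, T[ -> in_H1 (y t) (dy t)}].

(** L^2(0,T; V) for the dual V of H^1(0,1).  As V is a separable
    Hilbert space, Bochner measurability is expressed by the measurability of all pairings. *)
Definition in_L2H1_dual (T : R) (g : R -> (R -> R) -> R) : Prop :=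
  [/\ {ae mu, forall t, t \in `]0, T[ -> in_H1_dual (g t)},
      forall v dv, in_H1 v dv -> measurable_fun `]0, T[ (fun t => g t v) &
      (\int[mu]_(t in `]0%R, T[) ((dual_norm (g t)) ^+ 2) < +oo)%E].

(** [g] is the distributional derivative in time of [y] with values in the
    dual V of H^1(0,1), for the Gelfand triple H^1(0,1), L^2(0,1), V. *)
Definition weak_time_derivative (T : R) (y : R -> R -> R)
    (g : R -> (R -> R) -> R) : Prop :=
  forall phi v dv, test_function 0 T phi -> in_H1 v dv ->
    \int[mu]_(t in `]0, T[)
      (derive1 phi t * (\int[mu]_(x in `]0, 1[) (y t x * v x))) =
    - \int[mu]_(t in `]0, T[) (phi t * g t v).

(** The intersection of L^2(0,T; H^1(0,1)) and H^1(0,T; V), V the dual of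
    H^1(0,1), with derivatives [dy] in space and [g] in time. *)
Definition in_W (T : R) (y dy : R -> R -> R) (g : R -> (R -> R) -> R) : Prop :=
  [/\ in_L2H1 T y dy, in_L2H1_dual T g & weak_time_derivative T y g].

(** [time_trace T y t0 z]: [y(t0, .) = z] in L^2(0,1), through the
    representative of [y] in C([0,T]; L^2(0,1)). *)
Definition time_trace (T : R) (y : R -> R -> R) (t0 : R) (z : R -> R) : Prop :=
  in_L2 mu `]0, 1[ z /\
  exists Y : R -> R -> R,
    [/\ forall t, t \in `[0, T] -> in_L2 mu `]0, 1[ (Y t),
        forall t, t \in `[0, T] ->
          (\int[mu]_(x in `]0, 1[) ((Y s x - Y t x) ^+ 2))
            @[s --> within `[0, T] (nbhs t)] --> (0 : R),
        {ae mu, forall t, t \in `]0, T[ ->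
          {ae mu, forall x, x \in `]0, 1[ -> Y t x = y t x}} &
        {ae mu, forall x, x \in `]0, 1[ -> Y t0 x = z x}].

End FunctionSpaces.

Section ControlProblem.
Variables (R : realType) (T : R).
Local Notation mu := (@lebesgue_measure R).

(** [y] is the weak solution of the state equation with control [u]. *)
Definition state_equation (y : R -> R -> R) (u : R -> R) : Prop :=
  time_trace T y 0 (fun=> 0) /\
  exists dy g, in_W T y dy g /\
    {ae mu, forall t, t \in `]0, T[ ->
      forall v dv c, in_H1 v dv -> space_trace v 1 c ->
        g t v + (\int[mu]_(x in `]0, 1[) (dy t x * dv x)) = u t * c}.

Definition admissible_control (u : R -> R) : Prop :=
  in_L2 mu `]0, T[ u /\
  {ae mu, forall t, t \in `]0, T[ -> -1 <= u t <= 1}.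

(** [(y, u)] is feasible for (P), and [z] is the final state [y(T, .)]. *)
Definition feasible (y : R -> R -> R) (u z : R -> R) : Prop :=
  [/\ state_equation y u, admissible_control u &
      time_trace T y T z].

Definition objective (yd z : R -> R) : R :=
  1 / 2 * \int[mu]_(x in `]0, 1[) ((z x - yd x) ^+ 2).

Definition optimal_value (yd : R -> R) : \bar R :=
  ereal_inf [set r : \bar R | exists y u z,
    feasible y u z /\ r = (objective yd z)%:E].

Definition optimal (yd : R -> R) (y : R -> R -> R) (u z : R -> R) : Prop :=
  feasible y u z /\
  forall y' u' z', feasible y' u' z' -> objective yd z <= objective yd z'.

(** [p] is the weak solution of the adjoint equation with final value [pT]. *)
Definition adjoint_equation (p : R -> R -> R) (pT : R -> R) : Prop :=
  time_trace T p T pT /\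
  exists dp g, in_W T p dp g /\
    {ae mu, forall t, t \in `]0, T[ ->
      forall v dv, in_H1 v dv ->
        - g t v + (\int[mu]_(x in `]0, 1[) (dp t x * dv x)) = 0}.

(** Real analyticity on [0,T): locally around each point, the endpoint 0
    included, the function is the sum of a power series. *)
Definition analytic_on_0T (q : R -> R) : Prop :=
  forall t0, t0 \in `[0, T[ -> exists (a : R^nat) (r : R), 0 < r /\
    forall t, t \in `[0, T[ -> `|t - t0| < r ->
      series (fun n => a n * (t - t0) ^+ n) n @[n --> \oo] --> q t.

(** [q] changes infinitely often from positive to negative values and back. *)
Definition infinitely_many_sign_changes (q : R -> R) : Prop :=
  exists s : R^nat,
    [/\ forall n, s n \in `[0, T[, forall n, s n < s n.+1,
        forall k, 0 < q (s k.*2) & forall k, q (s k.*2.+1) < 0].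

(** [w] is a right-continuous representative on [0,T) of the control [u], with
    values in {-1, 1}. *)
Definition right_continuous_representative (u w : R -> R) : Prop :=
  [/\ {ae mu, forall t, t \in `]0, T[ -> w t = u t},
      forall t, t \in `[0, T[ -> w s @[s --> t^'+] --> w t &
      forall t, t \in `[0, T[ -> w t = -1 \/ w t = 1].

(** The points at which a right-continuous [w] on [0,T) changes its value;
    right-continuity excludes a change at 0. *)
Definition switching_points (w : R -> R) : set R :=
  [set t | 0 < t < T /\ ~ (w s @[s --> t] --> w t)].

End ControlProblem.

(* Main.v *)
(** The adjoint state is prescribed first.  Let [q s = sum_j c_j exp (- r_j s)]
    with [c_j = (-1/64)^j] and the rates [r_j = (16^j pi)^2], completed by a
    constant term such that [q 0 = 0].  At [s = 1 / (pi^2 256^(k+1))] the mode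
    [k + 1] dominates, so that the sign of [q] alternates with [k] and [q]
    oscillates as [s] tends to [0].  The function
    [p (t, x) = sum_j c_j exp (- r_j (T - t)) cos (16^j pi x)] solves the
    adjoint equation, and its trace at [x = 1] is [q (T - t)].

    Take [ubar = - sgn q (T - .)] with state [ybar], and let
    [yd = ybar(T) - p(T)].  Pairing states with [p] gives, for every feasible
    control [u] with final state [z], the identity [J z - J zbar =
    ||z - zbar||^2 / 2 + int_0^T (u - ubar) q (T - .)] whose last term is
    nonnegative, and vanishes only for [u = ubar] since the zeros of [q] are
    isolated.

    The state is the cosine series whose coefficients are the Duhamel integrals
    of [u].  The coefficients of its space derivative differ by [O(1/n)] from
    those of a multiple of the sawtooth series, whose remainders are bounded
    by [(1 - x)^(-1/4) n^(-1/4)]; summation by parts gives a majorant of the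
    derivative in [L^2(0,1)]. *)

Require Import Defs.
From mathcomp Require Import ring lra measurable_realfun.

Set Implicit Arguments.
Unset Strict Implicit.
Unset Printing Implicit Defensive.

Local Open Scope classical_set_scope.
Local Open Scope ring_scope.

(** * Integration *)

(** The ratios 16 and 1/64 answer three demands. Even frequencies make every mode equal to 1 at
    [x = 1], so the trace of [p] keeps the coefficients [c_j]. Rates grow by 256 while weights
    shrink by 64, so the contributions [|c_j| r_j s] of the slow modes grow by 4 and sum to at most
    a third of the weight of the deciding mode, while the faster modes carry at most 1/63 of it.
    Finally 16/64 < 1 makes the space derivative of [p] converge uniformly up to [t = T]. The
    constant term has to cancel the sum of the other [c_j]: with [q 0] different from zero the sign
    of [q] would be fixed near [s = 0].

    The obstacle lies on the state side. For a control that is merely bounded, the coefficients of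
    the space derivative are only controlled by a multiple of [1/n], which gives no absolute
    convergence; hence the detour through the sawtooth series. Membership in the solution space is
    shown once for both [y] and [p], with a sign for the direction of time and a factor for the
    boundary term. Arbitrary feasible pairs come with no formula: their cosine coefficients are
    extracted from the weak equation by the du Bois-Reymond lemma. *)

Section IntegralToolkit.
Context d (X : measurableType d) (R : realType).
Variable m : {measure set X -> \bar R}.

Lemma dominated_Rintegral (D : set X) (fn : nat -> X -> R) (f g : X -> R) :
  measurable D -> (forall n, measurable_fun D (fn n)) ->
  (forall x, D x -> fn n x @[n --> \oo] --> f x) ->
  m.-integrable D (EFin \o g) ->
  (forall n x, D x -> `|fn n x| <= g x) ->
  m.-integrable D (EFin \o f) /\
  \int[m]_(x in D) fn n x @[n --> \oo] --> \int[m]_(x in D) f x.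
Proof.
move=> mD mf ff ig fg.
have mlim : measurable_fun D f by exact: (measurable_fun_cvg mf ff).
have [] := @dominated_convergence _ _ _ m D mD (fun n => EFin \o fn n)
  (EFin \o f) (EFin \o g).
- by move=> n; apply/measurable_EFinP.
- exact/measurable_EFinP.
- apply: aeW => x Dx; apply/fine_cvgP; split; first by apply: nearW.
  exact: (ff x Dx).
- by [].
- by apply: aeW => x n Dx /=; rewrite lee_fin fg.
move=> iF _ H; split => //.
rewrite /Rintegral; apply: fine_cvg.
rewrite fineK//; exact: integrable_fin_num.
Qed.

Lemma ae_eq_Rintegral (D : set X) (f g : X -> R) :
  measurable D -> measurable_fun D f -> measurable_fun D g ->
  {ae m, forall x, D x -> f x = g x} ->
  \int[m]_(x in D) f x = \int[m]_(x in D) g x.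
Proof.
move=> mD mf mg fg; rewrite /Rintegral; congr fine; apply: ae_eq_integral => //.
- exact/measurable_EFinP.
- exact/measurable_EFinP.
- by apply: filterS fg => x fg Dx; rewrite fg.
Qed.

Lemma integrable_mul_bounded (D : set X) (f g : X -> R) (C : R) :
  measurable D -> m.-integrable D (EFin \o f) -> measurable_fun D g ->
  (forall x, D x -> `|g x| <= C) ->
  m.-integrable D (EFin \o (fun x => f x * g x)).
Proof.
move=> mD fi mg gC.
have mf : measurable_fun D f by apply/measurable_EFinP; exact: measurable_int fi.
apply: (@le_integrable _ _ _ _ _ mD _ (EFin \o (fun x => C * f x))).
- by apply/measurable_EFinP; exact: measurable_funM.
- move=> x Dx /=; rewrite lee_fin !normrM mulrC ler_wpM2r//.
  by rewrite (le_trans (gC x Dx))// ler_norm.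
- exact: (integrableZl mD C fi).
Qed.

Lemma in_L2_integrable_sqr (D : set X) (f : X -> R) :
  measurable D -> in_L2 m D f -> m.-integrable D (EFin \o (fun x => f x ^+ 2)).
Proof.
move=> mD [mf fi]; apply/integrableP; split.
  apply/measurable_EFinP; exact: (measurable_funX 2 mf).
rewrite (_ : (fun _ => _) = (fun x => (f x ^+ 2)%:E))//.
by apply/funext => x /=; rewrite ger0_norm// sqr_ge0.
Qed.

Lemma in_L2_mul (D : set X) (f g : X -> R) :
  measurable D -> in_L2 m D f -> in_L2 m D g ->
  m.-integrable D (EFin \o (fun x => f x * g x)).
Proof.
move=> mD f2 g2.
apply: (@le_integrable _ _ _ _ _ mD _ (EFin \o (fun x => f x ^+ 2 + g x ^+ 2))).
- by apply/measurable_EFinP; apply: measurable_funM; [case: f2|case: g2].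
- move=> x Dx /=; rewrite lee_fin.
  rewrite [leRHS]ger0_norm ?addr_ge0 ?sqr_ge0//.
  rewrite ler_norml; nra.
- have := integrableD mD (in_L2_integrable_sqr mD f2) (in_L2_integrable_sqr mD g2).
  by apply: eq_integrable.
Qed.

Lemma in_L2_le (D : set X) (f g : X -> R) :
  measurable D -> measurable_fun D f -> in_L2 m D g ->
  (forall x, D x -> `|f x| <= g x) -> in_L2 m D f.
Proof.
move=> mD mf [mg gi] fg; split => //.
apply: le_lt_trans gi; apply: ge0_le_integral => //.
- by move=> x _; rewrite lee_fin sqr_ge0.
- by apply/measurable_EFinP; exact: measurable_funX.
- by apply/measurable_EFinP; exact: measurable_funX.
- move=> x Dx; rewrite lee_fin -real_normK ?num_real//.
  by rewrite lerXn2r ?nnegrE// (le_trans _ (fg x Dx)).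
Qed.

Lemma in_L2_cst (D : set X) (C : R) :
  measurable D -> (m D < +oo)%E -> in_L2 m D (fun=> C).
Proof.
move=> mD Doo; split => //; rewrite integral_cst//.
by rewrite lte_mul_pinfty// lee_fin sqr_ge0.
Qed.

Lemma in_L2_bounded (D : set X) (f : X -> R) (C : R) :
  measurable D -> (m D < +oo)%E -> measurable_fun D f ->
  (forall x, D x -> `|f x| <= C) -> in_L2 m D f.
Proof. by move=> mD Doo mf fC; apply: (in_L2_le mD mf (in_L2_cst C mD Doo)). Qed.

Lemma in_L2_integrable (D : set X) (f : X -> R) :
  measurable D -> (m D < +oo)%E -> in_L2 m D f -> m.-integrable D (EFin \o f).
Proof.
move=> mD Doo f2; have := in_L2_mul mD f2 (in_L2_cst 1 mD Doo).
by apply: eq_integrable => // x _ /=; rewrite mulr1.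
Qed.

Lemma in_L2_D (D : set X) (f g : X -> R) :
  measurable D -> in_L2 m D f -> in_L2 m D g -> in_L2 m D (f \+ g).
Proof.
move=> mD f2 g2; have [mf _] := f2; have [mg _] := g2; split.
  exact: measurable_funD.
have i1 := integrableZl mD 2 (in_L2_integrable_sqr mD f2).
have i2 := integrableZl mD 2 (in_L2_integrable_sqr mD g2).
have i3 := integrableD mD i1 i2.
apply: le_lt_trans (integrable_lty mD i3); apply: ge0_le_integral => //.
- by move=> x _; rewrite lee_fin sqr_ge0.
- by apply/measurable_EFinP; apply: measurable_funX; exact: measurable_funD.
- exact: measurable_int i3.
- move=> x Dx /=; rewrite lee_fin -subr_ge0.
  by rewrite (_ : _ - _ = (f x - g x) ^+ 2) ?sqr_ge0//; ring.
Qed.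

Lemma in_L2_Z (D : set X) (f : X -> R) c :
  measurable D -> in_L2 m D f -> in_L2 m D (fun x => c * f x).
Proof.
move=> mD f2; have [mf _] := f2; split; first exact: measurable_funM.
have i1 := integrableZl mD (c ^+ 2) (in_L2_integrable_sqr mD f2).
apply: le_lt_trans (integrable_lty mD i1); rewrite le_eqVlt; apply/orP; left.
by apply/eqP; apply: eq_integral => x _ /=; rewrite exprMn.
Qed.

Lemma in_L2_B (D : set X) (f g : X -> R) :
  measurable D -> in_L2 m D f -> in_L2 m D g -> in_L2 m D (f \- g).
Proof.
move=> mD f2 g2; have := in_L2_D mD f2 (in_L2_Z (-1) mD g2).
by congr in_L2; apply/funext => x /=; rewrite mulN1r.
Qed.

Lemma ge0_Rintegral_eq0 (D : set X) (f : X -> R) :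
  measurable D -> m.-integrable D (EFin \o f) -> (forall x, D x -> 0 <= f x) ->
  \int[m]_(x in D) f x = 0 -> {ae m, forall x, D x -> f x = 0}.
Proof.
move=> mD fi f0 f00.
(* [Rintegral] is [fine] of the integral, which also sends infinite values to 0; integrability
   excludes them. *)
have : (\int[m]_(x in D) (EFin \o f) x = 0)%E.
  have := integrable_fin_num mD fi; rewrite fin_numE; move: f00.
  by rewrite /Rintegral /=; case: (integral _ _ _) => //= r ->.
move=> H; have : (\int[m]_(x in D) `|(EFin \o f) x| = 0)%E.
  rewrite -[RHS]H; apply: eq_integral => x; rewrite inE => Dx /=.
  by rewrite ger0_norm// f0.
move/(ae_eq_integral_abs m mD (measurable_int m fi)).1; apply: filterS => x /= H1 Dx.
by case: (H1 Dx).
Qed.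

Lemma Rintegral_sum (I : Type) (s : seq I) (D : set X) (f : I -> X -> R) :
  measurable D -> (forall i, m.-integrable D (EFin \o f i)) ->
  \int[m]_(x in D) (\sum_(i <- s) f i x) = \sum_(i <- s) \int[m]_(x in D) f i x.
Proof.
move=> mD fi; rewrite /Rintegral.
under eq_integral do rewrite -sumEFin.
by rewrite integral_sum// -sum_fine => [|i _] //; exact: integrable_fin_num (fi i).
Qed.

Lemma integrable_fD (D : set X) (f g : X -> R) : measurable D ->
  m.-integrable D (EFin \o f) -> m.-integrable D (EFin \o g) ->
  m.-integrable D (EFin \o (fun x => f x + g x)).
Proof. by move=> mD fi gi; have := integrableD mD fi gi; exact: eq_integrable. Qed.

Lemma integrable_fB (D : set X) (f g : X -> R) : measurable D ->
  m.-integrable D (EFin \o f) -> m.-integrable D (EFin \o g) ->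
  m.-integrable D (EFin \o (fun x => f x - g x)).
Proof. by move=> mD fi gi; have := integrableB mD fi gi; exact: eq_integrable. Qed.

Lemma integrable_fZ (D : set X) (f : X -> R) c : measurable D ->
  m.-integrable D (EFin \o f) -> m.-integrable D (EFin \o (fun x => c * f x)).
Proof. by move=> mD fi; have := integrableZl mD c fi; exact: eq_integrable. Qed.

Lemma Rintegral_zero (D : set X) : \int[m]_(x in D) (0 : R) = 0.
Proof. by rewrite /Rintegral integral0. Qed.

End IntegralToolkit.

Section RealIntegrals.
Context {R : realType}.
Notation mu := (@lebesgue_measure R).
Implicit Types (f g G k : R -> R) (a b : R).

Lemma ae_imply (P Q : R -> Prop) :
  {ae mu, forall x, P x} -> (forall x, P x -> Q x) -> {ae mu, forall x, Q x}.
Proof.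
by move=> aP PQ; apply: (@filterS _ _ (ae_filter_ringOfSetsType mu) _ _ PQ aP).
Qed.

Lemma ae_imply2 (P Q S : R -> Prop) :
  {ae mu, forall x, P x} -> {ae mu, forall x, Q x} ->
  (forall x, P x -> Q x -> S x) -> {ae mu, forall x, S x}.
Proof.
move=> aP aQ PQS.
by apply: (@filterS2 _ _ (ae_filter_ringOfSetsType mu) _ _ _ PQS aP aQ).
Qed.

Lemma itvoo_lty a b : (mu `]a, b[%classic < +oo)%E.
Proof. by rewrite lebesgue_measure_itv /=; case: ifP => // _; rewrite -EFinD ltry. Qed.

Lemma continuous_integrable_oo f a b : continuous f ->
  mu.-integrable `]a, b[ (EFin \o f).
Proof.
move=> cf; apply: (@integrableS _ _ _ mu `[a, b]) => //.
  exact: subset_itv_oo_cc.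
apply: continuous_compact_integrable; first exact: segment_compact.
exact: continuous_subspaceT.
Qed.

Lemma continuous_bounded_itv f a b : continuous f ->
  exists C, forall x, a <= x <= b -> `|f x| <= C.
Proof.
move=> cf; have [ab|ab] := leP a b; last first.
  by exists 0 => x /andP[ax xb]; have := le_trans ax xb; rewrite leNgt ab.
have cn : {within `[a, b], continuous (fun x => `|f x|)}.
  by apply: continuous_subspaceT => x; apply: cvg_norm; exact: cf.
have [c _ fc] := EVT_max ab cn.
by exists `|f c| => x xab; apply: fc; rewrite in_itv.
Qed.

Lemma integrable_mul_continuous f g a b :
  mu.-integrable `]a, b[ (EFin \o f) -> continuous g ->
  mu.-integrable `]a, b[ (EFin \o (fun x => f x * g x)).
Proof.
move=> fi cg; have [C gC] := continuous_bounded_itv a b cg.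
apply: (integrable_mul_bounded (C := C)) => //.
  by apply: measurable_funTS; exact: continuous_measurable_fun.
by move=> x; rewrite /= in_itv /= => /andP[/ltW ax /ltW xb]; rewrite gC ?ax.
Qed.

Lemma is_derive_continuous G k : (forall x : R, is_derive x (1 : R) G (k x)) ->
  continuous G.
Proof.
move=> dG x; apply: differentiable_continuous; apply/derivable1_diffP.
by case: (dG x).
Qed.

Lemma FTC2oo G k a b : a <= b -> (forall x : R, is_derive x (1 : R) G (k x)) ->
  continuous k -> \int[mu]_(x in `]a, b[) k x = G b - G a.
Proof.
move=> + dG ck; rewrite le_eqVlt => /predU1P[->|ab].
  by rewrite set_itv_ge ?bnd_simp ?ltxx// Rintegral_set0 subrr.
have cG := is_derive_continuous dG.
rewrite Rintegral_itv_bndo_bndc; last exact: continuous_integrable_oo.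
rewrite Rintegral_itv_obnd_cbnd; last first.
  apply: (@integrableS _ _ _ mu `[a, b]) => //.
    exact: subset_itv_oc_cc.
  apply: continuous_compact_integrable; first exact: segment_compact.
  exact: continuous_subspaceT.
rewrite /Rintegral (@continuous_FTC2 _ k G a b)//.
- exact: continuous_subspaceT.
- split; first by move=> x _; case: (dG x).
    exact/cvg_at_right_filter/cG.
  exact/cvg_at_left_filter/cG.
- by move=> x _; rewrite derive1E; case: (dG x).
Qed.

(** Every section is assumed integrable, not just almost every one, so that [fine] can be removed
    pointwise under the outer integrals. *)
Lemma Rintegral_Fubini (f : R * R -> R) :
  (mu \x mu)%E.-integrable setT (EFin \o f) ->
  (forall x, mu.-integrable setT (fun y => (f (x, y))%:E)) ->
  (forall y, mu.-integrable setT (fun x => (f (x, y))%:E)) ->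
  \int[mu]_x (\int[mu]_y f (x, y)) = \int[mu]_y (\int[mu]_x f (x, y)).
Proof.
move=> fi f1 f2; have := Fubini fi.
rewrite /Rintegral => H; congr fine.
under eq_integral do rewrite fineK ?integrable_fin_num//.
under [in RHS]eq_integral do rewrite fineK ?integrable_fin_num//.
exact: H.
Qed.

End RealIntegrals.

(** * Integration by parts against a primitive *)

Section Parts.
Context {R : realType}.
Notation mu := (@lebesgue_measure R).
Implicit Types (f g G k : R -> R) (a b : R).

Lemma integrable_patch f (D : set R) : measurable D ->
  mu.-integrable D (EFin \o f) -> mu.-integrable setT (EFin \o (f \_ D)).
Proof. by move=> mD fi; rewrite -restrict_EFin -integrable_mkcond. Qed.

(** Extension by zero and the factor for [z.1 < z.2] move the triangle into the whole plane, where
    [Rintegral_Fubini] is stated. *)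
Let kernel f k a b (z : R * R) : R :=
  (f \_ `]a, b[) z.1 * ((k \_ `]a, b[) z.2 * (if z.1 < z.2 then 1 else 0)).

Let kernel_le f k a b z :
  `|kernel f k a b z| <= `|(f \_ `]a, b[) z.1| * `|(k \_ `]a, b[) z.2|.
Proof.
rewrite /kernel; case: ifP => _; first by rewrite mulr1 normrM.
by rewrite !mulr0 normr0 mulr_ge0.
Qed.

Let measurable_kernel f k a b :
  mu.-integrable `]a, b[ (EFin \o f) -> mu.-integrable `]a, b[ (EFin \o k) ->
  measurable_fun setT (kernel f k a b).
Proof.
move=> /(integrable_patch (measurable_itv _)) fi.
move=> /(integrable_patch (measurable_itv _)) ki.
have mf : measurable_fun setT (f \_ `]a, b[).
  by apply/measurable_EFinP; exact: measurable_int fi.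
have mk : measurable_fun setT (k \_ `]a, b[).
  by apply/measurable_EFinP; exact: measurable_int ki.
apply: measurable_funM; first exact: measurableT_comp mf measurable_fst.
apply: measurable_funM; first exact: measurableT_comp mk measurable_snd.
apply: measurable_fun_ifT => //.
by apply: measurable_fun_ltr; [exact: measurable_fst|exact: measurable_snd].
Qed.

Let integrable_kernel f k a b :
  mu.-integrable `]a, b[ (EFin \o f) -> mu.-integrable `]a, b[ (EFin \o k) ->
  (mu \x mu)%E.-integrable setT (EFin \o kernel f k a b).
Proof.
move=> fi ki; have mK := measurable_kernel fi ki.
move: fi => /(integrable_patch (measurable_itv _)) fi.
move: ki => /(integrable_patch (measurable_itv _)) ki.
apply/integrable12ltyP; first exact/measurable_EFinP.
have /integrableP[_ kfin] := ki.
have K0 : (0 <= \int[mu]_y `|(EFin \o (k \_ `]a, b[)) y|)%E by exact: integral_ge0.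
have := integrable_lty measurableT (integrableZl measurableT
   (fine (\int[mu]_y `|(EFin \o (k \_ `]a, b[)) y|)%E) (integrable_abse fi)).
apply: le_lt_trans; apply: ge0_le_integral => //.
- by move=> x _; exact: integral_ge0.
- apply: (@measurable_fun_fubini_tonelli_F _ _ _ _ _ mu (fun z => `|(kernel f k a b z)%:E|%E)) => //.
  by apply/measurable_EFinP; apply: measurableT_comp.
- apply: emeasurable_funM => //; apply: measurableT_comp => //.
  exact: measurable_int fi.
- move=> x _; rewrite fineK ?ge0_fin_numE// muleC /=.
  rewrite -ge0_integralZl//=; last first.
    apply/measurable_EFinP; apply: measurableT_comp => //.
    by apply/measurable_EFinP; exact: measurable_int ki.
  apply: ge0_le_integral => //.
  + apply/measurable_EFinP; apply: measurableT_comp => //.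
    exact: measurableT_comp mK (measurable_pair1 x).
  + apply/measurable_EFinP; apply: measurable_funM => //.
    apply: measurableT_comp => //.
    by apply/measurable_EFinP; exact: measurable_int ki.
  + by move=> y _; rewrite lee_fin; exact: kernel_le.
Qed.

(* Fubini on the triangle [a < x < s < b] for [f x * k s]. *)
Lemma absolutely_continuous_by_parts f G k a b : a <= b ->
  mu.-integrable `]a, b[ (EFin \o f) ->
  (forall x : R, is_derive x (1 : R) G (k x)) -> continuous k ->
  \int[mu]_(x in `]a, b[) (f x * G x) +
  \int[mu]_(s in `]a, b[) ((\int[mu]_(x in `]a, s[) f x) * k s) =
  (\int[mu]_(x in `]a, b[) f x) * G b.
Proof.
move=> ab fi dG ck.
have ki := continuous_integrable_oo a b ck.
have Kx x : mu.-integrable setT (fun y => (kernel f k a b (x, y))%:E).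
  apply: (@le_integrable _ _ _ mu _ measurableT _
    (fun y => ((f \_ `]a, b[) x)%:E * (EFin \o (k \_ `]a, b[)) y)%E).
  - apply/measurable_EFinP.
    exact: measurableT_comp (measurable_kernel fi ki) (measurable_pair1 x).
  - move=> y _ /=; rewrite lee_fin; apply: le_trans (kernel_le _ _ _ _ (x, y)) _.
    by rewrite normrM.
  - exact/(integrableZl measurableT)/integrable_patch.
have Ky y : mu.-integrable setT (fun x => (kernel f k a b (x, y))%:E).
  apply: (@le_integrable _ _ _ mu _ measurableT _
    (fun x => ((k \_ `]a, b[) y)%:E * (EFin \o (f \_ `]a, b[)) x)%E).
  - apply/measurable_EFinP.
    exact: measurableT_comp (measurable_kernel fi ki) (measurable_pair2 y).
  - move=> x _ /=; rewrite lee_fin; apply: le_trans (kernel_le _ _ _ _ (x, y)) _.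
    by rewrite normrM mulrC.
  - exact/(integrableZl measurableT)/integrable_patch.
have := Rintegral_Fubini (integrable_kernel fi ki) Kx Ky.
have -> : \int[mu]_x \int[mu]_y kernel f k a b (x, y) =
          \int[mu]_(x in `]a, b[) (f x * G b - f x * G x).
  rewrite [RHS]Rintegral_mkcond; apply: eq_Rintegral => x _.
  rewrite [RHS]patchE mem_setE /kernel /=; case: ifPn => xab; last first.
    rewrite patchE mem_setE (negbTE xab).
    by under eq_Rintegral do rewrite mul0r; rewrite Rintegral_zero.
  rewrite patchE mem_setE xab; move: xab; rewrite in_itv /= => /andP[ax xb].
  have E y : (k \_ `]a, b[) y * (if x < y then 1 else 0) = (k \_ `]x, b[) y.
    rewrite !patchE !mem_setE !in_itv /=.
    have [xy|] := ltP x y; last by rewrite mulr0.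
    by rewrite (lt_trans ax xy) mulr1.
  under eq_Rintegral do rewrite E.
  rewrite RintegralZl//; last first.
    exact/integrable_patch/continuous_integrable_oo.
  by rewrite -Rintegral_mkcond (FTC2oo (ltW xb) dG ck) mulrBr.
have -> : \int[mu]_y \int[mu]_x kernel f k a b (x, y) =
    \int[mu]_(s in `]a, b[) ((\int[mu]_(x in `]a, s[) f x) * k s).
  rewrite [RHS]Rintegral_mkcond; apply: eq_Rintegral => y _.
  rewrite [RHS]patchE mem_setE /kernel /=; case: ifPn => xab; last first.
    rewrite patchE mem_setE (negbTE xab).
    by under eq_Rintegral do rewrite mul0r mulr0; rewrite Rintegral_zero.
  rewrite patchE mem_setE xab; move: xab; rewrite in_itv /= => /andP[ay yb].
  have E x : (f \_ `]a, b[) x * (k y * (if x < y then 1 else 0)) =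
      k y * (f \_ `]a, y[) x.
    rewrite !patchE !mem_setE !in_itv /=.
    have [xy|] := ltP x y; last by rewrite !mulr0 andbF mulr0.
    by rewrite (lt_trans xy yb) mulr1 mulrC.
  under eq_Rintegral do rewrite E.
  rewrite RintegralZl//; last first.
    apply: integrable_patch => //; apply: integrableS fi => //.
    by apply: subset_itvl; rewrite bnd_simp ltW.
  by rewrite -Rintegral_mkcond mulrC.
move=> <-.
have cG := is_derive_continuous dG.
rewrite RintegralB//.
- by rewrite RintegralZr// addrC subrK.
- by apply: integrable_mul_continuous => // x; exact: cvg_cst.
- exact: integrable_mul_continuous.
Qed.

End Parts.

(** * Test functions and weak derivatives *)

Section Derivatives.
Context {R : realType}.
Implicit Types (f g : R -> R).

Lemma derD f g (x a b : R) : is_derive x (1 : R) f a -> is_derive x (1 : R) g b ->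
  is_derive x (1 : R) (fun y => f y + g y) (a + b).
Proof. by move=> fa gb; exact: is_deriveD. Qed.

Lemma derM f g (x a b : R) : is_derive x (1 : R) f a -> is_derive x (1 : R) g b ->
  is_derive x (1 : R) (fun y => f y * g y) (a * g x + f x * b).
Proof.
move=> fa gb; apply: (is_derive_eq (is_deriveM fa gb)).
by rewrite /GRing.scale /=; ring.
Qed.

Lemma derZ f (c x a : R) : is_derive x (1 : R) f a ->
  is_derive x (1 : R) (fun y => c * f y) (c * a).
Proof. by move=> fa; exact: (is_derive_eq (is_deriveZ c fa)). Qed.

Lemma der_comp f g (x a b : R) : is_derive (g x) (1 : R) f a ->
  is_derive x (1 : R) g b -> is_derive x (1 : R) (fun y => f (g y)) (a * b).
Proof. by move=> fa gb; exact: (is_derive_eq (is_derive1_comp fa gb)). Qed.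

Lemma derX m (x : R) : is_derive x (1 : R) (fun y => y ^+ m) (m%:R * x ^+ m.-1).
Proof.
elim: m => [|m IH].
  by rewrite mul0r; under eq_fun do rewrite expr0; exact: is_derive_cst.
under eq_fun do rewrite exprS; apply: (is_derive_eq (derM (is_derive_id x 1) IH)).
by case: m {IH} => [|m]; rewrite /= ?exprS ?mulr1 -?[m.+2]addn1 ?natrD; ring.
Qed.

Lemma der_affine (c d x : R) : is_derive x (1 : R) (fun y => c * y + d) c.
Proof.
apply: (is_derive_eq (derD (derZ c (is_derive_id x 1)) (is_derive_cst d x 1))).
by rewrite mulr1 addr0.
Qed.

(** Derivatives are carried as existential witnesses, so that sums, products and affine
    substitutions follow by induction without a formula for [derive1n]; [ntimes_diff_derivable] and
    [derive1n_ntimes_diff] translate. *)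
Fixpoint ntimes_diff n f : Prop :=
  if n is m.+1 then
    exists f', (forall x : R, is_derive x (1 : R) f (f' x)) /\ ntimes_diff m f'
  else True.

Lemma ntimes_diffW n f : ntimes_diff n.+1 f -> ntimes_diff n f.
Proof.
elim: n f => // n IH f [f' [df f'n]]; exists f'; split => //; exact: IH.
Qed.

Lemma ntimes_diffD n f g : ntimes_diff n f -> ntimes_diff n g ->
  ntimes_diff n (fun x => f x + g x).
Proof.
elim: n f g => // n IH f g [f' [df f'n]] [g' [dg g'n]].
exists (fun x => f' x + g' x); split; last exact: IH.
by move=> x; exact: derD.
Qed.

Lemma ntimes_diffM n f g : ntimes_diff n f -> ntimes_diff n g ->
  ntimes_diff n (fun x => f x * g x).
Proof.
elim: n f g => // n IH f g fn gn.
have [f' [df f'n]] := fn; have [g' [dg g'n]] := gn.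
exists (fun x => f' x * g x + f x * g' x); split.
  by move=> x; exact: derM.
by apply: ntimes_diffD; apply: IH => //; exact: ntimes_diffW.
Qed.

Lemma ntimes_diff_cst n (c : R) : ntimes_diff n (fun=> c).
Proof.
elim: n c => // n IH c; exists (fun=> 0); split => // x; exact: is_derive_cst.
Qed.

Lemma ntimes_diffZ n (c : R) f : ntimes_diff n f -> ntimes_diff n (fun x => c * f x).
Proof. exact/ntimes_diffM/ntimes_diff_cst. Qed.

Lemma ntimes_diff_affine n f (c d : R) : ntimes_diff n f ->
  ntimes_diff n (fun x => f (c * x + d)).
Proof.
elim: n f => // n IH f [f' [df f'n]].
exists (fun x => c * f' (c * x + d)); split; last exact/ntimes_diffZ/IH.
move=> x; rewrite mulrC; apply: der_comp => //; exact: der_affine.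
Qed.

Lemma ntimes_diff_expR n (c : R) : ntimes_diff n (fun x => expR (c * x)).
Proof.
elim: n => // n IH; exists (fun x => c * expR (c * x)); split; last exact: ntimes_diffZ.
move=> x; rewrite mulrC; apply: der_comp => //.
by apply: (is_derive_eq (derZ c (is_derive_id x 1))); rewrite mulr1.
Qed.

Lemma ntimes_diff_derivable f : (forall n, ntimes_diff n f) ->
  forall n (x : R), derivable (derive1n n f) x 1.
Proof.
move=> fs n; move: (fs n.+1); elim: n f {fs} => [|n IH] f [f' [df f'n]] x.
  by case: (df x).
rewrite derive1Sn (_ : derive1 f = f'); first exact: IH.
by apply/funext => y; rewrite derive1E; case: (df y).
Qed.

Lemma derive1_is_derive f f' : (forall x : R, is_derive x (1 : R) f (f' x)) ->
  derive1 f = f'.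
Proof. by move=> df; apply/funext => x; rewrite derive1E; case: (df x). Qed.

Lemma test_function_is_derive a b f : test_function a b f ->
  forall x : R, is_derive x (1 : R) f (derive1 f x).
Proof. by move=> [fs _] x; rewrite derive1E; apply: derivableP; exact: (fs 0%N). Qed.

Lemma derive1n_ntimes_diff f : (forall n (x : R), derivable (derive1n n f) x 1) ->
  forall n, ntimes_diff n f.
Proof.
move=> fs n; elim: n f fs => // n IH f fs; exists (derive1 f); split.
  by move=> x; rewrite derive1E; apply: derivableP; exact: (fs 0%N).
by apply: IH => m x; have := fs m.+1 x; rewrite derive1Sn.
Qed.

End Derivatives.

(** * Smooth bump functions *)

Section Bump.
Context {R : realType}.

(** The case [m = 0] is the classical flat function; the negative powers of [x] are included because
    they appear on differentiation, and the whole family is closed under it. *)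
Let flat m (x : R) : R := if 0 < x then x^-1 ^+ m * expR (- x^-1) else 0.

(** One term of the exponential series: [expR (1/x)] is at least [(1/x)^(m+1) / (m+1)!]. *)
Let flat_le m x : `|flat m x| <= (m.+1)`!%:R * `|x|.
Proof.
rewrite /flat; case: ifPn => x0; last by rewrite normr0 mulr_ge0.
rewrite (gtr0_norm x0) ger0_norm ?mulr_ge0 ?expR_ge0 ?exprn_ge0 ?invr_ge0 ?(ltW x0)//.
have := expR_ge1Dxn m (ltW (_ : 0 < x^-1)); rewrite invr_gt0 => /(_ x0) H.
have {}H : x^-1 ^+ m.+1 / (m.+1)`!%:R <= expR x^-1.
  by apply: le_trans H; rewrite lerDr.
rewrite expRN ler_pdivrMr ?expR_gt0// mulrAC -ler_pdivrMr// mulrC.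
by move: H; rewrite ler_pdivrMr ?ltr0n ?fact_gt0// exprS mulrC [leRHS]mulrC mulrC.
Qed.

Let flat_cvg0 m : flat m x @[x --> (0 : R)] --> (0 : R).
Proof.
have c1 : (m.+1)`!%:R * `|x| @[x --> (0 : R)] --> (0 : R).
  rewrite -[X in _ --> X](mulr0 (m.+1)`!%:R) -{2}(normr0 R).
  by apply: cvgMr; exact: norm_continuous.
have c2 : - ((m.+1)`!%:R * `|x|) @[x --> (0 : R)] --> (0 : R).
  by rewrite -[X in _ --> X]oppr0; exact: cvgN.
apply: squeeze_cvgr c2 c1; apply: nearW => x.
by rewrite -ler_norml flat_le.
Qed.

Let flat_derive m (x : R) :
  is_derive x (1 : R) (flat m) (- m%:R * flat m.+1 x + flat m.+2 x).
Proof.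
have [x0|x0|->] := ltgtP x 0.
- apply: (@near_eq_is_derive _ _ _ (fun=> 0)).
    near=> y; rewrite /flat ltNge ltW//.
    by near: y; exact: lt_nbhsl.
  rewrite /flat ltNge ltW//= mulr0 addr0; exact: is_derive_cst.
- apply: (@near_eq_is_derive _ _ _ (fun y : R => y^-1 ^+ m * expR (- y^-1) : R)).
    near=> y; rewrite /flat ifT//.
    by near: y; exact: lt_nbhsr.
  rewrite /flat x0.
  have dV : is_derive x (1 : R) (fun y : R => y^-1) (- x^-1 ^+ 2).
    have xn : id x != 0 by rewrite gt_eqF.
    apply: (is_derive_eq (is_deriveV xn (is_derive_id x 1))).
    by rewrite /GRing.scale /= mulr1 exprVn.
  have d1 : is_derive x (1 : R) (fun y : R => y^-1 ^+ m)
      (m%:R * x^-1 ^+ m.-1 * - x^-1 ^+ 2).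
    apply: (der_comp (f := fun y : R => y ^+ m) _ dV).
    exact: derX.
  have d2 : is_derive x (1 : R) (fun y : R => expR (- y^-1))
      (expR (- x^-1) * - - x^-1 ^+ 2).
    have dN : is_derive x (1 : R) (fun y : R => - y^-1) (- - x^-1 ^+ 2).
      exact: is_deriveN.
    exact: (der_comp (g := fun y : R => - y^-1) (is_derive_expR _) dN).
  apply: (is_derive_eq (derM d1 d2)).
  rewrite /GRing.scale /=; case: m {d1} => [|m]; rewrite ?exprS; ring.
- rewrite /flat ltxx mulr0 addr0.
  (* The difference quotient of [flat m] at 0 is [flat m.+1], which is continuous there with value
     0. *)
  apply/is_derive1_caratheodory; exists (flat m.+1); split.
  + move=> z; rewrite ltxx !subr0 /flat; case: ifPn => z0; last by rewrite mul0r.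
    rewrite exprS; set a := _ ^+ m; set e := expR _.
    have -> : z^-1 * a * e * z = z^-1 * z * (a * e) by ring.
    by rewrite mulVf ?gt_eqF// mul1r.
  + by rewrite /prop_for /continuous_at {2}/flat ltxx; exact: flat_cvg0.
  + by rewrite /flat ltxx.
Unshelve. all: by end_near. Qed.

Lemma flat_smooth n m : ntimes_diff n (flat m).
Proof.
elim: n m => // n IH m.
exists (fun x => - m%:R * flat m.+1 x + flat m.+2 x); split; first exact: flat_derive.
by apply: ntimes_diffD => //; exact: ntimes_diffZ.
Qed.

(* [bump c d k] increases to the indicator function of [`]c, d[] as [k] grows. *)
Definition bump (c d : R) (k : nat) (x : R) : R :=
  flat 0 (k.+1%:R * x + k.+1%:R * - c) * flat 0 (- k.+1%:R * x + k.+1%:R * d).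

Lemma bump_smooth c d k n : ntimes_diff n (bump c d k).
Proof. by apply: ntimes_diffM; apply: ntimes_diff_affine; exact: flat_smooth. Qed.

Let flat01 (x : R) : 0 <= flat 0 x <= 1.
Proof.
rewrite /flat; case: ifPn => [x0|_]; last by rewrite lexx ler01.
by rewrite expr0 mul1r expR_ge0 /= -[leRHS]expR0 ler_expR oppr_le0 invr_ge0 ltW.
Qed.

Lemma bump01 c d k x : 0 <= bump c d k x <= 1.
Proof.
have /andP[a0 a1] := flat01 (k.+1%:R * x + k.+1%:R * - c).
have /andP[b0 b1] := flat01 (- k.+1%:R * x + k.+1%:R * d).
by rewrite mulr_ge0//= mulr_ile1.
Qed.

Lemma bump_eq0 c d k x : ~~ (c < x < d) -> bump c d k x = 0.
Proof.
have -> : bump c d k x = flat 0 (k.+1%:R * (x - c)) * flat 0 (k.+1%:R * (d - x)).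
  by rewrite /bump; congr (flat _ _ * flat _ _); ring.
rewrite /flat negb_and -!leNgt => /orP[h|h].
  by rewrite ifN ?mul0r// -leNgt pmulr_rle0// subr_le0.
by rewrite [X in _ * X]ifN ?mulr0// -leNgt pmulr_rle0// subr_le0.
Qed.

Let flat_cvg1 (x : R) : 0 < x -> flat 0 (k.+1%:R * x) @[k --> \oo] --> (1 : R).
Proof.
move=> x0; rewrite /flat.
have E k : expR (- (x^-1 * harmonic k)) =
    if 0 < k.+1%:R * x then (k.+1%:R * x)^-1 ^+ 0 * expR (- (k.+1%:R * x)^-1) else 0.
  by rewrite ifT ?mulr_gt0// expr0 mul1r invfM mulrC.
under eq_fun do rewrite -E.
rewrite -expR0; apply: continuous_cvg; first exact: continuous_expR.
rewrite -oppr0; apply: cvgN; rewrite -(mulr0 x^-1); apply: cvgMr.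
exact: cvg_harmonic.
Qed.

Lemma bump_cvg c d x : bump c d k x @[k --> \oo] --> (\1_`]c, d[ x : R).
Proof.
rewrite indicE mem_setE in_itv /=.
have [|xcd] := boolP (c < x < d); last first.
  by under eq_fun do rewrite bump_eq0//; exact: cvg_cst.
move=> /andP[cx xd].
have E k : flat 0 (k.+1%:R * (x - c)) * flat 0 (k.+1%:R * (d - x)) = bump c d k x.
  by rewrite /bump; congr (flat _ _ * flat _ _); ring.
under eq_fun do rewrite -E.
have c1 := @flat_cvg1 (x - c); have c2 := @flat_cvg1 (d - x).
have := cvgM (c1 _) (c2 _); rewrite mulr1 !subr_gt0.
by apply.
Qed.

End Bump.

(** * The du Bois-Reymond lemma *)

Section DuBoisReymond.
Context {R : realType}.
Notation mu := (@lebesgue_measure R).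
Implicit Types (f g h : R -> R) (a b c d : R).

(** The primitive of the zero extension of [g] is locally constant on the interval, and by Lebesgue
    differentiation its derivative is [g] almost everywhere. *)
Lemma zero_on_intervals g a b :
  mu.-integrable `]a, b[ (EFin \o g) ->
  (forall c d, a < c -> c < d -> d < b -> \int[mu]_(x in `]c, d[) g x = 0) ->
  {ae mu, forall x, x \in `]a, b[ -> g x = 0}.
Proof.
move=> gi g0; pose g1 := g \_ `]a, b[.
have g1i : mu.-integrable setT (EFin \o g1) by exact: integrable_patch.
have g1y (y : R) : mu.-integrable `]-oo, y] (EFin \o g1).
  by apply: integrableS g1i.
have aF := FTC1Ny g1y (integrable_locally (measurable_itv _) gi).
apply: ae_imply aF _ => x [_ dF] xab.
have -> : g x = g1 x by rewrite /g1 patchE mem_setE xab.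
rewrite -dF; pose F (x : R) := \int[mu]_(t in `]-oo, x]) g1 t.
suff : derive1 F x = 0 by [].
have cst_near : \forall y \near x, F x = F y.
  have aux y z : a < y -> y < z -> z < b -> F z = F y.
    move=> ay yz zb; apply/eqP; rewrite -subr_eq0 /F.
    rewrite Rintegral_itvB ?bnd_simp ?ltW//.
    rewrite -Rintegral_itv_bndo_bndc; last first.
      by apply: integrableS g1i.
    apply/eqP; rewrite -[RHS](g0 _ _ ay yz zb); apply: eq_Rintegral => t.
    rewrite inE /= in_itv /= => /andP[yt tz].
    by rewrite /g1 patchE mem_setE in_itv /= (lt_trans ay yt) (lt_trans tz zb).
  near=> y.
  have /andP[ay yb] : a < y < b.
    apply/andP; split; near: y; [apply: lt_nbhsr|apply: lt_nbhsl].
      by move: (xab); rewrite in_itv => /andP[].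
    by move: (xab); rewrite in_itv => /andP[].
  have /andP[ax xb] : a < x < b by move: (xab); rewrite in_itv.
  have [xy|yx|->//] := ltgtP x y; last exact: aux.
  by apply/esym/aux.
rewrite derive1E.
have dc := near_eq_is_derive cst_near (is_derive_cst (F x) x 1).
by case: dc.
Unshelve. all: by end_near. Qed.

Lemma bump_continuous c d k : continuous (bump c d k).
Proof.
have [f' [df _]] := bump_smooth c d k 1; exact: is_derive_continuous df.
Qed.

(** A smooth function with compact support and zero mean has a primitive with compact support. Two
    bumps suffice: in the next result one of them is fixed and balances the mean of the other. *)
Lemma bump_primitive a b c d c' d' k k' (r r' : R) :
  a < c -> c < d -> d < b -> a < c' -> c' < d' -> d' < b ->
  let psi x := r * bump c d k x + r' * bump c' d' k' x in
  \int[mu]_(x in `]a, b[) psi x = 0 ->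
  exists phi, test_function a b phi /\ derive1 phi = psi.
Proof.
move=> ac cd db ac' cd' db' psi psi0.
have cpsi : continuous psi.
  move=> x; apply: cvgD; apply: cvgMr; exact: bump_continuous.
have psi_out x : ~~ (Num.min c c' < x < Num.max d d') -> psi x = 0.
  rewrite gt_min lt_max => H.
  rewrite /psi !bump_eq0 ?mulr0 ?addr0//.
    by apply: contra H => /andP[-> ->]; rewrite !orbT.
  by apply: contra H => /andP[-> ->].
have psi_out' x : ~~ (a < x < b) -> psi x = 0.
  move=> H; apply: psi_out; apply: contra H; rewrite gt_min lt_max.
  move=> /andP[h1 h2]; apply/andP; split.
    by case/orP: h1 => h; rewrite (lt_trans _ h).
  by case/orP: h2 => h; rewrite (lt_trans h).
have ipsi : mu.-integrable setT (EFin \o psi).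
  have := integrable_patch (measurable_itv `]a, b[) (continuous_integrable_oo a b cpsi).
  apply: eq_integrable => // x _ /=; rewrite patchE mem_setE in_itv /=.
  by case: ifPn => // /psi_out' ->.
pose phi (x : R) := \int[mu]_(t in `]-oo, x]) psi t.
have dphi (x : R) : is_derive x (1 : R) phi (psi x).
  have [] := @continuous_FTC1 _ psi -oo%O x (x + 1) _ _ _ (cpsi x).
  - by rewrite ltrDl.
  - by apply: integrableS ipsi.
  - by rewrite ltNyr.
  - by move=> D E; rewrite -E derive1E; exact: derivableP.
have psiab u v : [set` Interval u v] `<=` setT ->
  \int[mu]_(x in [set` Interval u v]) psi x =
  \int[mu]_(x in [set` Interval u v] `&` `]a, b[) psi x.
  move=> _; rewrite Rintegral_mkcondr; apply: eq_Rintegral => x _.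
  rewrite patchE mem_setE in_itv /=; by case: ifPn => // /psi_out' ->.
exists phi; split; last exact: derive1_is_derive.
split.
  apply: ntimes_diff_derivable => -[//|n]; exists psi; split => //.
  by apply: ntimes_diffD; apply: ntimes_diffZ; exact: bump_smooth.
exists `[Num.min c c', Num.max d d']%classic; split.
- exact: segment_compact.
- move=> x /=; rewrite !in_itv /= ge_min le_max => /andP[h1 h2].
  apply/andP; split.
    by case/orP: h1 => h; rewrite (lt_le_trans _ h).
  by case/orP: h2 => h; rewrite (le_lt_trans h).
- move=> x /=; rewrite in_itv /= => /negP; rewrite negb_and -!ltNge => /orP[h|h].
    rewrite /phi -[RHS](Rintegral_zero mu `]-oo, x]); apply: eq_Rintegral => t.
    rewrite inE /= in_itv /= => tx; apply: psi_out.
    by rewrite negb_and -leNgt (le_trans tx (ltW h)).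
  (* To the right of the support [phi] is constant, equal to the full integral of [psi]. *)
  have <- : phi b = 0.
    rewrite /phi psiab// -[RHS]psi0; congr Rintegral; apply/seteqP; split => y /=.
      by case.
    by rewrite !in_itv /= => /andP[-> yb]; split => //; exact: ltW.
  have aux y z : Num.max d d' < y -> y < z -> phi z = phi y.
    move=> ay yz; apply/eqP; rewrite -subr_eq0 /phi.
    rewrite Rintegral_itvB ?bnd_simp ?ltW//; last by apply: integrableS ipsi.
    apply/eqP; rewrite -[RHS](Rintegral_zero mu `]y, z]); apply: eq_Rintegral => t.
    rewrite inE /= in_itv /= => /andP[yt _]; apply: psi_out.
    by rewrite negb_and -!leNgt (ltW (lt_trans ay yt)) orbT.
  have [xb|bx|->//] := ltgtP x b; first by apply/esym/aux.
  by apply: aux => //; rewrite gt_max db.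
Qed.

Lemma integral_bump_cvg h a b c d : a < c -> d < b ->
  mu.-integrable `]a, b[ (EFin \o h) ->
  \int[mu]_(x in `]a, b[) (h x * bump c d k x) @[k --> \oo] -->
  \int[mu]_(x in `]c, d[) h x.
Proof.
move=> ac db hi.
have -> : \int[mu]_(x in `]c, d[) h x =
          \int[mu]_(x in `]a, b[) (h x * \1_`]c, d[ x).
  have -> : `]c, d[%classic = `]a, b[%classic `&` `]c, d[%classic :> set R.
    apply/seteqP; split => x /=; rewrite !in_itv /=; last by case.
    by move=> /andP[cx xd]; rewrite (lt_trans ac cx) (lt_trans xd db) cx xd.
  rewrite Rintegral_mkcondr; apply: eq_Rintegral => x.
  rewrite inE => /= xab; rewrite patchE indicE.
  have -> : (x \in `]a, b[%classic `&` `]c, d[%classic) = (x \in `]c, d[%classic).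
    by rewrite in_setI mem_setE xab.
  by case: ifP => _; rewrite ?mulr1 ?mulr0.
have hm : measurable_fun `]a, b[ h by apply/measurable_EFinP; exact: measurable_int hi.
have [] // := @dominated_Rintegral _ _ R mu `]a, b[ (fun k x => h x * bump c d k x)
  (fun x => h x * \1_`]c, d[ x) (fun x => `|h x|).
- move=> k; apply: measurable_funM => //; apply: measurable_funTS.
  by apply: continuous_measurable_fun; exact: bump_continuous.
- by move=> x _; apply: cvgMr; exact: bump_cvg.
- exact: integrable_norm.
- move=> k x _; have /andP[b0 b1] := bump01 c d k x.
  by rewrite normrM (ger0_norm b0) ler_piMr.
Qed.

(** With a fixed bump of nonzero mass [I0] and pairing [J0] with [h], the pairing of [h] with any
    other bump is [J0 / I0] times its mass. Letting the bumps tend to indicators, [h - J0 / I0]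
    integrates to zero over every inner interval. *)
Lemma du_Bois_Reymond_cst h a b : a < b -> mu.-integrable `]a, b[ (EFin \o h) ->
  (forall phi, test_function a b phi ->
     \int[mu]_(x in `]a, b[) (h x * derive1 phi x) = 0) ->
  exists C, {ae mu, forall x, x \in `]a, b[ -> h x = C}.
Proof.
move=> ab hi h0.
pose c0 := a + (b - a) / 3; pose d0 := b - (b - a) / 3.
have ac0 : a < c0 by rewrite /c0; lra.
have cd0 : c0 < d0 by rewrite /c0 /d0; lra.
have db0 : d0 < b by rewrite /d0; lra.
have i1 : mu.-integrable `]a, b[ (EFin \o (fun=> 1 : R)).
  by apply: continuous_integrable_oo => x; exact: cvg_cst.
have bi c d k : mu.-integrable `]a, b[ (EFin \o bump c d k).
  by apply: continuous_integrable_oo; exact: bump_continuous.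
have hbi c d k : mu.-integrable `]a, b[ (EFin \o (fun x => h x * bump c d k x)).
  by apply: integrable_mul_continuous => //; exact: bump_continuous.
have len c d : c < d -> \int[mu]_(x in `]c, d[) (1 : R) = d - c.
  move=> cd; rewrite (@FTC2oo _ (fun x => x) (fun=> 1) c d (ltW cd)) //.
  by move=> x; exact: cvg_cst.
(* The masses of the bumps on the middle third tend to its length, so some index [k0] gives a
   nonzero mass. *)
have := integral_bump_cvg ac0 db0 i1; rewrite len//.
under eq_fun do under eq_Rintegral do rewrite mul1r.
move=> /cvgrPdist_lt /(_ (d0 - c0)); rewrite subr_gt0 => /(_ cd0) [k0 _ /(_ k0 (leqnn _))].
set I0 := Rintegral _ _ _ => /= I0near.
have I0_neq0 : I0 != 0.
  apply: contraTneq I0near => ->.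
  by rewrite subr0 gtr0_norm ?subr_gt0// ltxx.
pose J0 := \int[mu]_(x in `]a, b[) (h x * bump c0 d0 k0 x).
(* The combination [I0 * bump - I * bump0] has zero mean, hence is the derivative of a test function
   and is annihilated by [h]. *)
have key c d k : a < c -> c < d -> d < b ->
  \int[mu]_(x in `]a, b[) (h x * bump c d k x) =
  (J0 / I0) * \int[mu]_(x in `]a, b[) bump c d k x.
  move=> ac cd db.
  set I := \int[mu]_(x in `]a, b[) bump c d k x.
  have [] := @bump_primitive a b c d c0 d0 k k0 I0 (- I) ac cd db ac0 cd0 db0.
    rewrite RintegralD//; last 2 first.
    - exact: (integrableZl _ I0 (bi _ _ _)).
    - exact: (integrableZl _ (- I) (bi _ _ _)).
    by rewrite !RintegralZl// -/I -/I0; ring.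
  move=> phi [/h0 + E]; rewrite E.
  have -> : \int[mu]_(x in `]a, b[) (h x * (I0 * bump c d k x + - I * bump c0 d0 k0 x))
    = \int[mu]_(x in `]a, b[) (I0 * (h x * bump c d k x) + - I * (h x * bump c0 d0 k0 x)).
    by apply: eq_Rintegral => x _; ring.
  rewrite RintegralD//; last 2 first.
  - exact: (integrableZl _ I0 (hbi _ _ _)).
  - exact: (integrableZl _ (- I) (hbi _ _ _)).
  rewrite !RintegralZl// -/J0 => H.
  have -> : \int[mu]_(x in `]a, b[) (h x * bump c d k x) = I * J0 / I0; last by ring.
  by apply: (mulfI I0_neq0); rewrite mulrCA divff// mulr1; move: H; lra.
exists (J0 / I0).
have Zi : mu.-integrable `]a, b[ (EFin \o (fun x => h x - J0 / I0)).
  apply: integrable_fB => //.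
  by apply: continuous_integrable_oo => x; exact: cvg_cst.
have := zero_on_intervals Zi; move=> H.
apply: ae_imply (H _) _ => [c d ac cd db|x /[apply] /eqP]; last first.
  by rewrite subr_eq0 => /eqP.
have sub : `]c, d[%classic `<=` (`]a, b[%classic : set R).
  by apply: subset_itv; rewrite bnd_simp ltW.
rewrite RintegralB//; last 2 first.
- by apply: integrableS hi.
- by apply: continuous_integrable_oo => x; exact: cvg_cst.
apply/eqP; rewrite subr_eq0; apply/eqP.
have L1 := integral_bump_cvg ac db hi.
have L2 := integral_bump_cvg ac db i1.
have -> : \int[mu]_(x in `]c, d[) (J0 / I0) = J0 / I0 * \int[mu]_(x in `]c, d[) (1 : R).
  rewrite -RintegralZl//; last by apply: integrableS i1.
  by apply: eq_Rintegral => x _; rewrite mulr1.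
have L3 : (fun k => \int[mu]_(x in `]a, b[) (h x * bump c d k x)) =
    (fun k => J0 / I0 * \int[mu]_(x in `]a, b[) bump c d k x).
  by apply/funext => k; exact: key.
rewrite L3 in L1; apply: (cvg_unique _ L1) => //.
apply: cvgMr; move: L2.
by under eq_fun do under eq_Rintegral do rewrite mul1r.
Qed.

Lemma primitive_continuous f a b : a <= b -> mu.-integrable `]a, b[ (EFin \o f) ->
  {within `[a, b], continuous (fun x => \int[mu]_(t in `]a, x[) f t)}.
Proof.
move=> ab fi; pose f1 := f \_ `]a, b[.
have f1i : mu.-integrable setT (EFin \o f1) by exact: integrable_patch.
have f1ab : mu.-integrable `[a, b] (EFin \o f1) by apply: integrableS f1i.
apply: subspace_eq_continuous (parameterized_integral_continuous ab f1ab) => x.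
rewrite inE /= in_itv /= => /andP[ax xb].
rewrite /from_subspace /= /parameterized_integral -Rintegral_itv_obnd_cbnd; last first.
  by apply: integrableS f1i.
rewrite -Rintegral_itv_bndo_bndc; last by apply: integrableS f1i.
apply: eq_Rintegral => t; rewrite inE /= in_itv /= => /andP[at_ tx].
by rewrite /f1 patchE mem_setE in_itv /= at_ (lt_le_trans tx xb).
Qed.

Lemma within_continuous_integrable_oo f a b : {within `[a, b], continuous f} ->
  mu.-integrable `]a, b[ (EFin \o f).
Proof.
move=> cf; apply: (@integrableS _ _ _ mu `[a, b]) => //.
  exact: subset_itv_oo_cc.
by apply: continuous_compact_integrable => //; exact: segment_compact.
Qed.

Lemma primitive_integrable f a b : a <= b -> mu.-integrable `]a, b[ (EFin \o f) ->
  mu.-integrable `]a, b[ (EFin \o (fun x => \int[mu]_(t in `]a, x[) f t)).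
Proof. by move=> ab fi; exact/within_continuous_integrable_oo/primitive_continuous. Qed.

Lemma test_function_out a b (phi : R -> R) x : test_function a b phi ->
  ~~ (a < x < b) -> phi x = 0.
Proof.
move=> [_ [K [_ Kab K0]]] xab; apply: K0 => /Kab.
by rewrite /= in_itv /=; exact/negP.
Qed.

(** Integration by parts against [phi], which vanishes at [b], shows that [h] minus the primitive of
    [f] has weak derivative zero. *)
Lemma du_Bois_Reymond h f a b : a < b ->
  mu.-integrable `]a, b[ (EFin \o h) -> mu.-integrable `]a, b[ (EFin \o f) ->
  (forall phi, test_function a b phi ->
     \int[mu]_(x in `]a, b[) (h x * derive1 phi x) =
     - \int[mu]_(x in `]a, b[) (f x * phi x)) ->
  exists C, {ae mu, forall x, x \in `]a, b[ ->
    h x = C + \int[mu]_(t in `]a, x[) f t}.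
Proof.
move=> ab hi fi hf; pose F (x : R) := \int[mu]_(t in `]a, x[) f t.
have Fi : mu.-integrable `]a, b[ (EFin \o F) by exact: primitive_integrable (ltW ab) fi.
have [C hC] : exists C, {ae mu, forall x, x \in `]a, b[ -> h x - F x = C}.
  apply: du_Bois_Reymond_cst => // [|phi tphi].
    exact: integrable_fB.
  have dphi := test_function_is_derive tphi.
  have [f1 [df1 [f2 [df2 _]]]] := derive1n_ntimes_diff (proj1 tphi) 2.
  have E : derive1 phi = f1 by exact: derive1_is_derive.
  have cf1 : continuous (derive1 phi) by rewrite E; exact: is_derive_continuous df2.
  have := absolutely_continuous_by_parts (ltW ab) fi dphi cf1.
  rewrite (test_function_out (x := b) tphi) ?ltxx ?andbF// mulr0 => H.
  have -> : \int[mu]_(x in `]a, b[) ((h x - F x) * derive1 phi x) =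
     \int[mu]_(x in `]a, b[) (h x * derive1 phi x - F x * derive1 phi x).
    by apply: eq_Rintegral => x _; rewrite mulrBl.
  rewrite RintegralB//.
  - by rewrite hf// -opprD H oppr0.
  - exact: integrable_mul_continuous.
  - exact: integrable_mul_continuous.
exists C; apply: ae_imply hC _ => x /[apply] /eqP.
by rewrite subr_eq => /eqP.
Qed.

End DuBoisReymond.

(** * The space H^1(0,1) *)

Section SobolevH1.
Context {R : realType}.
Notation mu := (@lebesgue_measure R).
Implicit Types (f g h v dv G k : R -> R) (a b c d : R).

Lemma ae_eq_continuous f g a b : a < b ->
  {within `[a, b], continuous f} -> {within `[a, b], continuous g} ->
  {ae mu, forall x, x \in `]a, b[ -> f x = g x} ->
  forall x, a <= x <= b -> f x = g x.
Proof.
move=> ab cf cg [N [mN N0 sN]] x /andP[ax xb]; apply/eqP; rewrite -subr_eq0.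
apply/negPn/negP => Dx.
have cfg : {within `[a, b], continuous (fun x => f x - g x)}.
  exact: within_continuousB.
have /subspace_continuousP/(_ x) := cfg.
rewrite /= in_itv /= ax xb => /(_ isT) /cvgrPdist_lt /(_ `|f x - g x|).
rewrite normr_gt0 => /(_ Dx) [e /= e0 He].
(* The ball is clipped to the interval so that [x] may be an end point; the clipped interval still
   has positive length and would lie in the null set. *)
pose c := Num.max a (x - e); pose d := Num.min b (x + e).
have cd : c < d.
  rewrite gt_max !lt_min; apply/andP; split; apply/andP; split; lra.
have sub : `]c, d[%classic `<=` N.
  move=> y /=; rewrite in_itv /= gt_max lt_min.
  move=> /andP[/andP[ay xey] /andP[yb yxe]]; apply: sN => /=.
  rewrite in_itv /= ay yb => /(_ isT) E.
  have := He y; rewrite /ball /= in_itv /= (ltW ay) (ltW yb).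
  rewrite /from_subspace /=.  rewrite E subrr subr0 ltxx => H; suff : false by []; apply: H => //.
  by rewrite ltr_norml; apply/andP; split; lra.
have : (mu `]c, d[%classic <= mu N)%E.
  by apply: (@le_measure _ _ _ mu) => //; rewrite inE //; exact: measurable_itv.
by rewrite N0 lebesgue_measure_itv /= lte_fin cd -EFinD lee_fin subr_le0 leNgt cd.
Qed.

Lemma ge0_itv01 : mu `]0, 1[%classic = 1%E.
Proof. by rewrite lebesgue_measure_itv /= lte_fin ltr01 -EFinD subr0. Qed.

Lemma in_L2_integrable01 f : in_L2 mu `]0, 1[ f -> mu.-integrable `]0, 1[ (EFin \o f).
Proof. by apply: in_L2_integrable => //; exact: itvoo_lty. Qed.

Lemma Rintegral_cst01 c : \int[mu]_(x in `]0, 1[) c = c.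
Proof.
rewrite Rintegral_cst// (_ : fine _ = 1) ?mulr1//.
exact: (congr1 fine ge0_itv01).
Qed.

(* The variance of [f] is nonnegative. *)
Lemma sqr_Rintegral01 f : in_L2 mu `]0, 1[ f ->
  (\int[mu]_(x in `]0, 1[) f x) ^+ 2 <= \int[mu]_(x in `]0, 1[) (f x ^+ 2).
Proof.
move=> f2; have fi := in_L2_integrable01 f2.
have f2i : mu.-integrable `]0, 1[ (EFin \o (fun x => f x ^+ 2)).
  exact: in_L2_integrable_sqr.
set m := \int[mu]_(x in _) f x.
have : 0 <= \int[mu]_(x in `]0, 1[) ((f x - m) ^+ 2).
  by apply: Rintegral_ge0 => x _; exact: sqr_ge0.
have ci c : mu.-integrable `]0, 1[ (EFin \o (fun=> c)).
  by apply: continuous_integrable_oo => x; exact: cvg_cst.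
have -> : \int[mu]_(x in `]0, 1[) ((f x - m) ^+ 2) =
          \int[mu]_(x in `]0, 1[) (f x ^+ 2 + (- 2 * m) * f x + m ^+ 2).
  by apply: eq_Rintegral => x _; ring.
rewrite RintegralD//; last by apply: integrable_fD => //; exact: integrable_fZ.
rewrite RintegralD//; last exact: integrable_fZ.
rewrite RintegralZl// -/m Rintegral_cst01; lra.
Qed.

Lemma H1_primitive v dv : in_H1 v dv -> exists C,
  {ae mu, forall x, x \in `]0, 1[ -> v x = C + \int[mu]_(t in `]0, x[) dv t}.
Proof.
move=> [v2 dv2 vdv].
by apply: du_Bois_Reymond => //; exact: in_L2_integrable01.
Qed.

Lemma H1_by_parts_primitive v dv C G k : in_H1 v dv ->
  {ae mu, forall x, x \in `]0, 1[ -> v x = C + \int[mu]_(t in `]0, x[) dv t} ->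
  (forall x : R, is_derive x (1 : R) G (k x)) -> continuous k -> G 0 = 0 ->
  \int[mu]_(x in `]0, 1[) (dv x * G x) + \int[mu]_(x in `]0, 1[) (v x * k x) =
  (C + \int[mu]_(t in `]0, 1[) dv t) * G 1.
Proof.
move=> [v2 dv2 _] vC dG ck G0.
have dvi := in_L2_integrable01 dv2; have vi := in_L2_integrable01 v2.
have Fi := primitive_integrable ler01 dvi.
have ci c : mu.-integrable `]0, 1[ (EFin \o (fun=> c)).
  by apply: continuous_integrable_oo => x; exact: cvg_cst.
have -> : \int[mu]_(x in `]0, 1[) (v x * k x) =
    \int[mu]_(x in `]0, 1[) ((C + \int[mu]_(t in `]0, x[) dv t) * k x).
  apply: ae_eq_Rintegral => //.
  - by apply/measurable_EFinP; apply: measurable_int; exact: integrable_mul_continuous.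
  - apply/measurable_EFinP; apply: (measurable_int mu).
    by apply: integrable_mul_continuous => //; exact: integrable_fD.
  - by apply: ae_imply vC _ => x /= H xD; rewrite H.
have -> : \int[mu]_(x in `]0, 1[) ((C + \int[mu]_(t in `]0, x[) dv t) * k x) =
  \int[mu]_(x in `]0, 1[) (C * k x + (\int[mu]_(t in `]0, x[) dv t) * k x).
  by apply: eq_Rintegral => x _; rewrite mulrDl.
have ki := continuous_integrable_oo 0 1 ck.
rewrite RintegralD//; [|exact: integrable_fZ|exact: integrable_mul_continuous].
rewrite RintegralZl// (FTC2oo ler01 dG ck) G0 subr0 addrCA.
by rewrite (absolutely_continuous_by_parts ler01 dvi dG ck) mulrDl.
Qed.

Lemma continuous_primitiveD C f : mu.-integrable `]0, 1[ (EFin \o f) ->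
  {within `[0, 1], continuous (fun x => C + \int[mu]_(t in `]0, x[) f t)}.
Proof.
move=> fi; apply: within_continuousD; last exact: primitive_continuous.
by apply: continuous_subspaceT => x; exact: cvg_cst.
Qed.

Lemma H1_trace_exists v dv : in_H1 v dv -> exists c, space_trace v 1 c.
Proof.
move=> vH1; have [C vC] := H1_primitive vH1; have [_ dv2 _] := vH1.
exists (C + \int[mu]_(t in `]0, 1[) dv t).
exists (fun x => C + \int[mu]_(t in `]0, x[) dv t); split => //.
  exact/continuous_primitiveD/in_L2_integrable01.
by apply: ae_imply vC _ => x H /H.
Qed.

(** Any continuous representative agrees with the primitive of [dv] up to the end point 1, so its
    value there is the boundary term; [G 0 = 0] removes the one at 0, where no trace is given. *)
Lemma H1_by_parts v dv c G k : in_H1 v dv -> space_trace v 1 c ->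
  (forall x : R, is_derive x (1 : R) G (k x)) -> continuous k -> G 0 = 0 ->
  \int[mu]_(x in `]0, 1[) (dv x * G x) + \int[mu]_(x in `]0, 1[) (v x * k x) =
  c * G 1.
Proof.
move=> vH1 [w [cw wv <-]] dG ck G0; have [C vC] := H1_primitive vH1.
have [_ dv2 _] := vH1.
rewrite (H1_by_parts_primitive vH1 vC dG ck G0); congr (_ * _).
apply: (ae_eq_continuous (f := fun x => C + \int[mu]_(t in `]0, x[) dv t)
   ltr01 _ cw _) => //; last by rewrite lexx ler01.
  exact/continuous_primitiveD/in_L2_integrable01.
by apply: ae_imply2 vC wv _ => x H1 H2 xD; rewrite H2// H1.
Qed.

Lemma in_L2_continuous f : continuous f -> in_L2 mu `]0, 1[ f.
Proof.
move=> cf; have [C fC] := continuous_bounded_itv 0 1 cf.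
apply: (in_L2_bounded (C := C)) => //; first exact: itvoo_lty.
- by apply: measurable_funTS; exact: continuous_measurable_fun.
- by move=> x /=; rewrite in_itv /= => /andP[/ltW ? /ltW ?]; apply: fC; apply/andP.
Qed.

Lemma C1_in_H1 G k : (forall x : R, is_derive x (1 : R) G (k x)) -> continuous k ->
  in_H1 G k.
Proof.
move=> dG ck; have cG := is_derive_continuous dG.
split; [exact: in_L2_continuous|exact: in_L2_continuous|move=> phi tphi].
have dphi := test_function_is_derive tphi.
have [f1 [df1 [f2 [df2 _]]]] := derive1n_ntimes_diff (proj1 tphi) 2.
have E : derive1 phi = f1 by exact: derive1_is_derive.
have cf1 : continuous (derive1 phi) by rewrite E; exact: is_derive_continuous df2.
have cphi := is_derive_continuous dphi.
have ck1 : continuous (fun x => k x * phi x) by move=> x; apply: cvgM; [exact: ck|exact: cphi].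
have ck2 : continuous (fun x => G x * derive1 phi x).
  by move=> x; apply: cvgM; [exact: cG|exact: cf1].
have ckk : continuous (fun x => k x * phi x + G x * derive1 phi x).
  by move=> x; apply: cvgD; [exact: ck1|exact: ck2].
have := FTC2oo ler01 (fun x => derM (dG x) (dphi x)) ckk.
rewrite RintegralD//; try exact: continuous_integrable_oo.
rewrite !(test_function_out tphi) ?ltxx ?andbF// !mulr0 subrr => /eqP.
by rewrite addrC addr_eq0 => /eqP.
Qed.

Lemma space_trace_continuous f x : continuous f -> space_trace f x (f x).
Proof.
move=> cf; exists f; split => //; first exact: continuous_subspaceT.
exact: aeW.
Qed.

Lemma cos_natpi n : cos (n%:R * pi) = (-1) ^+ n :> R.
Proof.
elim: n => [|n IH]; first by rewrite mul0r cos0.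
by rewrite -natr1 mulrDl mul1r cosDpi IH exprS mulN1r.
Qed.

Lemma sin_natpi n : sin (n%:R * pi) = 0 :> R.
Proof.
elim: n => [|n IH]; first by rewrite mul0r sin0.
by rewrite -natr1 mulrDl mul1r sinDpi IH oppr0.
Qed.

Lemma der_cos (w x : R) :
  is_derive x (1 : R) (fun y => cos (w * y)) (- (w * sin (w * x))).
Proof.
have dl : is_derive x (1 : R) (fun y => w * y) w.
  by apply: (is_derive_eq (derZ w (is_derive_id x 1))); rewrite mulr1.
by apply: (is_derive_eq (der_comp (is_derive_cos (w * x)) dl)); ring.
Qed.

Lemma der_sin (w x : R) : is_derive x (1 : R) (fun y => sin (w * y)) (w * cos (w * x)).
Proof.
have dl : is_derive x (1 : R) (fun y => w * y) w.
  by apply: (is_derive_eq (derZ w (is_derive_id x 1))); rewrite mulr1.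
by apply: (is_derive_eq (der_comp (is_derive_sin (w * x)) dl)); ring.
Qed.

Lemma continuous_cos_mul (w : R) : continuous (fun x => cos (w * x)).
Proof. exact: is_derive_continuous (der_cos w). Qed.

Lemma continuous_sin_mul (w : R) : continuous (fun x => sin (w * x)).
Proof. exact: is_derive_continuous (der_sin w). Qed.

Lemma cos_in_H1 (w : R) : in_H1 (fun x => cos (w * x)) (fun x => - (w * sin (w * x))).
Proof.
apply: C1_in_H1 => [x|x]; first exact: der_cos.
by apply: cvgN; apply: cvgMr; exact: continuous_sin_mul.
Qed.

(* The boundary terms vanish because [sin (n pi x)] does at both end points. *)
Lemma H1_sin_coef v dv n : in_H1 v dv ->
  \int[mu]_(x in `]0, 1[) (dv x * sin (n%:R * pi * x)) =
  - (n%:R * pi * \int[mu]_(x in `]0, 1[) (v x * cos (n%:R * pi * x))).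
Proof.
move=> vH1; have [c tr] := H1_trace_exists vH1; have [v2 _ _] := vH1.
have ck : continuous (fun x : R => n%:R * pi * cos (n%:R * pi * x)).
  by move=> x; apply: cvgMr; exact: continuous_cos_mul.
have := H1_by_parts vH1 tr (der_sin (n%:R * pi)) ck.
rewrite mulr0 sin0 mulr1 sin_natpi mulr0 => /(_ erefl) /eqP.
rewrite addr_eq0 => /eqP ->; rewrite -RintegralZl//.
  by congr (- _); apply: eq_Rintegral => x _; ring.
by apply: integrable_mul_continuous; [exact: in_L2_integrable01|exact: continuous_cos_mul].
Qed.

End SobolevH1.

(** * Dominated series *)

Section SeriesToolkit.
Context {R : realType}.
Implicit Types (a b B : nat -> R).

Lemma series_dominated a B : (forall n, `|a n| <= B n) -> cvgn (series B) ->
  cvgn (series a).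
Proof.
move=> aB cB; apply: normed_cvg; apply: series_le_cvg cB => n.
- exact: normr_ge0.
- exact: le_trans (normr_ge0 _) (aB n).
- exact: aB.
Qed.

Lemma series_le_lim B N : (forall n, 0 <= B n) -> cvgn (series B) ->
  series B N <= limn (series B).
Proof.
move=> B0 cB; apply: nondecreasing_cvgn_le => //; apply/nondecreasing_seqP => n.
by rewrite /series /= big_nat_recr //= lerDl.
Qed.

Lemma series_sub_le a B (M N : nat) : (forall n, `|a n| <= B n) -> (N <= M)%N ->
  `|series a M - series a N| <= series B M - series B N.
Proof.
move=> aB NM; rewrite /series /= !sub_series_geq//.
by apply: le_trans (ler_norm_sum _ _ _) _; apply: ler_sum.
Qed.

Lemma series_tail_le a B N : (forall n, `|a n| <= B n) -> cvgn (series B) ->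
  `|limn (series a) - series a N| <= limn (series B) - series B N.
Proof.
move=> aB cB; have ca := series_dominated aB cB.
have c1 : `|series a M - series a N| @[M --> \oo] --> `|limn (series a) - series a N|.
  by apply: cvg_norm; apply: cvgB => //; exact: cvg_cst.
have c2 : series B M - series B N @[M --> \oo] --> limn (series B) - series B N.
  by apply: cvgB => //; exact: cvg_cst.
apply: (ler_cvg_to c1 c2); near=> M; apply: series_sub_le => //.
by near: M; exact: nbhs_infty_ge.
Unshelve. all: by end_near. Qed.

Lemma series0 a : series a 0 = 0.
Proof. by rewrite /series /= big_geq. Qed.

Lemma series_norm_le a B : (forall n, `|a n| <= B n) -> cvgn (series B) ->
  forall N, `|series a N| <= limn (series B).
Proof.
move=> aB cB N; have B0 n : 0 <= B n by apply: le_trans (normr_ge0 _) (aB n).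
have := series_sub_le aB (leq0n N).
rewrite !series0 !subr0 => /le_trans; apply; exact: series_le_lim.
Qed.

Lemma lim_series_norm_le a B : (forall n, `|a n| <= B n) -> cvgn (series B) ->
  `|limn (series a)| <= limn (series B).
Proof.
move=> aB cB; have := series_tail_le 0 aB cB.
by rewrite !series0 !subr0.
Qed.

(** Tannery's theorem: the tails are below [e / 3] uniformly in [i], and a finite sum converges. The
    filter is general because the limit is taken in [x], in [t] within [[0, T]], at punctured
    neighbourhoods and along partial sums. *)
Lemma series_dominated_cvg (I : Type) (F : set_system I) {FF : Filter F}
    (f : I -> nat -> R) (l : nat -> R) B :
  cvgn (series B) -> (\forall i \near F, forall n, `|f i n| <= B n) ->
  (forall n, `|l n| <= B n) ->
  (forall n, f i n @[i --> F] --> l n) ->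
  limn (series (f i)) @[i --> F] --> limn (series l).
Proof.
move=> cB fB lB fl; apply/cvgrPdist_lt => e e0.
have [N _ HN] : \forall N \near \oo, `|limn (series B) - series B N| < e / 3.
  by move/cvgrPdist_lt : (cB) => /(_ (e / 3)); apply; rewrite divr_gt0.
have {}HN := HN N (leqnn N).
have : series (f i) N @[i --> F] --> series l N.
  elim: N {HN} => [|N IH].
    by under eq_fun do rewrite series0; rewrite series0; exact: cvg_cst.
  move: IH; rewrite /series /= => IH.
  under eq_fun do rewrite big_nat_recr//=; rewrite big_nat_recr//=.
  exact: cvgD.
move/cvgrPdist_lt => /(_ (e / 3)); rewrite divr_gt0// => /(_ isT) H.
near=> i.
have H1 : `|series l N - series (f i) N| < e / 3 by near: i.
have fBi : forall n, `|f i n| <= B n by near: i.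
have H2 := series_tail_le N lB cB; have H3 := series_tail_le N fBi cB.
have H4 := le_lt_trans (ler_norm _) HN.
move: H1 H2 H3; rewrite !ltr_norml !ler_norml.
move=> /andP[h1 h2] /andP[h3 h4] /andP[h5 h6].
by apply/andP; split; lra.
Unshelve. all: by end_near. Qed.

Lemma lim_seriesB_le a b B : (forall n, `|a n - b n| <= B n) ->
  cvgn (series a) -> cvgn (series b) -> cvgn (series B) ->
  `|limn (series a) - limn (series b)| <= limn (series B).
Proof.
move=> abB ca cb cB; have := lim_seriesB ca cb => <-.
exact: lim_series_norm_le.
Qed.

End SeriesToolkit.

Section IntegralToolkit2.
Context d (X : measurableType d) (R : realType).
Variable m : {measure set X -> \bar R}.

(** Meant for the dual norm of the time derivative, a supremum over an uncountable family: the
    integral of a nonnegative function is a supremum over simple functions below it, which is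
    monotone by construction. *)
Lemma ge0_le_integral_nonmeasurable (D : set X) (f g : X -> \bar R) :
  (forall x, D x -> (0 <= f x)%E) -> (forall x, D x -> (f x <= g x)%E) ->
  (\int[m]_(x in D) f x <= \int[m]_(x in D) g x)%E.
Proof.
move=> f0 fg; have g0 x : D x -> (0 <= g x)%E by move=> Dx; exact: le_trans (f0 x Dx) (fg x Dx).
rewrite !ge0_integralE//; apply: le_ereal_sup => _ [h hf <-]; exists h => // x.
apply: le_trans (hf x) _; rewrite /patch; case: ifPn => //.
by rewrite inE; exact: fg.
Qed.

End IntegralToolkit2.

Section ProductL2.
Context {R : realType}.
Notation mu := (@lebesgue_measure R).

Let rect (T : R) : set (measurableTypeR R * measurableTypeR R) :=
  `]0, T[%classic `*` `]0, 1[%classic.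

Lemma measurable_rect (T : R) : measurable (rect T).
Proof. by apply: measurableX; exact: measurable_itv. Qed.

Lemma measurable_rect_snd (T : R) (h : R -> R) : measurable_fun (`]0, 1[%classic : set R) h ->
  measurable_fun (rect T) (fun z => h z.2).
Proof.
move=> mh; apply: (@measurable_comp _ _ _ _ _ _
  (`]0, 1[%classic : set (measurableTypeR R)) h (rect T) snd) => //.
  by move=> _ [z [_ z2] <-].
exact: measurable_funTS measurable_snd.
Qed.

Lemma measurable_rect_fst (T : R) (h : R -> R) : measurable_fun (`]0, T[%classic : set R) h ->
  measurable_fun (rect T) (fun z => h z.1).
Proof.
move=> mh; apply: (@measurable_comp _ _ _ _ _ _
  (`]0, T[%classic : set (measurableTypeR R)) h (rect T) fst) => //.
  by move=> _ [z [z1 _] <-].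
exact: measurable_funTS measurable_fst.
Qed.

Lemma in_L2_snd (T : R) (h : R -> R) : in_L2 mu `]0, 1[ h ->
  in_L2 (mu \x mu)%E (rect T) (fun z => h z.2).
Proof.
move=> h2; have [mh hi] := h2.
have mrect := measurable_rect T; have mh2 := measurable_rect_snd (T := T) mh.
split => //; rewrite integral_mkcond.
pose H := (fun z : measurableTypeR R * measurableTypeR R => ((h z.2) ^+ 2)%:E) \_ (rect T).
have H0 z : (0 <= H z)%E.
  by rewrite /H patchE; case: ifP => // _; rewrite lee_fin sqr_ge0.
have mH : measurable_fun setT H.
  apply/(measurable_restrictT _ mrect).
  by apply/measurable_EFinP; exact: measurable_funX.
rewrite (fubini_tonelli1 _ mH H0).
have E x : fubini_F mu H x =
    ((fun=> (\int[mu]_(x in `]0%R, 1%R[) ((h x) ^+ 2)%:E)%E) \_ `]0, T[%classic) x.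
  rewrite /fubini_F patchE; case: ifPn => xT.
    rewrite [RHS]integral_mkcond; apply: eq_integral => y _.
    rewrite /H !patchE; congr (if _ then _ else _).
    by rewrite in_setX xT.
  rewrite -[RHS](integral0 mu setT); apply: eq_integral => y _.
  by rewrite /H patchE in_setX (negbTE xT).
under eq_integral do rewrite E.
rewrite -integral_mkcond integral_cst//.
by rewrite lte_mul_pinfty ?integral_ge0 ?itvoo_lty// ?ge0_fin_numE ?integral_ge0// => x _;
  rewrite lee_fin sqr_ge0.
Qed.

End ProductL2.

(** * Cosine series in time and space *)

(** Here [(a + b)^2 <= 2 (a^2 + b^2) <= 2]; this bounds the trace on the unit ball of H^1. *)
Lemma norm_sum_le2 (R : realFieldType) (a b s p q : R) :
  p + q <= 1 -> a ^+ 2 <= s -> b ^+ 2 <= p -> s <= q -> `|a + b| <= 2.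
Proof.
move=> H1 H2 H3 H4; rewrite -(ler_pXn2r (n := 2)) ?nnegrE//.
by rewrite real_normK ?num_real//; have := sqr_ge0 (a - b); nra.
Qed.

Lemma mul_le_half_sum_sqr (R : realFieldType) (a b c : R) :
  0 <= a -> 0 <= b -> a <= c -> a * b <= 2^-1 * (c ^+ 2 + b ^+ 2).
Proof.
move=> a0 b0 ac; apply: (@le_trans _ _ (c * b)); first exact: ler_wpM2r.
have := sqr_ge0 (c - b); lra.
Qed.

Section CosineSeries.
Context {R : realType}.
Notation mu := (@lebesgue_measure R).
Variables (T : R) (nu : nat -> nat) (al : nat -> R -> R) (A : nat -> R).
Variables (h : R -> R) (eps delta : R) (ka : nat -> R) (u : R -> R).
Variables (dy : R -> R -> R).
Hypothesis T_gt0 : 0 < T.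

Let om n : R := (nu n)%:R * pi.
Let mode n (x : R) := cos (om n * x).
Let dmode n (x : R) := - (om n * sin (om n * x)).
Let coef n (v : R -> R) := \int[mu]_(x in `]0, 1[) (v x * mode n x).
(** The time derivative of [al n] in the weak sense. The state has [eps = 1], the adjoint state,
    running backwards, [eps = -1]. The numbers [ka n] expand the boundary functional [delta * v(1)]
    in cosine coefficients, with [delta = 1] for the state and [delta = 0] for the adjoint state. *)
Let ga n t := - eps * om n ^+ 2 * al n t + u t * ka n.
Let S t x := series (fun n => al n t * mode n x).
Let dS t x := series (fun n => al n t * dmode n x).

Hypothesis al_continuous : forall n, {within `[0, T], continuous (al n)}.
Hypothesis al_le : forall n (t : R), 0 <= t <= T -> `|al n t| <= A n.
Hypothesis A_cvg : cvgn (series A).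
Hypothesis h_L2 : in_L2 mu `]0, 1[ h.
(** The majorant depends neither on [N] nor on [t]: it dominates the limits of the derivative series
    and also gives a bound of the dual norm that is uniform in time. *)
Hypothesis dS_le : forall N (t x : R), 0 < t < T -> 0 < x < 1 -> `|dS t x N| <= h x.
Hypothesis dS_cvg : forall (t x : R), 0 < t < T -> 0 < x < 1 ->
  dS t x N @[N --> \oo] --> dy t x.
Hypothesis al_weak : forall n phi, test_function 0 T phi ->
  \int[mu]_(t in `]0, T[) (derive1 phi t * al n t) =
  - \int[mu]_(t in `]0, T[) (phi t * ga n t).
Hypothesis u_measurable : measurable_fun `]0, T[ u.
Hypothesis u_le : forall t : R, 0 < t < T -> `|u t| <= 1.
Hypothesis ka_cvg : forall v dv c, in_H1 v dv -> space_trace v 1 c ->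
  series (fun n => ka n * coef n v) N @[N --> \oo] --> delta * c.

Definition cosine_series t x := limn (S t x).
Definition cosine_series_dt t v := limn (series (fun n => ga n t * coef n v)).

Let A_ge0 n : 0 <= A n.
Proof.
apply: le_trans (al_le n (t := 0) _); first exact: normr_ge0.
by rewrite lexx ltW.
Qed.

Let mode_le1 n x : `|mode n x| <= 1.
Proof. by rewrite ler_norml cos_geN1 cos_le1. Qed.

Let term_le n (t x : R) : 0 <= t <= T -> `|al n t * mode n x| <= A n.
Proof.
move=> tT; rewrite normrM -[leRHS]mulr1.
by apply: ler_pM => //; exact: al_le.
Qed.

Lemma cosine_series_cvg t x : 0 <= t <= T ->
  S t x N @[N --> \oo] --> cosine_series t x.
Proof.
by move=> tT; apply: (series_dominated _ A_cvg) => n; exact: term_le.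
Qed.

Lemma cosine_series_le t x : 0 <= t <= T -> `|cosine_series t x| <= limn (series A).
Proof. by move=> tT; apply: lim_series_norm_le => // n; exact: term_le. Qed.

Let S_le N t x : 0 <= t <= T -> `|S t x N| <= limn (series A).
Proof. by move=> tT; apply: series_norm_le => // n; exact: term_le. Qed.

Let mode_continuous n : continuous (mode n).
Proof. exact: continuous_cos_mul. Qed.

Lemma cosine_series_continuous t : 0 <= t <= T -> continuous (cosine_series t).
Proof.
move=> tT x.
apply: (series_dominated_cvg A_cvg).
- by apply: nearW => y n; exact: term_le.
- by move=> n; exact: term_le.
- by move=> n; apply: cvgMr; exact: mode_continuous.
Qed.

Let al_measurable n : measurable_fun `]0, T[ (al n).
Proof.
apply: (@measurable_funS _ _ _ _ `[0, T]) => //; first exact: subset_itv_oo_cc.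
by apply: subspace_continuous_measurable_fun => //; exact: al_continuous.
Qed.

Let inT (t : R) : t \in `]0, T[ -> 0 < t < T.
Proof. by rewrite in_itv. Qed.

Let inTW (t : R) : 0 < t < T -> 0 <= t <= T.
Proof. by move=> /andP[/ltW -> /ltW ->]. Qed.

Let dmode_continuous n : continuous (dmode n).
Proof. by move=> x; apply: cvgN; apply: cvgMr; exact: continuous_sin_mul. Qed.

Let measurable_series2 (F : nat -> R -> R) :
  (forall n, continuous (F n)) -> forall N,
  measurable_fun (`]0, T[%classic `*` `]0, 1[%classic :
    set (measurableTypeR R * measurableTypeR R))
    (fun z => series (fun n => al n z.1 * F n z.2) N).
Proof.
move=> cF N; rewrite /series /=.
apply: measurable_sum => n; apply: measurable_funM.
  exact: measurable_rect_fst.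
apply: measurable_rect_snd; apply: measurable_funTS.
exact: continuous_measurable_fun.
Qed.

Let y_L2 : in_L2 (mu \x mu)%E (`]0, T[ `*` `]0, 1[)
  (fun z => cosine_series z.1 z.2).
Proof.
have c2 : in_L2 mu `]0, 1[ (fun=> limn (series A)).
  by apply: in_L2_cst => //; exact: itvoo_lty.
apply: (in_L2_le _ _ (in_L2_snd T c2)); first exact: measurable_rect.
  apply: measurable_realfun.measurable_fun_cvg; first exact: (measurable_series2 mode_continuous).
  by move=> z [/= /inT zT _]; exact/cosine_series_cvg/inTW.
by move=> z [/= /inT zT _]; apply/cosine_series_le/inTW.
Qed.

Let dy_le (t x : R) : 0 < t < T -> 0 < x < 1 -> `|dy t x| <= h x.
Proof.
move=> tT x01; have c1 : `|dS t x N| @[N --> \oo] --> `|dy t x|.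
  by apply: cvg_norm; exact: dS_cvg.

have c2 : (fun=> h x) N @[N --> \oo] --> h x by exact: cvg_cst.
apply: (ler_cvg_to c1 c2); apply: nearW => N; exact: dS_le.
Qed.

Let dy_L2 : in_L2 (mu \x mu)%E (`]0, T[ `*` `]0, 1[) (fun z => dy z.1 z.2).
Proof.
apply: (in_L2_le _ _ (in_L2_snd T h_L2)); first exact: measurable_rect.
  apply: measurable_realfun.measurable_fun_cvg; first exact: (measurable_series2 dmode_continuous).
  by move=> z [/= /inT zT z1]; apply: dS_cvg => //; move: z1; rewrite /= in_itv.
by move=> z [/= /inT zT z1]; apply: dy_le => //; move: z1; rewrite /= in_itv.
Qed.

Let continuous_series (F : nat -> R -> R) (a : nat -> R) N :
  (forall n, continuous (F n)) -> continuous (fun x => series (fun n => a n * F n x) N).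
Proof.
move=> cF; elim: N => [|N IH].
  by move=> x; under eq_fun do rewrite series0; exact: cvg_cst.
have -> : (fun x => series (fun n => a n * F n x) N.+1) =
    (fun x => series (fun n => a n * F n x) N + a N * F N x).
  by apply/funext => x; rewrite /series /= big_nat_recr.
by move=> x; apply: cvgD; [exact: IH|apply: cvgMr; exact: cF].
Qed.

Let dyt_measurable t : 0 < t < T -> measurable_fun (`]0, 1[%classic : set R) (dy t).
Proof.
move=> tT; apply: measurable_realfun.measurable_fun_cvg (fun N x => dS t x N) _ _ _.
  move=> N; apply: measurable_funTS; apply: continuous_measurable_fun.
  by apply: continuous_series; exact: dmode_continuous.
by move=> x /=; rewrite in_itv => x01; exact: dS_cvg.
Qed.

Let dyt_L2 t : 0 < t < T -> in_L2 mu `]0, 1[ (dy t).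
Proof.
move=> tT; apply: in_L2_le h_L2 _ => //; first exact: dyt_measurable.
by move=> x /=; rewrite in_itv => x01; exact: dy_le.
Qed.

Let Rintegral_series (F : nat -> R -> R) (a : nat -> R) (f : R -> R) N :
  (forall n, continuous (F n)) -> mu.-integrable `]0, 1[ (EFin \o f) ->
  \int[mu]_(x in `]0, 1[) (f x * series (fun n => a n * F n x) N) =
  series (fun n => a n * \int[mu]_(x in `]0, 1[) (f x * F n x)) N.
Proof.
move=> cF fi; rewrite /series /=.
under eq_Rintegral do rewrite mulr_sumr.
rewrite Rintegral_sum//.
  apply: eq_bigr => n _; rewrite -RintegralZl//; last exact: integrable_mul_continuous.
  by apply: eq_Rintegral => x _; ring.
move=> n; apply: integrable_mul_continuous => // x.
by apply: cvgMr; exact: cF.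
Qed.

Let S_pairing_cvg t f : 0 <= t <= T -> mu.-integrable `]0, 1[ (EFin \o f) ->
  series (fun n => al n t * coef n f) N @[N --> \oo] -->
  \int[mu]_(x in `]0, 1[) (f x * cosine_series t x).
Proof.
move=> tT fi; rewrite /coef.
under eq_fun do rewrite -(Rintegral_series _ _ mode_continuous fi).
have mf : measurable_fun (`]0, 1[%classic : set R) f.
  by apply/measurable_EFinP; exact: measurable_int fi.
have [] // := @dominated_Rintegral _ _ R mu `]0, 1[ (fun N x => f x * S t x N)
  (fun x => f x * cosine_series t x) (fun x => limn (series A) * `|f x|).
- move=> N; apply: measurable_funM => //; apply: measurable_funTS.
  by apply: continuous_measurable_fun; apply: continuous_series; exact: mode_continuous.
- by move=> x _; apply: cvgMr; exact: cosine_series_cvg.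
- by apply: integrable_fZ => //; exact: integrable_norm.
- by move=> N x _; rewrite normrM mulrC ler_wpM2r//; exact: S_le.
Qed.

Let dS_pairing_cvg t f : 0 < t < T -> in_L2 mu `]0, 1[ f ->
  series (fun n => al n t * \int[mu]_(x in `]0, 1[) (f x * dmode n x)) N @[N --> \oo] -->
  \int[mu]_(x in `]0, 1[) (f x * dy t x).
Proof.
move=> tT f2; have fi := in_L2_integrable01 f2; have [mf _] := f2.
under eq_fun do rewrite -(Rintegral_series _ _ dmode_continuous fi).
have [] // := @dominated_Rintegral _ _ R mu `]0, 1[ (fun N x => f x * dS t x N)
  (fun x => f x * dy t x) (fun x => `|f x * h x|).
- move=> N; apply: measurable_funM => //; apply: measurable_funTS.
  by apply: continuous_measurable_fun; apply: continuous_series; exact: dmode_continuous.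
- by move=> x /=; rewrite in_itv => x01; apply: cvgMr; exact: dS_cvg.
- by apply: integrable_norm; exact: in_L2_mul.
- move=> N x /=; rewrite in_itv => x01; rewrite !normrM ler_wpM2l//.
  by apply: le_trans (dS_le N tT x01) _; exact: ler_norm.
Qed.

Let dmode_coef n v dv : in_H1 v dv ->
  \int[mu]_(x in `]0, 1[) (dv x * dmode n x) = om n ^+ 2 * coef n v.
Proof.
move=> vH1; have [_ dv2 _] := vH1; have dvi := in_L2_integrable01 dv2.
transitivity (\int[mu]_(x in `]0, 1[) (- om n * (dv x * sin (om n * x)))).
  by apply: eq_Rintegral => x _; rewrite /dmode; ring.
rewrite RintegralZl//; last by apply: integrable_mul_continuous => //; exact: continuous_sin_mul.
by rewrite (H1_sin_coef (nu n) vH1) -/(om n) /coef /mode; ring.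
Qed.

(** The factor [om n ^+ 2] is absorbed by moving a derivative from the cosine to [v]. What remains
    is a pairing of [dv] with the partial sum [dS], which [h] dominates. *)
Let ga_series N t v dv : in_H1 v dv ->
  series (fun n => ga n t * coef n v) N =
  - eps * series (fun n => al n t * \int[mu]_(x in `]0, 1[) (dv x * dmode n x)) N +
  u t * series (fun n => ka n * coef n v) N.
Proof.
move=> vH1; rewrite /series /= !mulr_sumr -big_split /=; apply: eq_bigr => n _.
by rewrite (dmode_coef _ vH1) /ga; ring.
Qed.

Let ga_cvg t v dv c : 0 < t < T -> in_H1 v dv -> space_trace v 1 c ->
  series (fun n => ga n t * coef n v) N @[N --> \oo] -->
  - eps * \int[mu]_(x in `]0, 1[) (dv x * dy t x) + u t * (delta * c).
Proof.
move=> tT vH1 vc; under eq_fun do rewrite (ga_series _ _ vH1).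
have [_ dv2 _] := vH1.
by apply: cvgD; apply: cvgMr; [exact: dS_pairing_cvg|exact: (ka_cvg vH1 vc)].
Qed.

Lemma cosine_series_dtE t v dv c : 0 < t < T -> in_H1 v dv -> space_trace v 1 c ->
  cosine_series_dt t v =
  - eps * \int[mu]_(x in `]0, 1[) (dy t x * dv x) + u t * (delta * c).
Proof.
move=> tT vH1 vc; rewrite /cosine_series_dt (cvg_lim _ (ga_cvg tT vH1 vc))//.
by congr (_ * _ + _); apply: eq_Rintegral => x _; rewrite mulrC.
Qed.

(** Each cosine satisfies the identity of weak derivatives, and the two pairing limits carry it over
    to the series. *)
Let y_H1 t : 0 < t < T -> in_H1 (cosine_series t) (dy t).
Proof.
move=> tT; have tT' := inTW tT.
split; [exact/in_L2_continuous/cosine_series_continuous|exact: dyt_L2|].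
move=> phi tphi.
have dphi := test_function_is_derive tphi.
have [f1 [df1 [f2 [df2 _]]]] := derive1n_ntimes_diff (proj1 tphi) 2.
have E : derive1 phi = f1 by exact: derive1_is_derive.
have cf1 : continuous (derive1 phi) by rewrite E; exact: is_derive_continuous df2.
have cphi := is_derive_continuous dphi.
have c1 := S_pairing_cvg tT' (continuous_integrable_oo 0 1 cf1).
have c2 := dS_pairing_cvg tT (in_L2_continuous cphi).
under eq_Rintegral do rewrite mulrC.
under [in RHS]eq_Rintegral do rewrite mulrC.
apply: (cvg_unique _ c1) => //.
have -> : series (fun n => al n t * coef n (derive1 phi)) =
  - series (fun n => al n t * \int[mu]_(x in `]0, 1[) (phi x * dmode n x)).
  apply/funext => N; rewrite /series /= [RHS]/GRing.opp/= -sumrN.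
  apply: eq_bigr => n _; rewrite /coef -mulrN; congr (_ * _).
  have [_ _ H] := cos_in_H1 (om n).
  under eq_Rintegral do rewrite mulrC.
  by rewrite H//; congr (- _); apply: eq_Rintegral => x _; rewrite mulrC.
exact: cvgN.
Qed.

Lemma cosine_series_in_L2H1 : in_L2H1 T cosine_series dy.
Proof.
by split => //; apply: aeW => t /inT tT; exact: y_H1.
Qed.


Lemma cosine_series_time_trace t0 : 0 <= t0 <= T ->
  time_trace T cosine_series t0 (cosine_series t0).
Proof.
move=> t0T; have yL2 t : 0 <= t <= T -> in_L2 mu `]0, 1[ (cosine_series t).
  by move=> tT; exact/in_L2_continuous/cosine_series_continuous.
split; first exact: yL2.
exists cosine_series; split; [|move=> t|by apply: aeW => t _; apply: aeW|by apply: aeW].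
  by move=> t; rewrite in_itv /= => /yL2.
rewrite in_itv /= => tT.
(* [w s] bounds the difference of the values at times [s] and [t] uniformly in [x], so the squared
   L^2 distance is at most [w s ^+ 2]. *)
pose w s := limn (series (fun n => `|al n s - al n t|)).
have A2 : cvgn (series (fun n => 2 * A n)) by exact: is_cvg_seriesZ.
have wle s n : 0 <= s <= T -> `| `|al n s - al n t| | <= 2 * A n.
  move=> sT; rewrite normr_id (le_trans (ler_normB _ _))// mulr2n mulrDl !mul1r.
  by apply: lerD; exact: al_le.
have w0 : w s @[s --> within `[0, T] (nbhs t)] --> (0 : R).
  have lim0 : limn (series (fun=> 0 : R)) = 0.
    apply/cvg_lim => //; rewrite (_ : series _ = fun=> 0); first exact: cvg_cst.
    by apply/funext => n; rewrite /series /= big1.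
  suff : w s @[s --> within `[0, T] (nbhs t)] --> limn (series (fun=> 0 : R)).
    by rewrite lim0.
  apply: (series_dominated_cvg A2).
  - rewrite near_withinE; apply: nearW => s /=; rewrite in_itv /= => sT n; exact: wle.
  - by move=> n; rewrite normr0 mulr_ge0.
  - move=> n.
    have aln : al n s @[s --> within `[0, T] (nbhs t)] --> al n t.
      have /subspace_continuousP/(_ t) := al_continuous (n := n).
      by rewrite /= in_itv /= => /(_ tT).
    have : `|al n s - al n t| @[s --> within `[0, T] (nbhs t)] --> `|al n t - al n t|.
      by apply: cvg_norm; apply: cvgB => //; exact: cvg_cst.
    by rewrite subrr normr0.
have w2 : w s * w s @[s --> within `[0, T] (nbhs t)] --> (0 * 0 : R) by exact: cvgM.
rewrite mulr0 in w2.
apply: (squeeze_cvgr _ (cvg_cst 0) w2); rewrite near_withinE; apply: nearW => s /=.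
rewrite in_itv /= => sT; apply/andP; split.
  by apply: Rintegral_ge0 => x _; exact: sqr_ge0.
rewrite -expr2 -[leRHS]Rintegral_cst01; apply: le_Rintegral => //.
- have : in_L2 mu `]0, 1[ (cosine_series s \- cosine_series t).
    by apply: in_L2_B => //; exact: yL2.
  by move/(in_L2_integrable_sqr _); apply.
- by apply: continuous_integrable_oo => x; exact: cvg_cst.
- move=> x _; rewrite -(real_normK (num_real _)) lerXn2r ?nnegrE//.
    apply: le_trans (normr_ge0 _) (lim_series_norm_le (a := fun n => al n s - al n t) _ _) => //.
    by apply: series_dominated A2 => n; exact: wle.
  apply: lim_seriesB_le.
  + by move=> n; rewrite -mulrBl normrM ler_piMr.
  + by apply/cvg_ex; exists (cosine_series s x); exact: cosine_series_cvg.
  + by apply/cvg_ex; exists (cosine_series t x); exact: cosine_series_cvg.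
  + by apply: series_dominated A2 => n; exact: wle.
Qed.

Let unit_ball v dv := \int[mu]_(x in `]0, 1[) (v x ^+ 2) +
  \int[mu]_(x in `]0, 1[) (dv x ^+ 2) <= 1.

(** Integration by parts against [x] writes [c] as the integral of [x * dv + v], and both parts are
    bounded by their L^2 norms. *)
Let trace_le v dv c : in_H1 v dv -> space_trace v 1 c -> unit_ball v dv -> `|c| <= 2.
Proof.
move=> vH1 vc vdv; have [v2 dv2 _] := vH1.
have c1 : continuous (fun _ : R => 1 : R) by move=> x; exact: cvg_cst.
have := H1_by_parts (G := fun x : R => x) (k := fun=> 1) vH1 vc
  (fun x => is_derive_id x 1) c1 erefl.
rewrite mulr1 => <-.
under [X in _ + X]eq_Rintegral do rewrite mulr1.
have x2 : in_L2 mu `]0, 1[ (fun x => x) by apply: in_L2_continuous => x U.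
have dvx : in_L2 mu `]0, 1[ (fun x => dv x * x).
  apply: (@in_L2_le _ _ _ mu _ _ (fun x => `|dv x|)) => //.
  - by apply: measurable_funM; [case: dv2|case: x2].
  - case: dv2 => mdv idv; split; first exact: measurableT_comp.
    by under eq_integral do rewrite real_normK ?num_real//.
  - move=> x /=; rewrite in_itv => /andP[x0 x1]; rewrite normrM ler_piMr//.
    by rewrite ger0_norm ltW.
have I1 := sqr_Rintegral01 dvx; have I2 := sqr_Rintegral01 v2.
have I3 : \int[mu]_(x in `]0, 1[) ((dv x * x) ^+ 2) <=
    \int[mu]_(x in `]0, 1[) (dv x ^+ 2).
  apply: le_Rintegral => //.
  - exact: in_L2_integrable_sqr.
  - exact: in_L2_integrable_sqr.
  - move=> x /=; rewrite in_itv => /andP[/= x0 x1].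
    rewrite exprMn ler_piMr ?sqr_ge0// expr_le1// ltW//.
exact: norm_sum_le2 vdv I1 I2 I3.
Qed.

(** The first summand is Young's inequality for [h * |dv|] on the unit ball, the second is the trace
    bound together with [|u| <= 1]. *)
Let M := `|eps| * ((1 + \int[mu]_(x in `]0, 1[) (h x ^+ 2)) / 2) + `|delta| * 2.

Let dt_le t v dv : 0 < t < T -> in_H1 v dv -> unit_ball v dv ->
  `|cosine_series_dt t v| <= M.
Proof.
move=> tT vH1 vdv; have [c vc] := H1_trace_exists vH1; have [v2 dv2 _] := vH1.
rewrite (cosine_series_dtE tT vH1 vc) (le_trans (ler_normD _ _))// lerD//; last first.
  rewrite !normrM mulrC -[leRHS]mulr1; apply: ler_pM => //; last exact: u_le.
  by apply: ler_wpM2l => //; exact: trace_le vdv.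
rewrite normrM normrN; apply: ler_wpM2l => //.
have h2i : mu.-integrable `]0, 1[ (EFin \o (fun x => h x ^+ 2)).
  exact: in_L2_integrable_sqr.
have dv2i : mu.-integrable `]0, 1[ (EFin \o (fun x => dv x ^+ 2)).
  exact: in_L2_integrable_sqr.
have dydv : mu.-integrable `]0, 1[ (EFin \o (fun x => dy t x * dv x)).
  by apply: in_L2_mul => //; exact: dyt_L2.
apply: le_trans (le_normr_Rintegral _ dydv) _ => //.
apply: (@le_trans _ _ (\int[mu]_(x in `]0, 1[) (2^-1 * (h x ^+ 2 + dv x ^+ 2)))).
  apply: le_Rintegral => //.
  - exact: integrable_norm.
  - by apply: integrable_fZ => //; exact: integrable_fD.
  - move=> x /=; rewrite in_itv => x01; rewrite normrM.
    rewrite -[dv x ^+ 2]real_normK ?num_real//.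
    by apply: mul_le_half_sum_sqr => //; exact: dy_le.
rewrite RintegralZl//; last exact: integrable_fD.
rewrite RintegralD// mulrC ler_pM2r ?invr_gt0// addrC lerD2r.
apply: le_trans vdv; rewrite lerDr.
by apply: Rintegral_ge0 => x _; exact: sqr_ge0.
Qed.

Let dual_norm_le t : 0 < t < T -> (dual_norm (cosine_series_dt t) <= M%:E)%E.
Proof.
move=> tT; apply: ub_ereal_sup => _ [v [dv [vH1 vdv ->]]]; rewrite lee_fin.
exact: dt_le vdv.
Qed.

Let in_H1_zero : in_H1 (fun=> 0 : R) (fun=> 0 : R).
Proof.
by apply: C1_in_H1 => x; exact: cvg_cst.
Qed.

Let dual_norm_ge0 (F : (R -> R) -> R) : (0 <= dual_norm F)%E.
Proof.
apply: (@le_trans _ _ `|F (fun=> 0)|%:E); first by rewrite lee_fin.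
apply: ereal_sup_ubound; exists (fun=> 0), (fun=> 0); split => //.
by under eq_Rintegral do rewrite expr0n /=; rewrite Rintegral_zero addr0 ler01.
Qed.

Let dt_cvg t v dv : 0 < t < T -> in_H1 v dv ->
  series (fun n => ga n t * coef n v) N @[N --> \oo] --> cosine_series_dt t v.
Proof.
move=> tT vH1; have [c vc] := H1_trace_exists vH1.
by apply: cvgP; exact: (ga_cvg tT vH1 vc).
Qed.

Let in_H1_coef_integrable n v dv : in_H1 v dv ->
  mu.-integrable `]0, 1[ (EFin \o (fun x => v x * mode n x)).
Proof.
move=> [v2 _ _]; apply: integrable_mul_continuous => //.
exact: in_L2_integrable01.
Qed.

Let dt_dual t : 0 < t < T -> in_H1_dual (cosine_series_dt t).
Proof.
move=> tT; split; last by rewrite (le_lt_trans (dual_norm_le tT))// ltry.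
move=> a v dv w dw vH1 wH1; apply: cvg_lim => //.
have -> : series (fun n => ga n t * coef n (fun x => a * v x + w x)) =
  (fun N => a * series (fun n => ga n t * coef n v) N +
            series (fun n => ga n t * coef n w) N).
  apply/funext => N; rewrite /series /= mulr_sumr -big_split /=.
  apply: eq_bigr => n _; rewrite /coef.
  have -> : \int[mu]_(x in `]0, 1[) ((a * v x + w x) * mode n x) =
     \int[mu]_(x in `]0, 1[) (a * (v x * mode n x) + w x * mode n x).
    by apply: eq_Rintegral => x _; ring.
  have iv := in_H1_coef_integrable n vH1; have iw := in_H1_coef_integrable n wH1.
  rewrite RintegralD//; last exact: integrable_fZ.
  by rewrite RintegralZl//; ring.
by apply: cvgD; [apply: cvgMr; exact: dt_cvg vH1|exact: dt_cvg wH1].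
Qed.

Let ga_measurable n : measurable_fun `]0, T[ (ga n).
Proof.
apply: measurable_funD; last exact: measurable_funM.
by apply: measurable_funM => //; exact: al_measurable.
Qed.

Let dt_series_measurable N v :
  measurable_fun `]0, T[ (fun t => series (fun n => ga n t * coef n v) N).
Proof.
rewrite /series /=; apply: measurable_sum => n.
by apply: measurable_funM => //; exact: ga_measurable.
Qed.

Let dt_measurable v dv : in_H1 v dv ->
  measurable_fun `]0, T[ (fun t => cosine_series_dt t v).
Proof.
move=> vH1.
apply: measurable_realfun.measurable_fun_cvg (fun N t => series (fun n => ga n t * coef n v) N) _ _ _.
  by move=> N; exact: dt_series_measurable.
by move=> t /inT tT; exact: dt_cvg vH1.
Qed.

Lemma cosine_series_dt_in_L2H1_dual : in_L2H1_dual T cosine_series_dt.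
Proof.
split.
- by apply: aeW => t /inT tT; exact: dt_dual.
- by move=> v dv vH1; exact: dt_measurable vH1.
- apply: (@le_lt_trans _ _ (\int[mu]_(t in `]0%R, T[) ((M ^+ 2)%:E))%E).
    apply: ge0_le_integral_nonmeasurable => t /inT tT.
      by rewrite expe2 mule_ge0.
    rewrite EFin_expe expe2 [leRHS]expe2; apply: lee_pmul => //; exact: dual_norm_le.
  by rewrite integral_cst// lte_mul_pinfty ?lee_fin ?sqr_ge0// itvoo_lty.
Qed.

Let al_integrable n : mu.-integrable `]0, T[ (EFin \o al n).
Proof. exact: within_continuous_integrable_oo. Qed.

Let u_integrable : mu.-integrable `]0, T[ (EFin \o u).
Proof.
apply: in_L2_integrable => //; first exact: itvoo_lty.
by apply: (in_L2_bounded (C := 1)) => //; exact: itvoo_lty.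
Qed.

Let ga_integrable n : mu.-integrable `]0, T[ (EFin \o ga n).
Proof.
apply: (@eq_integrable _ _ _ mu _ _ (EFin \o (fun t => - eps * om n ^+ 2 * al n t + ka n * u t))) => //.
  by move=> t _ /=; rewrite /ga; congr (_ + _)%:E; rewrite mulrC.
by apply: integrable_fD => //; apply: integrable_fZ.
Qed.

Let Rintegral_time_series (F : nat -> R -> R) (a : nat -> R) (f : R -> R) N :
  (forall n, mu.-integrable `]0, T[ (EFin \o F n)) -> continuous f ->
  \int[mu]_(t in `]0, T[) (f t * series (fun n => F n t * a n) N) =
  series (fun n => a n * \int[mu]_(t in `]0, T[) (f t * F n t)) N.
Proof.
move=> Fi cf; rewrite /series /=.
have fFi n : mu.-integrable `]0, T[ (EFin \o (fun t => f t * F n t)).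
  apply: eq_integrable (integrable_mul_continuous (Fi n) cf) => //.
  by move=> t _ /=; rewrite mulrC.
transitivity (\int[mu]_(t in `]0, T[)
    (\sum_(0 <= k < N) a k * (f t * F k t))).
  by apply: eq_Rintegral => t _; rewrite mulr_sumr; apply: eq_bigr => n _; ring.
rewrite Rintegral_sum//; last by move=> n; exact: integrable_fZ.
by apply: eq_bigr => n _; rewrite RintegralZl.
Qed.

Let dS_coef_le N t v dv : 0 < t < T -> in_H1 v dv ->
  `|series (fun n => al n t * \int[mu]_(x in `]0, 1[) (dv x * dmode n x)) N| <=
  \int[mu]_(x in `]0, 1[) `|dv x * h x|.
Proof.
move=> tT [_ dv2 _]; have dvi := in_L2_integrable01 dv2.
have dvh : mu.-integrable `]0, 1[ (EFin \o (fun x => dv x * h x)) by exact: in_L2_mul.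
have cS : continuous (fun x => dS t x N) by exact: continuous_series.
rewrite -(Rintegral_series _ _ dmode_continuous dvi).
have dvS := integrable_mul_continuous dvi cS.
apply: le_trans (le_normr_Rintegral _ dvS) _ => //; apply: le_Rintegral => //.
- exact: integrable_norm.
- exact: integrable_norm.
- move=> x /=; rewrite in_itv /= => x01; rewrite !normrM ler_wpM2l//.
  by apply: le_trans (dS_le N tT x01) _; exact: ler_norm.
Qed.

(** Every partial sum satisfies the identity by [al_weak]; dominated convergence in time is applied
    on both sides. On the right the domination comes from [ga_series], as the terms of [ga] alone
    grow with [om n ^+ 2]. *)
Lemma cosine_series_weak_time_derivative :
  weak_time_derivative T cosine_series cosine_series_dt.
Proof.
move=> phi v dv tphi vH1; have [v2 dv2 _] := vH1.
have vi := in_L2_integrable01 v2.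
have [c vc] := H1_trace_exists vH1.
have dphi := test_function_is_derive tphi.
have [f1 [df1 [f2 [df2 _]]]] := derive1n_ntimes_diff (proj1 tphi) 2.
have E : derive1 phi = f1 by exact: derive1_is_derive.
have cf1 : continuous (derive1 phi) by rewrite E; exact: is_derive_continuous df2.
have cphi := is_derive_continuous dphi.
have coef_le n : `|coef n v| <= \int[mu]_(x in `]0, 1[) `|v x|.
  apply: le_trans (le_normr_Rintegral _ (in_H1_coef_integrable n vH1)) _ => //.
  apply: le_Rintegral => //.
  - by apply: integrable_norm; exact: in_H1_coef_integrable vH1.
  - exact: integrable_norm.
  - by move=> x _; rewrite normrM ler_piMr.
set V := \int[mu]_(x in `]0, 1[) `|v x| in coef_le.
have V0 : 0 <= V by apply: Rintegral_ge0.
have AV : cvgn (series (fun n => A n * V)).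
  rewrite (_ : (fun n => A n * V) = V *: A); first exact: is_cvg_seriesZ.
  by apply/funext => n; rewrite mulrC.
have c1 : \int[mu]_(t in `]0, T[)
    (derive1 phi t * series (fun n => al n t * coef n v) N) @[N --> \oo] -->
  \int[mu]_(t in `]0, T[)
    (derive1 phi t * (\int[mu]_(x in `]0, 1[) (cosine_series t x * v x))).
  have cn : continuous (fun t => `|derive1 phi t|).
    by move=> t; apply: cvg_norm; exact: cf1.
  apply: (@dominated_Rintegral _ _ R mu `]0, T[
    (fun N t => derive1 phi t * series (fun n => al n t * coef n v) N)
    (fun t => derive1 phi t * (\int[mu]_(x in `]0, 1[) (cosine_series t x * v x)))
    (fun t => limn (series (fun n => A n * V)) * `|derive1 phi t|) _ _ _ _ _).2 => //.
  - move=> N; apply: measurable_funM.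
      by apply: measurable_funTS; exact: continuous_measurable_fun.
    rewrite /series /=; apply: measurable_sum => n.
    by apply: measurable_funM => //; exact: al_measurable.
  - move=> t /inT/inTW tT; apply: cvgMr.
    under [X in _ --> X]eq_Rintegral do rewrite mulrC.
    exact: S_pairing_cvg.
  - by apply: integrable_fZ => //; exact: continuous_integrable_oo.
  - move=> N t /inT/inTW tT; rewrite normrM mulrC ler_wpM2r//.
    apply: series_norm_le AV _ => n; rewrite normrM.
    by apply: ler_pM => //; exact: al_le.
have c2 : \int[mu]_(t in `]0, T[)
    (phi t * series (fun n => ga n t * coef n v) N) @[N --> \oo] -->
  \int[mu]_(t in `]0, T[) (phi t * cosine_series_dt t v).
  (* The boundary series only converges conditionally in general; as a convergent sequence its
     partial sums are bounded. *)
  have [K KP] : exists K, forall N, `|series (fun n => ka n * coef n v) N| <= K.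
    have /cvgP/cvg_seq_bounded/pinfty_ex_gt0[K _ HK] := ka_cvg vH1 vc.
    by exists K => N; exact: HK.
  pose B := `|eps| * \int[mu]_(x in `]0, 1[) `|dv x * h x| + K.
  have cn : continuous (fun t => `|phi t|).
    by move=> t; apply: cvg_norm; exact: cphi.
  apply: (@dominated_Rintegral _ _ R mu `]0, T[
    (fun N t => phi t * series (fun n => ga n t * coef n v) N)
    (fun t => phi t * cosine_series_dt t v)
    (fun t => B * `|phi t|) _ _ _ _ _).2 => //.
  - move=> N; apply: measurable_funM; last exact: dt_series_measurable.
    by apply: measurable_funTS; exact: continuous_measurable_fun.
  - by move=> t /inT tT; apply: cvgMr; exact: dt_cvg vH1.
  - by apply: integrable_fZ => //; exact: continuous_integrable_oo.
  - move=> N t /inT tT; rewrite normrM mulrC ler_wpM2r//.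
    rewrite (ga_series _ _ vH1) (le_trans (ler_normD _ _))// lerD//.
      by rewrite normrM normrN ler_wpM2l//; exact: dS_coef_le vH1.
    rewrite normrM -[leRHS]mul1r; apply: ler_pM => //; exact: u_le.
apply: (cvg_unique _ c1) => //.
have -> : (fun N => \int[mu]_(t in `]0, T[)
    (derive1 phi t * series (fun n => al n t * coef n v) N)) =
  (fun N => - \int[mu]_(t in `]0, T[)
    (phi t * series (fun n => ga n t * coef n v) N)).
  apply/funext => N.
  rewrite (Rintegral_time_series _ _ al_integrable cf1).
  rewrite (Rintegral_time_series _ _ ga_integrable cphi).
  rewrite /series /= -sumrN; apply: eq_bigr => n _.
  by rewrite -mulrN; congr (_ * _); exact: al_weak.
exact: cvgN.
Qed.

Lemma cosine_series_in_W : in_W T cosine_series dy cosine_series_dt.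
Proof.
split.
- exact: cosine_series_in_L2H1.
- exact: cosine_series_dt_in_L2H1_dual.
- exact: cosine_series_weak_time_derivative.
Qed.

End CosineSeries.

(** * The sawtooth series *)

Section Sawtooth.
Context {R : realType}.
Notation mu := (@lebesgue_measure R).

(** Both [g + f] and [g - f] are nondecreasing. *)
Lemma derive_dominated (f g f' g' : R -> R) (a b : R) : a <= b ->
  (forall x : R, a <= x <= b -> is_derive x (1 : R) f (f' x)) ->
  (forall x : R, a <= x <= b -> is_derive x (1 : R) g (g' x)) ->
  (forall x : R, a <= x <= b -> `|f' x| <= g' x) ->
  `|f b - f a| <= g b - g a.
Proof.
move=> ab df dg fg.
have mono (s : R) : `|s| = 1 -> g a + s * f a <= g b + s * f b.
  move=> s1; pose F x := g x + s * f x.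
  have dF (x : R) : a <= x <= b -> is_derive x (1 : R) F (g' x + s * f' x).
    by move=> xab; apply: derD; [exact: dg|apply: derZ; exact: df].
  have xoo (x : R) : x \in `]a, b[ -> a <= x <= b.
    by rewrite in_itv /= => /andP[/ltW -> /ltW ->].
  apply: (@ger0_derive1_le_cc _ F a b) => //.
  - by move=> x /xoo /dF [].
  - move=> x /xoo xab; rewrite derive1E; case: (dF x xab) => _ ->.
    have := fg x xab; have := ler_norm (- (s * f' x)).
    by rewrite normrN normrM s1 mul1r; lra.
  - apply: derivable_within_continuous => x; rewrite in_itv => /dF [].
    by [].
  - by rewrite in_itv /= lexx.
  - by rewrite in_itv /= lexx andbT.
have := mono 1 (normr1 _); have := mono (- 1) (normrN1 _).
by rewrite ler_norml => h1 h2; apply/andP; split; lra.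
Qed.

(** The remainder after [N] terms of the sine series of [-x]. All sines vanish at [x = 1], so the
    remainder stays at -1 there and convergence is not uniform near 1. *)
Definition saw N (x : R) : R :=
  - x - \sum_(0 <= k < N) 2 * (-1) ^+ k.+1 * (sin (k.+1%:R * pi * x) / (k.+1%:R * pi)).

Let ker N (x : R) : R := 1 + \sum_(0 <= k < N) 2 * (-1) ^+ k.+1 * cos (k.+1%:R * pi * x).

Lemma saw0 x : saw 0 x = - x.
Proof. by rewrite /saw big_geq// subr0. Qed.

Lemma sawS N x : saw N.+1 x =
  saw N x - 2 * (-1) ^+ N.+1 * (sin (N.+1%:R * pi * x) / (N.+1%:R * pi)).
Proof. by rewrite /saw big_nat_recr//= opprD addrA. Qed.

Let npi_neq0 N : N.+1%:R * pi != 0 :> R.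
Proof. by rewrite mulf_neq0// ?pnatr_eq0// gt_eqF// pi_gt0. Qed.

Let saw_derive N (x : R) : is_derive x (1 : R) (saw N) (- ker N x).
Proof.
elim: N => [|N IH].
  have -> : saw 0 = (fun y => -1 * y + 0) by apply/funext => y; rewrite saw0; ring.
  by rewrite /ker big_geq// addr0; exact: der_affine.
pose c : R := 2 * (-1) ^+ N.+1 / (N.+1%:R * pi).
have -> : saw N.+1 = (fun y => saw N y + - c * sin (N.+1%:R * pi * y)).
  by apply/funext => y; rewrite sawS /c; ring.
apply: (is_derive_eq (derD IH (derZ (- c) (der_sin (N.+1%:R * pi) x)))).
rewrite /ker big_nat_recr//= /c.
have -> : - (2 * (-1) ^+ N.+1 / (N.+1%:R * pi)) * (N.+1%:R * pi * cos (N.+1%:R * pi * x))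
  = - (2 * (-1) ^+ N.+1 * cos (N.+1%:R * pi * x)) * ((N.+1%:R * pi) / (N.+1%:R * pi)).
  by ring.
by rewrite divff// mulr1; ring.
Qed.

(** [ker] is the Dirichlet kernel with alternating signs, that is, centred at [x = 1]; on [[0, 1]]
    the factor [cos (pi / 2 * x)] vanishes only there. *)
Let ker_eq N (x : R) :
  ker N x * cos (pi / 2 * x) = (-1) ^+ N * cos ((N%:R + 2^-1) * pi * x).
Proof.
elim: N => [|N IH].
  by rewrite /ker big_geq// addr0 expr0 add0r [2^-1 * pi]mulrC.
have -> : ker N.+1 x = ker N x + 2 * (-1) ^+ N.+1 * cos (N.+1%:R * pi * x).
  by rewrite /ker big_nat_recr//= addrA.
rewrite mulrDl IH.
have -> : (N%:R + 2^-1) * pi * x = N.+1%:R * pi * x - pi / 2 * x.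
  by rewrite -natr1; field.
have -> : (N.+1%:R + 2^-1) * pi * x = N.+1%:R * pi * x + pi / 2 * x by field.
by rewrite cosB cosD exprS; ring.
Qed.

Let ker_le N (x : R) : `|ker N x| <= 2 * N%:R + 1.
Proof.
rewrite /ker addrC (le_trans (ler_normD _ _))// normr1 lerD2r.
apply: le_trans (ler_norm_sum _ _ _) _.
apply: (@le_trans _ _ (\sum_(0 <= k < N) 2)).
  apply: ler_sum => k _; rewrite normrM -[leRHS]mulr1; apply: ler_pM => //.
    by rewrite normrM normr_sign mulr1 ger0_norm.
  by rewrite ler_norml cos_geN1 cos_le1.
by rewrite big_const_nat subn0 iter_addr addr0 mulr_natr.
Qed.

Let saw1 N : saw N 1 = -1.
Proof.
by elim: N => [|N IH]; rewrite ?saw0// sawS IH mulr1 sin_natpi mul0r mulr0 subr0.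
Qed.

(** The mean value inequality from the known value -1 at 1, with the trivial bound of the kernel. *)
Let saw_near1 N (x : R) : x <= 1 -> `|saw N x| <= 1 + (2 * N%:R + 1) * (1 - x).
Proof.
move=> x1; have := @derive_dominated (saw N) (fun y => (2 * N%:R + 1) * y + 0)
  (fun y => - ker N y) (fun=> 2 * N%:R + 1) x 1 x1 (fun y _ => saw_derive N y)
  (fun y _ => der_affine _ _ y).
have H y : x <= y <= 1 -> `|- ker N y| <= 2 * N%:R + 1 by rewrite normrN.
move=> /(_ H); rewrite saw1 => {}H.
have -> : saw N x = - (-1 - saw N x) - 1 by ring.
rewrite (le_trans (ler_normB _ _))// normr1 addrC lerD2l normrN.
by apply: le_trans H _; lra.
Qed.

Let sin_pihalf_ge0 (y : R) : 0 <= y <= pi / 2 -> 0 <= sin y.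
Proof.
move=> /andP[y0 yp]; apply: sin_ge0_pi; rewrite y0 (le_trans yp)//.
by have := pi_ge0 R; lra.
Qed.

(** A crude form of Jordan's inequality. Since [sin z - z cos z] has derivative [z sin z], one has
    [y cos y <= sin y], which settles [cos y >= 1/2]; otherwise [sin y >= 1/2] and [y <= 2]. *)
Let sin_ge (y : R) : 0 <= y <= pi / 2 -> y / 4 <= sin y.
Proof.
move=> /andP[y0 ypi]; have [p2 _] := pihalf_02_cos_pihalf R.
have /andP[_ pi2] := p2; have y2 := le_trans ypi pi2.
have s0 : 0 <= sin y by apply: sin_pihalf_ge0; rewrite y0.
have := @derive_dominated (fun=> 0) (fun z => sin z - z * cos z) (fun=> 0)
   (fun z => z * sin z) 0 y y0 (fun z _ => is_derive_cst 0 z 1).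
have ds (z : R) : is_derive z (1 : R) (fun z => sin z - z * cos z) (z * sin z).
  have d1 := derM (is_derive_id z 1) (is_derive_cos z).
  have d2 := derD (is_derive_sin z) (derZ (-1) d1).
  have -> : (fun z : R => sin z - z * cos z) = (fun z : R => sin z + -1 * (z * cos z)).
    by apply/funext => w; ring.
  by apply: (is_derive_eq d2); ring.
move=> /(_ (fun z _ => ds z)).
have H (z : R) : 0 <= z <= y -> `|0 : R| <= z * sin z.
  move=> /andP[z0 zy]; rewrite normr0 mulr_ge0//.
  by apply: sin_pihalf_ge0; rewrite z0 (le_trans zy ypi).
move=> /(_ H); rewrite subrr normr0 sin0 mul0r subr0 subr0 => ycos.
have := cos2Dsin2 y; have [c2|c2] := leP 2^-1 (cos y) => trig.
  have this : y * 2^-1 <= y * cos y by exact: ler_wpM2l.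
  by move: (y * cos y) ycos this => yc *; lra.
have cge : 0 <= cos y by apply: cos_ge0_pihalf; rewrite ypi andbT; lra.
have : 2^-1 <= sin y by nra.
by lra.
Qed.

Let cos_ge (x : R) : 0 <= x <= 1 -> (1 - x) / 4 <= cos (pi / 2 * x).
Proof.
move=> /andP[x0 x1]; have p2 := pi_ge2 R.
have -> : cos (pi / 2 * x) = sin (pi / 2 * (1 - x)).
  rewrite -cosBpihalf (_ : _ - _ = - (pi / 2 * x)) ?cosN//; ring.
apply: le_trans (sin_ge _); first by nra.
by rewrite mulr_ge0 ?divr_ge0 ?pi_ge0 ?subr_ge0//= ler_piMr ?divr_ge0 ?pi_ge0//; lra.
Qed.

(** Integration by parts of the kernel [s' / (w c)]. With [Q = 1 / (w c)], which increases,
    [saw + s * Q] has derivative [s * Q'], so it is at most [Q x - Q 0] in absolute value; the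
    boundary term costs another [Q x]. *)
Let saw_far N (x : R) : 0 <= x < 1 ->
  `|saw N x| <= 2 / ((N%:R + 2^-1) * pi * cos (pi / 2 * x)).
Proof.
move=> /andP[x0 x1]; set w := (N%:R + 2^-1) * pi.
have w0 : 0 < w by rewrite mulr_gt0 ?pi_gt0// ltr_wpDl.
have cgt y : 0 <= y <= x -> 0 < cos (pi / 2 * y).
  move=> /andP[y0 yx]; apply: (lt_le_trans _ (cos_ge _)).
    by rewrite divr_gt0// subr_gt0 (le_lt_trans yx).
  by rewrite y0 (le_trans yx (ltW x1)).
pose c y : R := cos (pi / 2 * y).
pose c' y : R := - (pi / 2 * sin (pi / 2 * y)).
pose Q y : R := w^-1 * (c y)^-1.
pose Q' y : R := w^-1 * (- (c y)^-1 ^+ 2 * c' y).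
have dV (y : R) : 0 <= y <= x -> is_derive y (1 : R) (fun y => (c y)^-1) (- (c y)^-1 ^+ 2 * c' y).
  move=> yx; have cn0 : c y != 0 by rewrite gt_eqF// cgt.
  apply: (is_derive_eq (is_deriveV cn0 (der_cos (pi / 2) y))).
  by rewrite /GRing.scale /= exprVn.
have dQ (y : R) : 0 <= y <= x -> is_derive y (1 : R) Q (Q' y).
  by move=> yx; apply: derZ; exact: dV.
pose s y : R := (-1) ^+ N * sin (w * y).
pose P y : R := saw N y + s y * Q y.
have dP (y : R) : 0 <= y <= x -> is_derive y (1 : R) P (s y * Q' y).
  move=> yx; apply: (is_derive_eq (derD (saw_derive N y)
     (derM (derZ ((-1) ^+ N) (der_sin w y)) (dQ y yx)))).
  have kE : ker N y = (-1) ^+ N * cos (w * y) / c y.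
    by rewrite -ker_eq mulfK// gt_eqF// cgt.
  rewrite kE /Q -/(s y).
  have -> : (-1) ^+ N * (w * cos (w * y)) * (w^-1 * (c y)^-1) =
     (w / w) * ((-1) ^+ N * cos (w * y) / c y) by ring.
  by rewrite divff ?gt_eqF// mul1r addrA addNr add0r.
have sle y : `|s y| <= 1 by rewrite normrM normr_sign mul1r; exact: sin_max.
have Q'0 (y : R) : 0 <= y <= x -> 0 <= Q' y.
  move=> /andP[y0 yx]; have p2 : 0 <= pi / 2 :> R by rewrite divr_ge0 ?pi_ge0.
  have s0 : 0 <= sin (pi / 2 * y).
    apply: sin_pihalf_ge0; rewrite mulr_ge0//=.
    by rewrite ler_piMr// (le_trans yx (ltW x1)).
  rewrite /Q' /c' mulrNN; apply: mulr_ge0; first by rewrite invr_ge0 ltW.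
  by apply: mulr_ge0; [exact: sqr_ge0|exact: mulr_ge0].
have := derive_dominated x0 dP dQ.
have H (y : R) : 0 <= y <= x -> `|s y * Q' y| <= Q' y.
  by move=> yx; rewrite normrM (ger0_norm (Q'0 y yx)) ler_piMl// Q'0.
move=> /(_ H) {H}.
have P0 : P 0 = 0.
  rewrite /P /s mulr0 sin0 mulr0 mul0r addr0.
  by elim: N {P dP s w w0 Q Q' dQ sle Q'0} => [|N IH]; rewrite ?saw0 ?oppr0// sawS IH mulr0 sin0 mul0r mulr0 subr0.
rewrite P0 subr0 => PQ.
have Qx0 : 0 < Q x.
  by rewrite mulr_gt0// invr_gt0//; apply: cgt; rewrite x0 lexx.
have Q00 : 0 <= Q 0 by rewrite /Q /c mulr0 cos0 invr1 mulr1 invr_ge0 ltW.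
have -> : saw N x = P x - s x * Q x by rewrite /P addrK.
apply: le_trans (ler_normB _ _) _.
have -> : 2 / (w * cos (pi / 2 * x)) = Q x + Q x by rewrite invfM /Q /c; ring.
apply: lerD; first by apply: le_trans PQ _; rewrite lerBlDr lerDl.
by rewrite normrM (gtr0_norm Qx0) ler_piMl// ltW.
Qed.

(** The exponent 1/4 is a compromise: below 1/2, so that [(1 - x)^(-1/4)] is square integrable, and
    positive, so that [n^(-1) n^(-1/4)] is summable. *)
Definition root4 (x : R) : R := Num.sqrt (Num.sqrt x).

Lemma root4_ge0 x : 0 <= root4 x. Proof. exact: sqrtr_ge0. Qed.

Lemma root4_gt0 x : (0 < root4 x) = (0 < x). Proof. by rewrite /root4 !sqrtr_gt0. Qed.

Lemma root4X4 x : 0 <= x -> root4 x ^+ 4 = x.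
Proof.
move=> x0; rewrite /root4 (exprM _ 2 2) sqr_sqrtr ?sqrtr_ge0//.
by rewrite sqr_sqrtr.
Qed.

Lemma root4M x y : 0 <= x -> root4 (x * y) = root4 x * root4 y.
Proof. by move=> x0; rewrite /root4 sqrtrM// sqrtrM// sqrtr_ge0. Qed.

Lemma ler_root4 x y : 0 <= y -> (root4 x <= root4 y) = (x <= y).
Proof. by move=> y0; rewrite /root4 !ler_sqrt// sqrtr_ge0. Qed.

Let saw_min N (x : R) : 0 <= x < 1 -> let z := (2 * N%:R + 1) * (1 - x) in
  `|saw N x| <= 1 + z /\ `|saw N x| * z <= 8.
Proof.
move=> x01 z; have /andP[x0 x1] := x01; split; first exact/saw_near1/ltW.
have w0 : 0 < N%:R + 2^-1 :> R by rewrite ltr_wpDl.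
have c0 : 0 < 1 - x by rewrite subr_gt0.
have c1 : (1 - x) / 4 <= cos (pi / 2 * x) by apply: cos_ge; rewrite x0 ltW.
have cc : 0 < cos (pi / 2 * x) by apply: lt_le_trans c1; rewrite divr_gt0.
have D0 : 0 < (N%:R + 2^-1) * pi * cos (pi / 2 * x) by rewrite !mulr_gt0// pi_gt0.
have := saw_far N x01; rewrite ler_pdivlMr// => H.
have zE : z = 2 * (N%:R + 2^-1) * (1 - x) by rewrite /z; field.
have le1 : (N%:R + 2^-1) * (1 - x) / 2 <= (N%:R + 2^-1) * pi * cos (pi / 2 * x).
  rewrite -[leLHS]mulrA -[leRHS]mulrA ler_pM2l//; have p2 := pi_ge2 R.
  apply: (@le_trans _ _ (2 * cos (pi / 2 * x))); first by lra.
  by rewrite ler_pM2r.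
have := ler_wpM2l (normr_ge0 (saw N x)) le1.
move: H; rewrite zE; set a := `|saw N x|; set b := (N%:R + 2^-1) * (1 - x).
set e := _ * cos _ => H1 H2.
have -> : 2 * (N%:R + 2^-1) * (1 - x) = 2 * b by rewrite /b; ring.
by lra.
Qed.

Lemma saw_le8 N (x : R) : 0 <= x < 1 -> `|saw N x| <= 8.
Proof.
move=> x01; have [h1 h2] := saw_min N x01.
set z := _ * (1 - x) in h1 h2; have [z1|z1] := leP z 1; first by lra.
by have := normr_ge0 (saw N x); nra.
Qed.

(** Interpolation between the two bounds of [saw_min]: for [z <= 1] both [|saw| <= 2] and
    [root4 z <= 1], for [z > 1] one has [root4 z <= z] and [|saw| * z <= 8]. Finally
    [N + 1 <= 2 N + 1]. *)
Lemma saw_le N (x : R) : 0 <= x < 1 -> `|saw N x| <= 8 / (root4 N.+1%:R * root4 (1 - x)).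
Proof.
move=> x01; have [h1 h2] := saw_min N x01; have /andP[x0 x1] := x01.
have x1' : 0 < 1 - x by rewrite subr_gt0.
set z := _ * (1 - x) in h1 h2.
have z0 : 0 < z by rewrite mulr_gt0// ltr_wpDl// mulr_ge0.
have r0 : 0 < root4 z by rewrite root4_gt0.
have rz : root4 N.+1%:R * root4 (1 - x) <= root4 z.
  rewrite -root4M// ler_root4 ?(ltW z0)// /z ler_pM2r// -natr1.
  by have := ler0n R N; lra.
rewrite ler_pdivlMr; last by rewrite mulr_gt0// root4_gt0.
apply: (@le_trans _ _ (`|saw N x| * root4 z)); first by apply: ler_wpM2l.
have rE := root4X4 (ltW z0).
have [z1|z1] := leP z 1.
  have r1 : root4 z <= 1.
    rewrite leNgt; apply/negP => r1; move: z1; rewrite -rE leNgt.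
    by rewrite exprn_egt1// ltW.
  have := normr_ge0 (saw N x); nra.
apply: le_trans h2; apply: ler_wpM2l => //.
have r1 : 1 <= root4 z.
  rewrite leNgt; apply/negP => r1; move: z1; rewrite -rE ltNge.
  by rewrite exprn_ile1// ltW.
by rewrite -[leRHS]rE (exprS _ 3) ler_peMr ?exprn_ege1// ltW.
Qed.

End Sawtooth.

(** * Summability and square integrability of the majorants *)

Section Root4.
Context {R : realType}.
Notation mu := (@lebesgue_measure R).

Definition five_fourths k : R := (k.+1%:R * root4 k.+1%:R)^-1.

Lemma five_fourths_ge0 k : 0 <= five_fourths k.
Proof. by rewrite invr_ge0 mulr_ge0// root4_ge0. Qed.

(* The step is [1/(n b_n) <= 4 (1/b_(n-1) - 1/b_n)] where [b_n] is the fourth root of [n] *)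
Let five_fourths_partial N : series five_fourths N.+1 <= 5 - 4 / root4 N.+1%:R.
Proof.
elim: N => [|N IH].
  rewrite /series /= big_nat1 /five_fourths.
  by rewrite (_ : root4 1%:R = 1) ?mulr1 ?invr1; [lra|rewrite /root4 !sqrtr1].
rewrite /series /= big_nat_recr//=; move: IH; rewrite /series /= /five_fourths.
have c4 := root4X4 (ler0n R N.+2); have b4 := root4X4 (ler0n R N.+1).
have c0 : 0 < root4 (N.+2%:R : R) by rewrite root4_gt0.
have b0 : 0 < root4 (N.+1%:R : R) by rewrite root4_gt0.
have bc : root4 N.+1%:R <= root4 N.+2%:R :> R by rewrite ler_root4// ler_nat.
rewrite -[X in (X * root4 N.+2%:R)^-1]c4.
have E : root4 N.+2%:R ^+ 4 = root4 N.+1%:R ^+ 4 + 1 :> R by rewrite c4 b4 natr1.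
move: c0 b0 bc E {c4 b4}; move: (root4 N.+2%:R) (root4 N.+1%:R) (bigop _ _ _) => c b s.
move=> c0 b0 bc E IH.
suff : (c ^+ 4 * c)^-1 <= 4 / b - 4 / c by lra.
have -> : 4 / b - 4 / c = 4 * (c - b) / (b * c) by field; rewrite !gt_eqF.
rewrite ler_pdivlMr ?mulr_gt0// mulrC ler_pdivrMr ?mulr_gt0 ?exprn_gt0//.
have E1 : (c - b) * ((c + b) * (c ^+ 2 + b ^+ 2)) = 1.
  by rewrite [RHS](_ : 1 = c ^+ 4 - b ^+ 4); [ring|rewrite E; ring].
have le1 : (c + b) * (c ^+ 2 + b ^+ 2) <= (2 * c) * (2 * c ^+ 2).
  apply: ler_pM; [lra|by rewrite addr_ge0 ?sqr_ge0|lra|].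
  have : b ^+ 2 <= c ^+ 2 by rewrite lerXn2r ?nnegrE ?(ltW b0) ?(ltW c0).
  by lra.
have cb0 : 0 <= c - b by lra.
have : 1 <= (c - b) * ((2 * c) * (2 * c ^+ 2)).
  by rewrite -[leLHS]E1; exact: ler_wpM2l.
move=> H; have := ler_wpM2l (mulr_ge0 (ltW c0) (ltW c0)) H.
have -> : c * c * ((c - b) * (2 * c * (2 * c ^+ 2))) = 4 * (c - b) * (c ^+ 4 * c) by ring.
by apply: le_trans; rewrite mulr1 ler_pM2r.
Qed.

Lemma is_cvg_five_fourths : cvgn (series five_fourths).
Proof.
apply: nondecreasing_is_cvgn.
  apply/nondecreasing_seqP => n; rewrite /series /= big_nat_recr//= lerDl.
  exact: five_fourths_ge0.
exists 5 => _ [[|n] _ <-]; first by rewrite series0.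
apply: le_trans (five_fourths_partial n) _.
by rewrite gerBl divr_ge0// root4_ge0.
Qed.

(** An improper integral: the primitive [-2 sqrt (1 - x)] is used on intervals [[0, b n]] that stay
    away from the singularity, and monotone convergence exhausts []0, 1[]. *)
Let sqrt1_le2 : (\int[mu]_(x in `]0%R, 1%R[) ((Num.sqrt (1 - x))^-1)%:E <= 2%:E)%E.
Proof.
pose f (x : R) := (Num.sqrt (1 - x))^-1.
pose G (x : R) := -2 * Num.sqrt (-1 * x + 1).
have dG (x : R) : x < 1 -> is_derive x (1 : R) G (f x).
  move=> x1; have s0 : 0 < -1 * x + 1 by lra.
  have s1 : Num.sqrt (-1 * x + 1) != 0 by rewrite gt_eqF// sqrtr_gt0.
  have ds := der_comp (g := fun y => -1 * y + 1) (is_derive1_sqrt s0) (der_affine (-1) 1 x).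
  apply: (is_derive_eq (derZ (-2) ds)).
  rewrite /f (_ : 1 - x = -1 * x + 1); last by ring.
  by field.
have f0 x : 0 <= f x by rewrite invr_ge0 sqrtr_ge0.
have cf (x : R) : x < 1 -> {for x, continuous f}.
  move=> x1; apply: cvgV; first by rewrite gt_eqF// sqrtr_gt0 subr_gt0.
  apply: continuous_cvg; first exact: sqrt_continuous.
  by apply: cvgB; [exact: cvg_cst|exact: cvg_id].
(* The shift by two keeps [b 0] positive, as the fundamental theorem of calculus requires a
   nondegenerate interval. *)
pose b n : R := 1 - n.+2%:R^-1.
have b1 n : b n < 1 by rewrite gtrBl invr_gt0.
have b0 n : 0 < b n.
  by rewrite subr_gt0 invf_lt1// ltr1n.
pose F n : set (measurableTypeR R) := `[0, b n]%classic.
have mF n : measurable (F n) by exact: measurable_itv.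
have cFf n : {within `[0, b n], continuous f}.
  apply: continuous_in_subspaceT => x; rewrite inE /F /= in_itv /= => /andP[_ xb].
  by apply: cf; exact: le_lt_trans (b1 n).
have mFf n : measurable_fun (F n) f.
  by apply: subspace_continuous_measurable_fun; [exact: measurable_itv|exact: cFf].
have Fle n : (\int[mu]_(x in F n) (f x)%:E <= 2%:E)%E.
  rewrite (@continuous_FTC2 _ f G 0 (b n) (b0 n) (cFf n)).
  - rewrite -EFinB lee_fin /G !mulr0 add0r sqrtr1.
    by have := sqrtr_ge0 (-1 * b n + 1); lra.
  - have dGb (x : R) : x <= b n -> is_derive x (1 : R) G (f x).
      by move=> xb; apply: dG; exact: le_lt_trans (b1 n).
    have cG (x : R) : x <= b n -> {for x, continuous G}.
      move=> xb; apply: differentiable_continuous; apply/derivable1_diffP.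
      by case: (dGb x xb).
    split.
    + by move=> x; rewrite in_itv /= => /andP[_ /ltW /dGb []].
    + by apply: cvg_at_right_filter; apply: cG; exact: ltW.
    + by apply: cvg_at_left_filter; exact: cG.
  - move=> x; rewrite in_itv /= => /andP[_ /ltW xb]; rewrite derive1E.
    by have [] := dG x (le_lt_trans xb (b1 n)).
have ndF : {homo F : n m / (n <= m)%N >-> (n <= m)%O}.
  move=> n m nm; rewrite subsetEset => x; rewrite /F /= !in_itv /= => /andP[-> xb] /=.
  apply: le_trans xb _; rewrite lerD2l lerN2 lef_pV2 ?posrE//.
  by rewrite ler_nat.
have H : (\int[mu]_(x in F i) (f x)%:E)%E @[i --> \oo] -->
    (\int[mu]_(x in \bigcup_i F i) (f x)%:E)%E.
  apply: ge0_nondecreasing_set_cvg_integral => //.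
  - by move=> n; apply/measurable_EFinP; exact: mFf.
  - by move=> n x _; rewrite lee_fin.
apply: (@le_trans _ _ (\int[mu]_(x in \bigcup_i F i) (f x)%:E)%E).
  apply: ge0_subset_integral => //.
  - exact: bigcup_measurable.
  - by apply/measurable_EFinP; apply/measurable_fun_bigcup.
  - move=> x /=; rewrite in_itv /= => /andP[x0 x1].
    have /cvgrPdist_lt/(_ (1 - x)) := @cvg_harmonic R; rewrite subr_gt0.
    move=> /(_ x1) [n _ /(_ n (leqnn n))] /=; rewrite sub0r normrN ger0_norm// => nx.
    exists n => //; rewrite /F /= in_itv /= (ltW x0) /= /b.
    have : n.+2%:R^-1 <= n.+1%:R^-1 :> R by rewrite lef_pV2 ?posrE// ler_nat.
    move: nx; rewrite /harmonic /= => h1 h2.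
    by rewrite lerBrDr -lerBrDl; exact: le_trans h2 (ltW h1).
have aux l : (\int[mu]_(x in F i) (f x)%:E)%E @[i --> \oo] --> l -> (l <= 2%:E)%E.
  move=> Hl; rewrite -(cvg_lim _ Hl)//; apply: lime_le; last exact: nearW.
  by apply/cvg_ex; exists l.
exact: aux H.
Qed.

Lemma root4V_L2 : in_L2 mu `]0, 1[ (fun x => (root4 (1 - x))^-1).
Proof.
split.
  apply: open_continuous_measurable_fun; first exact: interval_open.
  move=> x; rewrite inE /= in_itv /= => /andP[_ x1].
  apply: cvgV; first by rewrite gt_eqF// root4_gt0 subr_gt0.
  rewrite /root4.
  apply: continuous_cvg; first exact: sqrt_continuous.
  apply: continuous_cvg; first exact: sqrt_continuous.
  by apply: cvgB; [exact: cvg_cst|exact: cvg_id].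
apply: le_lt_trans (_ : _ <= 2%:E)%E _; last by rewrite ltry.
apply: le_trans sqrt1_le2; rewrite le_eqVlt; apply/orP; left; apply/eqP.
apply: eq_integral => x; rewrite inE /= in_itv /= => /andP[_ x1].
by rewrite exprVn /root4 sqr_sqrtr// sqrtr_ge0.
Qed.

End Root4.

(** * Existence of states *)

Lemma within_continuousM (R : realType) (A : set R) (f g : R -> R) :
  {within A, continuous f} -> {within A, continuous g} ->
  {within A, continuous (fun x => f x * g x)}.
Proof. by move=> cf cg /= z; apply: continuousM; [exact: cf|exact: cg]. Qed.

Section StateExistence.
Context {R : realType}.
Notation mu := (@lebesgue_measure R).
Variables (T : R) (u : R -> R).
Hypothesis T_gt0 : 0 < T.
Hypothesis u_measurable : measurable_fun `]0, T[ u.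
Hypothesis u_le : forall t : R, 0 < t < T -> `|u t| <= 1.

Let lam n : R := (n%:R * pi) ^+ 2.
Let I n (t : R) := \int[mu]_(s in `]0, t[) (expR (lam n * (s - t)) * u s).
(** The term [al n * dmode n] of the derivative is [m n] times the corresponding increment of [saw];
    these multipliers are bounded by 1 but need not decay. *)
Let m n (t : R) := lam n * I n t.
(** The value at 1 of the [n]-th cosine divided by its squared norm: the cosine coefficients of
    evaluation at [x = 1]. *)
Let ka n : R := if n is 0 then 1 else 2 * (-1) ^+ n.
Let al n (t : R) := ka n * I n t.
Let dmode n (x : R) := - (n%:R * pi * sin (n%:R * pi * x)).
Let dS t x := series (fun n => al n t * dmode n x).

Let u_integrable t : t <= T -> mu.-integrable `]0, t[ (EFin \o u).
Proof.
move=> tT; apply: (@integrableS _ _ _ mu `]0, T[) => //.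
  by apply: subset_itvl; rewrite bnd_simp.
apply: in_L2_integrable => //; first exact: itvoo_lty.
by apply: (in_L2_bounded (C := 1)) => //; exact: itvoo_lty.
Qed.

Let E_derive n t (s : R) : is_derive s (1 : R)
  (fun s => expR (lam n * (s - t))) (lam n * expR (lam n * (s - t))).
Proof.
have dl : is_derive s (1 : R) (fun s => lam n * (s - t)) (lam n).
  have -> : (fun s => lam n * (s - t)) = (fun s => lam n * s + - (lam n * t)).
    by apply/funext => y; ring.
  exact: der_affine.
by apply: (is_derive_eq (der_comp (is_derive_expR _) dl)); rewrite mulrC.
Qed.

Let E_continuous n t : continuous (fun s => expR (lam n * (s - t))).
Proof. exact: is_derive_continuous (E_derive n t). Qed.

Let E_integrable n t : mu.-integrable `]0, t[ (EFin \o (fun s => expR (lam n * (s - t)))).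
Proof. by apply: continuous_integrable_oo; exact: E_continuous. Qed.

Let Eu_integrable n t : t <= T ->
  mu.-integrable `]0, t[ (EFin \o (fun s => expR (lam n * (s - t)) * u s)).
Proof.
move=> tT; have := integrable_mul_continuous (u_integrable tT) (@E_continuous n t).
by apply: eq_integrable => // s _ /=; rewrite mulrC.
Qed.

Let E_int n t : 0 <= t ->
  lam n * \int[mu]_(s in `]0, t[) expR (lam n * (s - t)) = 1 - expR (- (lam n * t)).
Proof.
move=> t0; rewrite -RintegralZl// (FTC2oo t0 (E_derive n t)).
  by rewrite subrr mulr0 expR0 sub0r mulrN.
by move=> s; apply: cvgMr; exact: E_continuous.
Qed.

Let lam_ge0 n : 0 <= lam n. Proof. exact: sqr_ge0. Qed.

Let I_le n t : 0 <= t <= T ->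
  `|I n t| <= \int[mu]_(s in `]0, t[) expR (lam n * (s - t)).
Proof.
move=> /andP[t0 tT]; apply: le_trans (le_normr_Rintegral _ (Eu_integrable n tT)) _ => //.
apply: le_Rintegral => //; first by apply: integrable_norm; exact: Eu_integrable.
move=> s /=; rewrite in_itv /= => /andP[s0 st].
rewrite normrM ger0_norm ?expR_ge0// ler_piMr ?expR_ge0//.
by apply: u_le; rewrite s0 (lt_le_trans st).
Qed.

Let m_le1 n t : 0 <= t <= T -> `|m n t| <= 1.
Proof.
move=> tT; rewrite normrM (ger0_norm (lam_ge0 n)).
apply: le_trans (ler_wpM2l (lam_ge0 n) (I_le n tT)) _.
by have /andP[t0 _] := tT; rewrite E_int// gerBl expR_ge0.
Qed.

Let m0 t : m 0 t = 0.
Proof. by rewrite /m /lam mul0r expr0n mul0r. Qed.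

Let lamS n : lam n <= lam n.+1.
Proof.
rewrite /lam lerXn2r ?nnegrE ?mulr_ge0 ?pi_ge0//.
by rewrite ler_wpM2r ?pi_ge0// ler_nat.
Qed.

(* The kernel [lam exp (- lam tau)] has total variation at most
   [2 (lam' - lam) / lam'] when [lam] increases to [lam']. *)
Let m_variation n t : 0 <= t <= T -> `|m n.+1 t - m n t| <= 4 / n.+1%:R.
Proof.
move=> tT; have /andP[t0 tT'] := tT; rewrite /m /I.
have l0 : 0 < lam n.+1 by rewrite /lam exprn_gt0// mulr_gt0// pi_gt0.
rewrite -RintegralZl//; last exact: Eu_integrable.
rewrite -RintegralZl//; last exact: Eu_integrable.
have i1 : mu.-integrable `]0, t[ (EFin \o (fun s => lam n.+1 * (expR (lam n.+1 * (s - t)) * u s))).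
  by apply: integrable_fZ => //; exact: Eu_integrable.
have i2 : mu.-integrable `]0, t[ (EFin \o (fun s => lam n * (expR (lam n * (s - t)) * u s))).
  by apply: integrable_fZ => //; exact: Eu_integrable.
rewrite -RintegralB//.
have j1 : mu.-integrable `]0, t[
    (EFin \o (fun s => (lam n.+1 - 2 * lam n) * expR (lam n.+1 * (s - t)))).
  exact: integrable_fZ.
have j2 : mu.-integrable `]0, t[ (EFin \o (fun s => lam n * expR (lam n * (s - t)))).
  exact: integrable_fZ.
apply: le_trans (le_normr_Rintegral _ (integrable_fB _ i1 i2)) _ => //.
(* With [l <= l'] the two rates and [a <= b] the exponentials for [l'] and [l], one has
   [l' a - l b = (l' - l) a - l (b - a)]; the majorant adds the two nonnegative parts. *)
apply: (@le_trans _ _ (\int[mu]_(s in `]0, t[)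
   ((lam n.+1 - 2 * lam n) * expR (lam n.+1 * (s - t)) + lam n * expR (lam n * (s - t))))).
  apply: le_Rintegral => //.
  - by apply: integrable_norm; exact: integrable_fB.
  - exact: integrable_fD.
  - move=> s /=; rewrite in_itv /= => /andP[s0 st].
    have us : `|u s| <= 1 by apply: u_le; rewrite s0 (lt_le_trans st).
    rewrite (_ : _ - _ = (lam n.+1 * expR (lam n.+1 * (s - t)) -
      lam n * expR (lam n * (s - t))) * u s) ?normrM; last by ring.
    apply: (@le_trans _ _ (`|lam n.+1 * expR (lam n.+1 * (s - t)) - lam n * expR (lam n * (s - t))|)).
      by rewrite ler_piMr.
    have e1 : expR (lam n.+1 * (s - t)) <= expR (lam n * (s - t)).
      by rewrite ler_expR ler_wnM2r ?lamS// subr_le0 ltW.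
    have e0 : 0 <= expR (lam n.+1 * (s - t)) by exact: expR_ge0.
    have := lamS n; have := lam_ge0 n; move: e1 e0.
    move: (expR (lam n.+1 * (s - t))) => a; move: (expR (lam n * (s - t))) => b.
    move: (lam n.+1) => l'; move: (lam n) => l ab a0 l0' ll.
    rewrite (_ : l' * a - l * b = (l' - l) * a - l * (b - a)); last by ring.
    rewrite (_ : (l' - 2 * l) * a + l * b = (l' - l) * a + l * (b - a)); last by ring.
    apply: le_trans (ler_normB _ _) _.
    by rewrite !ger0_norm ?mulr_ge0 ?subr_ge0.
rewrite RintegralD// !RintegralZl// E_int//.
have := E_int n.+1 t0; set J := Rintegral _ _ _ => HJ.
have JE : J = (1 - expR (- (lam n.+1 * t))) / lam n.+1 by rewrite -HJ mulrC mulKf// gt_eqF.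
have e1 : expR (- (lam n.+1 * t)) <= expR (- (lam n * t)).
  by rewrite ler_expR lerN2 ler_wpM2r.
have e0 : 0 <= expR (- (lam n.+1 * t)) by exact: expR_ge0.
pose r := lam n / lam n.+1.
have r1 : r <= 1 by rewrite ler_pdivrMr// mul1r lamS.
have -> : (lam n.+1 - 2 * lam n) * J = (1 - 2 * r) * (1 - expR (- (lam n.+1 * t))).
  have l0n : lam n.+1 != 0 by rewrite gt_eqF.
  by rewrite JE /r; field.
(* The boundary exponentials are discarded using [r <= 1] and their order. Then
   [1 - r = (2 n + 1) / (n + 1)^2] yields the rate [4 / (n + 1)]. *)
apply: (@le_trans _ _ (2 * (1 - r))).
  move: e1 e0; move: (expR _) (expR _) => a b ab a0; nra.
have -> : r = n%:R ^+ 2 / n.+1%:R ^+ 2.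
  have pn : (pi : R) != 0 by rewrite gt_eqF// pi_gt0.
  rewrite /r /lam; move: (pi : R) pn => p pn.
  by field; rewrite pn andbT nat1r pnatr_eq0.
rewrite -[n.+1%:R]natr1; have := ler0n R n; move: (n%:R : R) => x x0.
have x1 : 0 < x + 1 by lra.
rewrite ler_pdivlMr//.
have -> : 2 * (1 - x ^+ 2 / (x + 1) ^+ 2) * (x + 1) = 2 * (2 * x + 1) / (x + 1).
  by field; rewrite gt_eqF.
by rewrite ler_pdivrMr//; lra.
Qed.

(** Abel summation, whose lower boundary term vanishes with [m 0]. The index is shifted because the
    series starts with the constant mode, which has no derivative. *)
Let dS_saw N t x : dS t x N.+1 =
  saw N x * m N t - \sum_(0 <= j < N) saw j x * (m j.+1 t - m j t).
Proof.
elim: N => [|N IH].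
  rewrite /dS /series /= big_nat1 big_geq// m0 mulr0 subr0.
  by rewrite /dmode mul0r mul0r oppr0 mulr0.
have -> : dS t x N.+2 = dS t x N.+1 + al N.+1 t * dmode N.+1 x.
  by rewrite /dS /series /= big_nat_recr.
rewrite IH big_nat_recr//= sawS.
have -> : al N.+1 t * dmode N.+1 x =
   - (2 * (-1) ^+ N.+1 * (sin (N.+1%:R * pi * x) / (N.+1%:R * pi))) * m N.+1 t.
  have pn : (pi : R) != 0 by rewrite gt_eqF// pi_gt0.
  rewrite /al /dmode /m /ka /lam; move: ((-1) ^+ N.+1) (sin _) (I _ _) => a b c.
  move: (pi : R) pn => p pn.
  by field; rewrite pn /= ?andbT nat1r pnatr_eq0.
ring.
Qed.

Let r4 (x : R) := (root4 (1 - x))^-1.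
(** The 8 is the boundary term of [dS_saw]; 32 is the product of the 8 in [saw_le] and the 4 in
    [m_variation]. *)
Let h x := (8 + 32 * limn (series (@five_fourths R))) * r4 x.

Let saw_r4 N x : 0 <= x < 1 -> `|saw N x| <= 8 * r4 x * (root4 N.+1%:R)^-1.
Proof.
move=> x01; apply: le_trans (saw_le N x01) _.
by rewrite /r4 invfM [(root4 N.+1%:R)^-1 * _]mulrC mulrA.
Qed.

Let r4_ge0 x : 0 <= r4 x. Proof. by rewrite invr_ge0 root4_ge0. Qed.

Let root4_ge1 N : 1 <= root4 N.+1%:R :> R.
Proof.
apply: (@le_trans _ _ (root4 1)); first by rewrite /root4 !sqrtr1.
by rewrite ler_root4// ler1n.
Qed.

Let term_le t x : 0 <= t <= T -> 0 <= x < 1 -> forall j,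
  `|saw j x * (m j.+1 t - m j t)| <= (32 * r4 x) * five_fourths j.
Proof.
move=> tT x01 j; rewrite normrM.
apply: le_trans (ler_pM _ _ (saw_r4 j x01) (m_variation j tT)) _ => //.
rewrite /five_fourths invfM le_eqVlt; apply/orP; left; apply/eqP; ring.
Qed.

Let B_cvg x : cvgn (series (fun j => (32 * r4 x) * five_fourths j)).
Proof. by apply: is_cvg_seriesZ; exact: is_cvg_five_fourths. Qed.

Let B_lim x : limn (series (fun j => (32 * r4 x) * five_fourths j)) =
  (32 * r4 x) * limn (series (@five_fourths R)).
Proof. by rewrite -[RHS]lim_seriesZ//; exact: is_cvg_five_fourths. Qed.

Let lim5_ge0 : 0 <= limn (series (@five_fourths R)).
Proof.
have := series_le_lim 0%N (@five_fourths_ge0 R) (@is_cvg_five_fourths R).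
by rewrite series0.
Qed.

Let dS_le N t x : 0 < t < T -> 0 < x < 1 -> `|dS t x N| <= h x.
Proof.
move=> /andP[t0 tT] /andP[x0 x1].
have tT' : 0 <= t <= T by rewrite !ltW.
have x01 : 0 <= x < 1 by rewrite ltW.
case: N => [|N].
  by rewrite /dS series0 normr0 mulr_ge0// addr_ge0// mulr_ge0.
have -> : h x = 8 * r4 x + 32 * limn (series (@five_fourths R)) * r4 x by rewrite /h mulrDl.
rewrite dS_saw; apply: le_trans (ler_normB _ _) _; apply: lerD.
  rewrite normrM -[leRHS]mulr1; apply: ler_pM => //; last exact: m_le1.
  apply: le_trans (saw_r4 N x01) _; rewrite ler_piMr ?mulr_ge0//.
  by rewrite invf_le1 ?root4_ge1// root4_gt0.
have := series_norm_le (term_le tT' x01) (@B_cvg x) N.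
by rewrite B_lim /series /= => /le_trans; apply; rewrite mulrAC.
Qed.

Let root4_cvg0 : (root4 N.+1%:R)^-1 @[N --> \oo] --> (0 : R).
Proof.
have -> : (fun N => (root4 N.+1%:R)^-1) = (fun N => Num.sqrt (Num.sqrt (@harmonic R N))).
  by apply/funext => N; rewrite /root4 /harmonic /= !sqrtrV// sqrtr_ge0.
rewrite -[X in _ --> X](_ : Num.sqrt (Num.sqrt 0) = 0); last by rewrite !sqrtr0.
apply: continuous_cvg; first exact: sqrt_continuous.
apply: continuous_cvg; first exact: sqrt_continuous.
exact: cvg_harmonic.
Qed.

Lemma saw_cvg0 x : 0 <= x < 1 -> saw N x @[N --> \oo] --> (0 : R).
Proof.
move=> x01; apply/norm_cvg0P.
have c1 : 8 * r4 x * (root4 N.+1%:R)^-1 @[N --> \oo] --> (8 * r4 x * 0 : R).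
  by apply: cvgMr; exact: root4_cvg0.
rewrite mulr0 in c1.
apply: squeeze_cvgr (cvg_cst 0) c1; apply: nearW => N.
by rewrite normr_ge0 saw_r4.
Qed.

Let dS_cvg t x : 0 < t < T -> 0 < x < 1 ->
  dS t x N @[N --> \oo] --> limn (dS t x).
Proof.
move=> /andP[t0 tT] /andP[x0 x1].
have tT' : 0 <= t <= T by rewrite !ltW.
have x01 : 0 <= x < 1 by rewrite ltW.
suff : cvgn (dS t x) by [].
have c1 : saw N x * m N t @[N --> \oo] --> (0 : R).
  have c1 : `|saw N x| @[N --> \oo] --> (0 : R) by apply/norm_cvg0P; exact: saw_cvg0.
  apply/norm_cvg0P.
  apply: squeeze_cvgr (cvg_cst 0) c1; apply: nearW => N.
  by rewrite normr_ge0 normrM ler_piMr// m_le1.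
have c2 := series_dominated (term_le tT' x01) (@B_cvg x).
apply/cvg_ex; exists (0 - limn (series (fun j => saw j x * (m j.+1 t - m j t)))).
rewrite -cvg_shiftS /=; under eq_fun do rewrite dS_saw.
exact: cvgB.
Qed.

(** The decay [1 / lam n] is weakened to the exponent 5/4, for which summability is at hand. *)
Let A n : R := if n is k.+1 then 2 * five_fourths k else T.

Let A_cvg : cvgn (series A).
Proof.
apply/cvg_ex; exists (T + 2 * limn (series (@five_fourths R))).
rewrite -cvg_shiftS /=.
have -> : (fun N => series A N.+1) = (fun N => T + 2 * series (@five_fourths R) N).
  apply/funext => N; rewrite /series /= big_nat_recl//= mulr_sumr; congr (_ + _).
apply: cvgD; [exact: cvg_cst|apply: cvgMr; exact: is_cvg_five_fourths].
Qed.

Let al_le n t : 0 <= t <= T -> `|al n t| <= A n.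
Proof.
move=> tT; have /andP[t0 tT'] := tT; case: n => [|n].
  rewrite /al mul1r; apply: le_trans (I_le 0 tT) _.
  have -> : lam 0 = 0 by rewrite /lam mul0r expr0n.
  under eq_Rintegral do rewrite mul0r expR0.
  rewrite (@FTC2oo _ (fun x => x) (fun=> 1) 0 t t0)//.
    by rewrite subr0.
  by move=> x; exact: cvg_cst.
rewrite /al /A /ka normrM normrM normr_sign mulr1 ger0_norm// ler_pM2l//.
have l0 : 0 < lam n.+1 by rewrite /lam exprn_gt0// mulr_gt0// pi_gt0.
have -> : I n.+1 t = (lam n.+1)^-1 * m n.+1 t by rewrite /m mulKf// gt_eqF.
rewrite normrM ger0_norm ?invr_ge0 ?(ltW l0)//.
apply: (@le_trans _ _ (lam n.+1)^-1); first by rewrite ler_piMr ?invr_ge0 ?(ltW l0)// m_le1.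
have n0 : 0 < n.+1%:R * root4 n.+1%:R :> R by rewrite mulr_gt0// root4_gt0.
rewrite lef_pV2 ?posrE// /lam exprMn.
have n1 : 1 <= n.+1%:R :> R by rewrite ler1n.
have p2 := pi_ge2 R.
have r_le : root4 n.+1%:R <= n.+1%:R :> R.
  rewrite -[leRHS](root4X4 (ler0n _ _)) (exprS _ 3).
  by rewrite ler_peMr ?root4_ge0// exprn_ege1// root4_ge1.
apply: (@le_trans _ _ (n.+1%:R ^+ 2)); first by rewrite expr2 ler_pM2l.
by rewrite ler_peMr ?sqr_ge0// exprn_ege1//; lra.
Qed.

(** Taking [t] out of the integrand makes [I n] a smooth factor times a primitive, from which both
    continuity and the weak derivative are read off. *)
Let I_split n t : t <= T ->
  I n t = expR (- (lam n * t)) * \int[mu]_(s in `]0, t[) (expR (lam n * s) * u s).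
Proof.
move=> tT; rewrite -RintegralZl//.
  by apply: eq_Rintegral => s _; rewrite mulrA -expRD; congr (expR _ * _); ring.
have cE : continuous (fun s => expR (lam n * s)).
  move=> s; apply: continuous_cvg; first exact: continuous_expR.
  by apply: cvgMr; exact: cvg_id.
have := integrable_mul_continuous (u_integrable tT) cE.
by apply: eq_integrable => // s _ /=; rewrite mulrC.
Qed.

Let E0_continuous n : continuous (fun s => expR (lam n * s)).
Proof.
move=> s; apply: continuous_cvg; first exact: continuous_expR.
by apply: cvgMr; exact: cvg_id.
Qed.

Let E0u_integrable n : mu.-integrable `]0, T[ (EFin \o (fun s => expR (lam n * s) * u s)).
Proof.
have := integrable_mul_continuous (u_integrable (lexx T)) (@E0_continuous n).
by apply: eq_integrable => // s _ /=; rewrite mulrC.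
Qed.

Let EN_derive n (t : R) : is_derive t (1 : R)
  (fun t => expR (- (lam n * t))) (- (lam n * expR (- (lam n * t)))).
Proof.
have dl : is_derive t (1 : R) (fun t => - (lam n * t)) (- lam n).
  have -> : (fun t => - (lam n * t)) = (fun t => - lam n * t + 0).
    by apply/funext => y; ring.
  exact: der_affine.
by apply: (is_derive_eq (der_comp (is_derive_expR _) dl)); ring.
Qed.

Let I_continuous n : {within `[0, T], continuous (I n)}.
Proof.
have cF := primitive_continuous (ltW T_gt0) (E0u_integrable n).
have cE : {within `[0, T], continuous (fun t => expR (- (lam n * t)))}.
  by apply: continuous_subspaceT; exact: is_derive_continuous (EN_derive n).
have cp : {within `[0, T], continuous (fun t => expR (- (lam n * t)) *
    \int[mu]_(s in `]0, t[) (expR (lam n * s) * u s))}.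
  exact: within_continuousM.
apply: subspace_eq_continuous cp => t.
by rewrite inE /= in_itv /= => /andP[_ tT]; rewrite /from_subspace /= I_split.
Qed.

Let al_continuous n : {within `[0, T], continuous (al n)}.
Proof.
have cc : {within `[0, T], continuous (fun _ : R => ka n)}.
  by apply: continuous_subspaceT => x; exact: cvg_cst.
have cI : {within `[0, T], continuous (fun t => ka n * I n t)}.
  by apply: within_continuousM => //; exact: I_continuous.
exact: cI.
Qed.

(** Integration by parts of [expR (lam n * t) * u t] against [phi t * expR (- (lam n * t))]: the
    exponentials cancel in the first term, and the derivative of the second one produces the damping
    [- lam n * I n]. *)
Let al_weak n phi : test_function 0 T phi ->
  \int[mu]_(t in `]0, T[) (derive1 phi t * al n t) =
  - \int[mu]_(t in `]0, T[) (phi t * (- 1 * lam n * al n t + u t * ka n)).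
Proof.
move=> tphi.
have dphi := test_function_is_derive tphi.
have [f1 [df1 [f2 [df2 _]]]] := derive1n_ntimes_diff (proj1 tphi) 2.
have E : derive1 phi = f1 by exact: derive1_is_derive.
have cf1 : continuous (derive1 phi) by rewrite E; exact: is_derive_continuous df2.
have cphi := is_derive_continuous dphi.
have Ii : mu.-integrable `]0, T[ (EFin \o I n) by exact: within_continuous_integrable_oo.
have fIi (f : R -> R) : continuous f -> mu.-integrable `]0, T[ (EFin \o (fun t => f t * I n t)).
  move=> cf; apply: eq_integrable (integrable_mul_continuous Ii cf) => //.
  by move=> t _ /=; rewrite mulrC.
have fui (f : R -> R) : continuous f -> mu.-integrable `]0, T[ (EFin \o (fun t => f t * u t)).
  move=> cf; apply: eq_integrable (integrable_mul_continuous (u_integrable (lexx T)) cf) => //.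
  by move=> t _ /=; rewrite mulrC.
have cEN : continuous (fun t => expR (- (lam n * t))) by exact: is_derive_continuous (EN_derive n).
have dG (t : R) := derM (dphi t) (EN_derive n t).
have ck : continuous (fun t => derive1 phi t * expR (- (lam n * t)) +
    phi t * - (lam n * expR (- (lam n * t)))).
  move=> t; apply: cvgD; apply: cvgM; [exact: cf1|exact: cEN|exact: cphi|].
  by apply: cvgN; apply: cvgMr; exact: cEN.
have := absolutely_continuous_by_parts (ltW T_gt0) (E0u_integrable n) dG ck.
rewrite (test_function_out (x := T) tphi) ?ltxx ?andbF// mul0r mulr0.
have -> : \int[mu]_(x in `]0, T[) (expR (lam n * x) * u x * (phi x * expR (- (lam n * x))))
   = \int[mu]_(x in `]0, T[) (phi x * u x).
  apply: eq_Rintegral => x _; rewrite expRN; field.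
  by rewrite gt_eqF// expR_gt0.
have -> : \int[mu]_(s in `]0, T[) ((\int[mu]_(x in `]0, s[) (expR (lam n * x) * u x)) *
      (derive1 phi s * expR (- (lam n * s)) + phi s * - (lam n * expR (- (lam n * s))))) =
   \int[mu]_(s in `]0, T[) (derive1 phi s * I n s - lam n * (phi s * I n s)).
  apply: eq_Rintegral => s; rewrite inE /= in_itv /= => /andP[_ /ltW sT].
  by rewrite (I_split n sT); ring.
rewrite RintegralB//; [|exact: fIi|by apply: integrable_fZ => //; exact: fIi].
rewrite RintegralZl//; last exact: fIi.
move=> H.
have -> : \int[mu]_(t in `]0, T[) (derive1 phi t * al n t) =
   ka n * \int[mu]_(t in `]0, T[) (derive1 phi t * I n t).
  rewrite -RintegralZl//; last exact: fIi.
  by apply: eq_Rintegral => t _; rewrite /al; ring.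
have -> : \int[mu]_(t in `]0, T[) (phi t * (- 1 * lam n * al n t + u t * ka n)) =
   \int[mu]_(t in `]0, T[) ((- lam n * ka n) * (phi t * I n t) + ka n * (phi t * u t)).
  by apply: eq_Rintegral => t _; rewrite /al; ring.
rewrite RintegralD//; [|by apply: integrable_fZ => //; exact: fIi
  |by apply: integrable_fZ => //; exact: fui].
rewrite !RintegralZl//; [|exact: fIi|exact: fui].
have -> : \int[mu]_(t in `]0, T[) (derive1 phi t * I n t) =
  lam n * \int[mu]_(t in `]0, T[) (phi t * I n t) - \int[mu]_(t in `]0, T[) (phi t * u t).
  by apply/eqP; rewrite -subr_eq0; apply/eqP; rewrite -[RHS]H; ring.
by ring.
Qed.

Let saw_continuous N : continuous (@saw R N).
Proof.
elim: N => [|N IH].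
  have -> : @saw R 0 = (fun y => - y) by apply/funext => y; rewrite saw0.
  by move=> x; apply: cvgN; exact: cvg_id.
have -> : @saw R N.+1 = (fun y => saw N y -
    2 * (-1) ^+ N.+1 * (sin (N.+1%:R * pi * y) / (N.+1%:R * pi))).
  by apply/funext => y; rewrite sawS.
move=> x; apply: cvgB; first exact: IH.
by apply: cvgMr; apply: cvgMl; exact: continuous_sin_mul.
Qed.

(** The cosine series of [v] at 1 misses the trace by a pairing of [dv] with the sawtooth remainder,
    which tends to 0 by dominated convergence since [saw] is bounded by 8 and tends to 0 on [[0,
    1[]. *)
Let ka_series N v dv c : in_H1 v dv -> space_trace v 1 c ->
  series (fun n => ka n * \int[mu]_(x in `]0, 1[) (v x * cos (n%:R * pi * x))) N.+1 =
  c + \int[mu]_(x in `]0, 1[) (dv x * saw N x).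
Proof.
move=> vH1 vc; have [v2 dv2 _] := vH1; have dvi := in_L2_integrable01 dv2.
elim: N => [|N IH].
  rewrite /series /= big_nat1 mul1r.
  have c1 : continuous (fun _ : R => 1 : R) by move=> x; exact: cvg_cst.
  have := H1_by_parts (G := fun x : R => x) (k := fun=> 1) vH1 vc
    (fun x => is_derive_id x 1) c1 erefl.
  rewrite mulr1 => <-.
  have -> : \int[mu]_(x in `]0, 1[) (dv x * saw 0 x) = - \int[mu]_(x in `]0, 1[) (dv x * x).
    rewrite -[RHS]mulN1r -RintegralZl//.
      by apply: eq_Rintegral => x _; rewrite saw0; ring.
    by apply: integrable_mul_continuous => // x; exact: cvg_id.
  rewrite addrC addKr; apply: eq_Rintegral => x _.
  by rewrite mulr0n !mul0r cos0.
have -> : series (fun n => ka n * \int[mu]_(x in `]0, 1[) (v x * cos (n%:R * pi * x))) N.+2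
  = series (fun n => ka n * \int[mu]_(x in `]0, 1[) (v x * cos (n%:R * pi * x))) N.+1
    + ka N.+1 * \int[mu]_(x in `]0, 1[) (v x * cos (N.+1%:R * pi * x)).
  by rewrite /series /= big_nat_recr.
rewrite IH -addrA; congr (_ + _).
pose q : R := - (2 * (-1) ^+ N.+1 / (N.+1%:R * pi)).
have -> : \int[mu]_(x in `]0, 1[) (dv x * saw N.+1 x) =
   \int[mu]_(x in `]0, 1[) (dv x * saw N x + q * (dv x * sin (N.+1%:R * pi * x))).
  by apply: eq_Rintegral => x _; rewrite sawS /q; ring.
have i1 : mu.-integrable `]0, 1[ (EFin \o (fun x => dv x * saw N x)).
  exact: integrable_mul_continuous.
have i2 : mu.-integrable `]0, 1[ (EFin \o (fun x => dv x * sin (N.+1%:R * pi * x))).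
  by apply: integrable_mul_continuous => //; exact: continuous_sin_mul.
rewrite RintegralD//; last exact: integrable_fZ.
rewrite RintegralZl// (H1_sin_coef N.+1 vH1); congr (_ + _).
rewrite /q mulrNN /ka.
have np : N.+1%:R * pi != 0 :> R by rewrite mulf_neq0 ?pnatr_eq0// gt_eqF// pi_gt0.
by rewrite -[RHS]mulrA mulKf.
Qed.

Let ka_cvg v dv c : in_H1 v dv -> space_trace v 1 c ->
  series (fun n => ka n * \int[mu]_(x in `]0, 1[) (v x * cos (n%:R * pi * x))) N
    @[N --> \oo] --> 1 * c.
Proof.
move=> vH1 vc; have [_ dv2 _] := vH1; have dvi := in_L2_integrable01 dv2.
have mdv : measurable_fun (`]0, 1[%classic : set R) dv.
  by apply/measurable_EFinP; exact: measurable_int dvi.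
have c2 : \int[mu]_(x in `]0, 1[) (dv x * saw N x) @[N --> \oo] -->
    \int[mu]_(x in `]0, 1[) (0 : R).
  apply: (@dominated_Rintegral _ _ R mu `]0, 1[ (fun N x => dv x * saw N x)
    (fun=> 0) (fun x => 8 * `|dv x|) _ _ _ _ _).2 => //.
  - move=> N; apply: measurable_funM => //; apply: measurable_funTS.
    by apply: continuous_measurable_fun; exact: saw_continuous.
  - move=> x /=; rewrite in_itv /= => /andP[x0 x1].
    rewrite -(mulr0 (dv x)); apply: cvgMr; apply: saw_cvg0; by rewrite ltW.
  - by apply: integrable_fZ => //; exact: integrable_norm.
  - move=> N x /=; rewrite in_itv /= => /andP[x0 x1]; rewrite normrM mulrC ler_wpM2r//.
    by apply: saw_le8; rewrite ltW.
rewrite Rintegral_zero in c2.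
have c3 : c + \int[mu]_(x in `]0, 1[) (dv x * saw N x) @[N --> \oo] --> c + 0.
  by apply: cvgD => //; exact: cvg_cst.
rewrite addr0 in c3.
by rewrite mul1r -cvg_shiftS /=; under eq_fun do rewrite (ka_series _ vH1 vc).
Qed.

Let h_L2 : in_L2 mu `]0, 1[ h.
Proof. by apply: in_L2_Z => //; exact: root4V_L2. Qed.

Lemma state_equation_exists :
  exists y z, state_equation T y u /\ time_trace T y T z.
Proof.
pose dy (t x : R) := limn (dS t x).
have yW := cosine_series_in_W (nu := id) (eps := 1) (delta := 1)
  al_continuous al_le A_cvg h_L2 dS_le dS_cvg al_weak u_measurable u_le ka_cvg.
have yt t := cosine_series_time_trace id T_gt0 al_continuous al_le A_cvg (t0 := t).
have yE t v dv c := cosine_series_dtE (nu := id) 1 (delta := 1) u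
  h_L2 dS_le dS_cvg ka_cvg (t := t) (v := v) (dv := dv) (c := c).
exists (cosine_series id al), (cosine_series id al T); split; last first.
  by apply: yt; rewrite lexx ltW.
split.
  have -> : (fun=> 0) = cosine_series id al 0; last by apply: yt; rewrite lexx ltW.
  apply/funext => x; apply/esym/cvg_lim => //.
  rewrite (_ : series _ = fun=> 0); first exact: cvg_cst.
  apply/funext => N; rewrite /series /= big1// => n _.
  by rewrite /al /I set_itvoo0 Rintegral_set0 mulr0 mul0r.
exists dy, (cosine_series_dt id al 1 ka u); split => //.
apply: aeW => t; rewrite in_itv /= => tT v dv c vH1 vc.
rewrite (yE _ _ _ _ tT vH1 vc) mul1r mulN1r addrAC addNr add0r.
by [].
Qed.

End StateExistence.

(** * Fourier coefficients of states *)

Section StateCoefficients.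
Context {R : realType}.
Notation mu := (@lebesgue_measure R).

Lemma test_function_mul_expR (a b c : R) phi : test_function a b phi ->
  test_function a b (fun t => phi t * expR (c * t)).
Proof.
move=> [sphi [K [cK Kab K0]]]; split.
  apply: ntimes_diff_derivable => n; apply: ntimes_diffM.
    exact: derive1n_ntimes_diff.
  exact: ntimes_diff_expR.
by exists K; split => // x /K0 ->; rewrite mul0r.
Qed.

(** The pairing with [f] of the representative that is continuous in time is itself continuous on
    [[0, T]] and agrees with [W] almost everywhere, hence everywhere, end points included. *)
Lemma time_trace_coef (T t0 : R) (y : R -> R -> R) (z W f : R -> R) :
  0 < T -> 0 <= t0 <= T -> time_trace T y t0 z -> continuous f ->
  (forall x, `|f x| <= 1) ->
  {ae mu, forall t, t \in `]0, T[ -> measurable_fun (`]0, 1[%classic : set R) (y t)} ->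
  {within `[0, T], continuous W} ->
  {ae mu, forall t, t \in `]0, T[ -> \int[mu]_(x in `]0, 1[) (y t x * f x) = W t} ->
  \int[mu]_(x in `]0, 1[) (z x * f x) = W t0.
Proof.
move=> T0 t0T [z2 [Y [Y2 Yc Yy Yz]]] cf f1 my cW yW.
have mf : measurable_fun (`]0, 1[%classic : set R) f.
  by apply: measurable_funTS; exact: continuous_measurable_fun.
pose V t := \int[mu]_(x in `]0, 1[) (Y t x * f x).
have Yf2 t : t \in `[0, T] -> in_L2 mu `]0, 1[ (fun x => Y t x * f x).
  move=> tT; have [mY _] := Y2 t tT.
  apply: (@in_L2_le _ _ _ mu _ _ (fun x => `|Y t x|)) => //.
  - exact: measurable_funM.
  - split; first exact: measurableT_comp.
    have [_] := Y2 t tT; congr (_ < _)%E.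
    by apply: eq_integral => x _; rewrite real_normK ?num_real.
  - by move=> x _; rewrite normrM ler_piMr.
have cV : {within `[0, T], continuous V}.
  apply/subspace_continuousP => t tT.
  have c1 := Yc t tT.
  apply/cvgrPdist_lt => e e0.
  have e2 : 0 < e ^+ 2 by rewrite exprn_gt0.
  move/cvgrPdist_lt : c1 => /(_ _ e2).
  rewrite !near_withinE; apply: filterS => s H sT; have {}H := H sT.
  have Ys : in_L2 mu `]0, 1[ (fun x => Y s x * f x - Y t x * f x).
    have H1 := Yf2 s sT; have H2 := Yf2 t tT.
    by have := in_L2_B _ H1 H2; apply.
  have dY : in_L2 mu `]0, 1[ (Y s \- Y t) by apply: in_L2_B => //; exact: Y2.
  have VE : V s - V t = \int[mu]_(x in `]0, 1[) (Y s x * f x - Y t x * f x).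
    by rewrite RintegralB//; apply: in_L2_integrable01; exact: Yf2.
  rewrite distrC -(ltr_pXn2r (n := 2)) ?nnegrE// ?(ltW e0)//.
  rewrite real_normK ?num_real// VE.
  apply: le_lt_trans (sqr_Rintegral01 Ys) _.
  move: H; rewrite sub0r normrN ger0_norm; last first.
    by apply: Rintegral_ge0 => x _; exact: sqr_ge0.
  apply: le_lt_trans; apply: le_Rintegral => //.
  - exact: in_L2_integrable_sqr.
  - exact: (in_L2_integrable_sqr _ dY).
  - move=> x _; rewrite /= -mulrBl exprMn ler_piMr ?sqr_ge0//.
    by rewrite -real_normK ?num_real// expr_le1.
have VW : {ae mu, forall t, t \in `]0, T[ -> V t = W t}.
  have VyW : {ae mu, forall t, t \in `]0, T[ ->
      V t = \int[mu]_(x in `]0, 1[) (y t x * f x)}.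
    apply: ae_imply2 my Yy _ => t myt Yyt tT.
    have tT' : t \in `[0, T] by apply: subset_itv_oo_cc.
    apply: ae_eq_Rintegral => //.
    - by apply: measurable_funM => //; case: (Y2 t tT').
    - by apply: measurable_funM => //; exact: myt.
    - by apply: ae_imply (Yyt tT) _ => x H x01; rewrite H.
  by apply: ae_imply2 VyW yW _ => t H1 H2 tT; rewrite H1// H2.
have -> : \int[mu]_(x in `]0, 1[) (z x * f x) = V t0.
  have t0T' : t0 \in `[0, T] by rewrite in_itv.
  apply: ae_eq_Rintegral => //.
  - by apply: measurable_funM => //; case: z2.
  - by apply: measurable_funM => //; case: (Y2 t0 t0T').
  - by apply: ae_imply Yz _ => x H x01; rewrite H.
exact: ae_eq_continuous VW _ t0T.
Qed.

Lemma rect_coef_integrable (T : R) (y : R -> R -> R) (f : R -> R) :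
  in_L2 (mu \x mu)%E (`]0, T[ `*` `]0, 1[) (fun z => y z.1 z.2) ->
  continuous f -> (forall x, `|f x| <= 1) ->
  mu.-integrable `]0, T[
    (EFin \o (fun t => \int[mu]_(x in `]0, 1[) (y t x * f x))).
Proof.
move=> y2 cf f1; have mD := measurable_rect T.
set D : set (measurableTypeR R * measurableTypeR R) :=
  `]0, T[%classic `*` `]0, 1[%classic in mD.
have f2 : in_L2 mu `]0, 1[ f by exact: in_L2_continuous.
have yf : (mu \x mu)%E.-integrable D (EFin \o (fun z => y z.1 z.2 * f z.2)).
  exact: in_L2_mul y2 (in_L2_snd T f2).
pose F := (EFin \o (fun z => y z.1 z.2 * f z.2)) \_ D.
have iF : (mu \x mu)%E.-integrable setT F by rewrite -integrable_mkcond.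
have FE t : t \in `]0, T[ ->
    fubini_F mu F t = (\int[mu]_(x in `]0%R, 1%R[) (y t x * f x)%:E)%E.
  move=> tT; rewrite /fubini_F [RHS]integral_mkcond; apply: eq_integral => x _.
  by rewrite /F !patchE in_setX mem_setE tT.
have iG : mu.-integrable `]0, T[ (fubini_F mu F).
  by apply: integrableS (integrable_fubini_F iF).
have [mG fG] := integrableP _ _ _ iG.
apply: le_integrable iG => //.
- apply/measurable_EFinP.
  apply: (eq_measurable_fun (fine \o fubini_F mu F)).
    by move=> t; rewrite inE /= => tT; rewrite /= FE.
  exact: measurableT_comp mG.
(* Where the inner integral is infinite, [fine] gives 0 and the bound still holds. *)
- move=> t tT; rewrite FE// /= /Rintegral.
  by case: (integral _ _ _) => [r| |] //=; rewrite normr0 leey.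
Qed.

(* Multiplying by [exp (lam t)] turns the weak equation of the [n]-th cosine
   coefficient into an integrable right-hand side that no longer contains it. *)
Lemma state_coefficient (T : R) (y : R -> R -> R) (u z : R -> R) (n : nat) :
  0 < T -> state_equation T y u -> time_trace T y T z -> in_L2 mu `]0, T[ u ->
  let lam := (n%:R * pi) ^+ 2 in
  \int[mu]_(x in `]0, 1[) (z x * cos (n%:R * pi * x)) =
  \int[mu]_(s in `]0, T[) (u s * ((-1) ^+ n * expR (- lam * (T - s)))).
Proof.
move=> T0 [y0 [dy [g [[[y2 dy2 yH1] [gH1 gm g2] gw] yeq]]]] yT u2 lam.
pose w : R := n%:R * pi; pose f x := cos (w * x).
have cf : continuous f by exact: continuous_cos_mul.
have f1 x : `|f x| <= 1 by rewrite ler_norml cos_geN1 cos_le1.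
pose eta t := \int[mu]_(x in `]0, 1[) (y t x * f x).
have eta_i : mu.-integrable `]0, T[ (EFin \o eta) by exact: rect_coef_integrable.
have ui : mu.-integrable `]0, T[ (EFin \o u).
  by apply: in_L2_integrable => //; exact: itvoo_lty.
have fH1 := cos_in_H1 w.
have trf : space_trace f 1 ((-1) ^+ n).
  have := space_trace_continuous 1 cf.
  by rewrite /f mulr1 /w cos_natpi.
(* The weak equation tested with the [n]-th cosine: an ordinary differential equation for the
   coefficient [eta]. *)
have geta : {ae mu, forall t, t \in `]0, T[ -> g t f = u t * (-1) ^+ n - lam * eta t}.
  apply: ae_imply2 yH1 yeq _ => t H1 H2 tT; have ytH1 := H1 tT.
  have [_ dyt2 _] := ytH1; have dyti := in_L2_integrable01 dyt2.
  have := H2 tT _ _ _ fH1 trf => <-.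
  have -> : \int[mu]_(x in `]0, 1[) (dy t x * - (w * sin (w * x))) =
      - w * \int[mu]_(x in `]0, 1[) (dy t x * sin (w * x)).
    rewrite -RintegralZl//; first by apply: eq_Rintegral => x _; ring.
    by apply: integrable_mul_continuous => //; exact: continuous_sin_mul.
  by rewrite (H1_sin_coef n ytH1) -/w -/(eta t) /lam -/w; ring.
have fi (k a : R -> R) : continuous k -> mu.-integrable `]0, T[ (EFin \o a) ->
    mu.-integrable `]0, T[ (EFin \o (fun t => k t * a t)).
  move=> ck ai; apply: eq_integrable (integrable_mul_continuous ai ck) => //.
  by move=> t _ /=; rewrite mulrC.
have weak phi : test_function 0 T phi ->
    \int[mu]_(t in `]0, T[) (derive1 phi t * eta t) =
    - \int[mu]_(t in `]0, T[) (phi t * (u t * (-1) ^+ n - lam * eta t)).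
  move=> tphi; have cphi := is_derive_continuous (test_function_is_derive tphi).
  have mphi : measurable_fun `]0, T[ phi.
    by apply: measurable_funTS; exact: continuous_measurable_fun.
  rewrite (gw phi f _ tphi fH1); congr (- _); apply: ae_eq_Rintegral => //.
  - by apply: measurable_funM => //; exact: gm fH1.
  - apply: measurable_funM => //; apply/measurable_EFinP; apply: (measurable_int mu).
    apply: integrable_fB => //; last exact: integrable_fZ.
    apply: eq_integrable (integrable_fZ ((-1) ^+ n) _ ui) => //.
    by move=> t _ /=; rewrite mulrC.
  - by apply: ae_imply geta _ => t H tT; rewrite H.
pose E t : R := expR (lam * t).
have dE (t : R) : is_derive t (1 : R) E (lam * E t).
  have dl : is_derive t (1 : R) (fun t => lam * t) lam.
    by apply: (is_derive_eq (derZ lam (is_derive_id t 1))); rewrite mulr1.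
  by apply: (is_derive_eq (der_comp (is_derive_expR _) dl)); rewrite mulrC.
have cE : continuous E by exact: is_derive_continuous dE.
pose r t := (-1) ^+ n * (E t * u t).
have ri : mu.-integrable `]0, T[ (EFin \o r).
  by apply: integrable_fZ => //; exact: fi.
(* The weak equation is tested with [phi * E]; the terms in [lam] cancel, so the weak derivative of
   [E * eta] is [r]. *)
have [C etaC] : exists C, {ae mu, forall t, t \in `]0, T[ ->
    E t * eta t = C + \int[mu]_(s in `]0, t[) r s}.
  apply: du_Bois_Reymond => // [|phi tphi]; first exact: fi.
  have tpsi := test_function_mul_expR lam tphi.
  have dphi := test_function_is_derive tphi.
  have [h1 [dh1 [h2 [dh2 _]]]] := derive1n_ntimes_diff (proj1 tphi) 2.
  have Eh : derive1 phi = h1 by exact: derive1_is_derive.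
  have ch1 : continuous (derive1 phi) by rewrite Eh; exact: is_derive_continuous dh2.
  have cphi := is_derive_continuous dphi.
  have := weak _ tpsi.
  rewrite (derive1_is_derive (fun t : R => derM (dphi t) (dE t))).
  have cpE : continuous (fun t => phi t * E t).
    by move=> t; apply: cvgM; [exact: cphi|exact: cE].
  have cdE : continuous (fun t => derive1 phi t * E t).
    by move=> t; apply: cvgM; [exact: ch1|exact: cE].
  have -> : \int[mu]_(t in `]0, T[) ((derive1 phi t * E t + phi t * (lam * E t)) * eta t) =
    \int[mu]_(t in `]0, T[) ((derive1 phi t * E t) * eta t + lam * ((phi t * E t) * eta t)).
    by apply: eq_Rintegral => t _; ring.
  have -> : \int[mu]_(t in `]0, T[) (phi t * expR (lam * t) * (u t * (-1) ^+ n - lam * eta t)) =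
    \int[mu]_(t in `]0, T[) (phi t * r t - lam * ((phi t * E t) * eta t)).
    by apply: eq_Rintegral => t _; rewrite /r /E; ring.
  have i1 := fi _ _ cdE eta_i; have i2 := fi _ _ cpE eta_i.
  have i3 := fi _ _ cphi ri.
  rewrite RintegralD//; last exact: integrable_fZ.
  rewrite RintegralB//; last exact: integrable_fZ.
  rewrite RintegralZl// opprB => H.
  transitivity (\int[mu]_(t in `]0, T[) ((derive1 phi t * E t) * eta t)).
    by apply: eq_Rintegral => t _; ring.
  transitivity (- \int[mu]_(t in `]0, T[) (phi t * r t)); last first.
    by congr (- _); apply: eq_Rintegral => t _; rewrite mulrC.
  by apply: (addIr (lam * \int[mu]_(t in `]0, T[) (phi t * E t * eta t))); rewrite H addrC.
pose W t := expR (- lam * t) * (C + \int[mu]_(s in `]0, t[) r s).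
have cW : {within `[0, T], continuous W}.
  apply: within_continuousM.
    apply: continuous_subspaceT => t; apply: continuous_cvg.
      exact: continuous_expR.
    by apply: cvgMr; exact: cvg_id.
  have cC : {within `[0, T], continuous (fun _ : R => C)}.
    by apply: continuous_subspaceT => x; exact: cvg_cst.
  by apply: within_continuousD => //; apply: primitive_continuous => //; exact: ltW.
have etaW : {ae mu, forall t, t \in `]0, T[ -> eta t = W t}.
  apply: ae_imply etaC _ => t H tT.
  by rewrite /W -H// mulrA -expRD mulNr addNr expR0 mul1r.
have my : {ae mu, forall t, t \in `]0, T[ -> measurable_fun (`]0, 1[%classic : set R) (y t)}.
  by apply: ae_imply yH1 _ => t H /H [[]].
(* The constant of integration is the coefficient of the initial trace, which is zero. *)
have C0 : C = 0.
  have t0 : 0 <= (0 : R) <= T by rewrite lexx ltW.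
  have := time_trace_coef T0 t0 y0 cf f1 my cW etaW.
  under eq_Rintegral do rewrite mul0r.
  by rewrite Rintegral_zero /W mulr0 expR0 mul1r set_itvoo0 Rintegral_set0 addr0.
have tT : 0 <= T <= T by rewrite lexx ltW.
rewrite (time_trace_coef T0 tT yT cf f1 my cW etaW) /W C0 add0r -RintegralZl//.
apply: eq_Rintegral => s _; rewrite /r /E.
have -> : expR (- lam * (T - s)) = expR (- lam * T) * expR (lam * s).
  by rewrite -expRD; congr expR; ring.
by ring.
Qed.

End StateCoefficients.

(** * A lacunary Dirichlet series *)

Section Lacunary.
Context {R : realType}.
Notation mu := (@lebesgue_measure R).

(** Index 0 is reserved for the constant mode. All frequencies are even, so that
    [cos (freq j * pi) = 1]. *)
Definition freq j : nat := if j is k.+1 then 16 ^ k.+1 else 0.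

(* The constant term makes the coefficients sum up to zero. *)
Definition lcoef j : R := if j is k.+1 then (- 64^-1) ^+ k.+1 else 65^-1.

Definition rate j : R := ((freq j)%:R * pi) ^+ 2.

Definition lacunary (s : R) := limn (series (fun j => lcoef j * expR (- rate j * s))).

Lemma rate_ge0 j : 0 <= rate j. Proof. exact: sqr_ge0. Qed.

Lemma lcoef_le j : `|lcoef j| <= 64^-1 ^+ j.
Proof.
case: j => [|j]; first by rewrite expr0 /lcoef ger0_norm// invf_le1// ler1n.
by rewrite /lcoef normrX normrN ger0_norm.
Qed.

Let norm64 : `|64^-1 : R| < 1.
Proof. by rewrite ger0_norm// invf_lt1// ltr1n. Qed.

Lemma cvg_geo64 : cvgn (series (fun j => (64^-1 : R) ^+ j)).
Proof.
have : cvgn (series (geometric (1 : R) 64^-1)).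
  exact: is_cvg_geometric_series.
by congr (cvgn (series _)); apply/funext => j; rewrite /geometric /= mul1r.
Qed.

Lemma lim_geo64 : limn (series (fun j => (64^-1 : R) ^+ j)) = 64 / 63.
Proof.
apply/cvg_lim => //.
have : series (geometric (1 : R) 64^-1) n @[n --> \oo] --> (1 * (1 - 64^-1)^-1 : R).
  exact: cvg_geometric_series.
rewrite (_ : geometric _ _ = (fun j => (64^-1 : R) ^+ j)); last first.
  by apply/funext => j; rewrite /geometric /= mul1r.
by rewrite (_ : 1 * _ = 64 / 63 :> R)//; field.
Qed.

Lemma decay_term_le s j : 0 <= s -> `|lcoef j * expR (- rate j * s)| <= 64^-1 ^+ j.
Proof.
move=> s0; rewrite normrM -[leRHS]mulr1; apply: ler_pM => //; first exact: lcoef_le.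
rewrite ger0_norm ?expR_ge0// -expR0 ler_expR mulNr oppr_le0.
by rewrite mulr_ge0// rate_ge0.
Qed.

Lemma series_lcoef N : series lcoef N.+1 = (- 64^-1) ^+ N / 65.
Proof.
elim: N => [|N IH]; first by rewrite /series /= big_nat1 expr0 mul1r.
rewrite /series /= big_nat_recr //=; move: IH; rewrite /series /= => ->.
by rewrite exprS; field.
Qed.

Lemma lim_lcoef : limn (series lcoef) = 0.
Proof.
apply/cvg_lim => //; rewrite -cvg_shiftS /=.
under eq_fun do rewrite series_lcoef.
have : (- 64^-1 : R) ^+ N / 65 @[N --> \oo] --> (0 / 65 : R).
  by apply: cvgMl; apply: cvg_expr; rewrite normrN.
by rewrite mul0r.
Qed.

(** The inverse of [rate k.+1]: at this time the mode [k + 1] has decayed exactly by the factor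
    [expR (-1)]. *)
Definition osc k : R := (pi ^+ 2 * 256 ^+ k.+1)^-1.

Lemma osc_gt0 k : 0 < osc k.
Proof. by rewrite invr_gt0 mulr_gt0 ?exprn_gt0// pi_gt0. Qed.

Let rate_osc k j : rate j.+1 * osc k = 256 ^+ j.+1 / 256 ^+ k.+1.
Proof.
rewrite /rate /osc /freq natrX exprMn -exprM mulnC exprM.
have -> : (16%:R : R) ^+ 2 = 256 by ring.
have pn : (pi : R) != 0 by rewrite gt_eqF// pi_gt0.
have b0 : (256 : R) ^+ k.+1 != 0 by rewrite expf_neq0.
move: (pi : R) pn => p pn; move: (256 ^+ j.+1) (256 ^+ k.+1) b0 => a b b0.
by field; rewrite ?b0 ?pn.
Qed.

Let expR1_half : expR (- 1) <= 2^-1 :> R.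
Proof.
rewrite expRN lef_pV2 ?posrE ?expR_gt0//.
by have := expR_ge1Dx (1 : R); lra.
Qed.

Let sum_pow4 K : \sum_(0 <= j < K) (4 : R) ^+ j <= 4 ^+ K / 3.
Proof.
elim: K => [|K IH]; first by rewrite big_geq// expr0; lra.
by rewrite big_nat_recr//= exprS; lra.
Qed.

(* At time [osc k] the modes below [k + 1] have not decayed, the modes above
   have a smaller weight, and the mode [k + 1] decides about the sign. *)
Lemma lacunary_sign k : 0 < (-1) ^+ k * lacunary (osc k).
Proof.
have o0 := ltW (osc_gt0 k).
(* Subtracting the vanishing sum of the coefficients makes the contribution of the slow modes small,
   of order [rate j * osc k]. *)
pose a j := lcoef j * (expR (- rate j * osc k) - 1).
have ca : cvgn (series (fun j => lcoef j * expR (- rate j * osc k))).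
  by apply: (series_dominated _ cvg_geo64) => j; exact: decay_term_le.
have cc : cvgn (series lcoef) by apply: (series_dominated _ cvg_geo64); exact: lcoef_le.
have fE : lacunary (osc k) = limn (series a).
  have -> : a = (fun j => lcoef j * expR (- rate j * osc k)) - lcoef.
    by apply/funext => j; rewrite /a mulrBr mulr1.
  by rewrite lim_seriesB// lim_lcoef subr0.
have e01 j : 0 <= 1 - expR (- rate j * osc k) <= 1.
  rewrite subr_ge0 gerBl expR_ge0 andbT -expR0 ler_expR mulNr oppr_le0.
  by rewrite mulr_ge0// rate_ge0.
have a_le j : `|a j| <= 64^-1 ^+ j.
  rewrite normrM -[leRHS]mulr1; apply: ler_pM => //; first exact: lcoef_le.
  by have /andP[h0 h1] := e01 j; rewrite distrC ger0_norm.
have tail := series_tail_le k.+2 a_le cvg_geo64.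
(* From [1 - expR (- x) <= x] the terms are at most [4^j / 256^(k+1)], a geometric sum; the constant
   mode contributes nothing. *)
have head : `|series a k.+1| <= 64^-1 ^+ k.+1 / 3.
  apply: le_trans (ler_norm_sum _ _ _) _.
  have hle j : `|a j| <= 4 ^+ j / 256 ^+ k.+1.
    case: j => [|j].
      rewrite /a /rate /freq mul0r expr0n oppr0 mul0r expR0 subrr mulr0 normr0.
      by rewrite divr_ge0// exprn_ge0.
    rewrite normrM; apply: (@le_trans _ _ (64^-1 ^+ j.+1 * (rate j.+1 * osc k))).
      apply: ler_pM => //; first exact: lcoef_le.
      have /andP[h0 h1] := e01 j.+1; rewrite distrC ger0_norm// lerBlDr -lerBlDl.
      by have := expR_ge1Dx (- rate j.+1 * osc k); lra.
    rewrite rate_osc mulrA ler_pM2r ?invr_gt0 ?exprn_gt0//.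
    by rewrite -exprMn (_ : 64^-1 * 256 = 4 :> R)//; field.
  apply: (@le_trans _ _ (\sum_(0 <= j < k.+1) (4 ^+ j / 256 ^+ k.+1))).
    by apply: ler_sum => j _.
  rewrite -mulr_suml; apply: (@le_trans _ _ (4 ^+ k.+1 / 3 / 256 ^+ k.+1)).
    by rewrite ler_pM2r ?invr_gt0 ?exprn_gt0//; exact: sum_pow4.
  by rewrite mulrAC -expr_div_n (_ : 4 / 256 = 64^-1 :> R)//; field.
have main : 64^-1 ^+ k.+1 / 2 <= (-1) ^+ k * a k.+1.
  rewrite /a /lcoef -[- 64^-1]mulN1r exprMn mulNr rate_osc divff; last first.
    by rewrite expf_neq0.
  have -> : (-1) ^+ k * ((-1) ^+ k.+1 * 64^-1 ^+ k.+1 * (expR (- 1) - 1)) =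
     ((-1) ^+ k * (-1) ^+ k) * 64^-1 ^+ k.+1 * (1 - expR (- 1)) :> R.
    by rewrite [(-1) ^+ k.+1]exprS; ring.
  rewrite -expr2 sqrr_sign mul1r ler_pM2l ?exprn_gt0 ?invr_gt0//.
  by have := expR1_half; lra.
have geo : limn (series (fun j => (64^-1 : R) ^+ j)) -
    series (fun j => (64^-1 : R) ^+ j) k.+2 <= 64^-1 ^+ k.+1 / 63.
  have gE N : series (fun j => (64^-1 : R) ^+ j) N = 64 / 63 * (1 - 64^-1 ^+ N).
    elim: N => [|N IH]; first by rewrite series0 expr0 subrr mulr0.
    rewrite /series /= big_nat_recr//=; move: IH; rewrite /series /= => ->.
    by rewrite exprS; field.
  rewrite lim_geo64 gE [_ ^+ k.+2]exprS le_eqVlt; apply/orP; left; apply/eqP; by field.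
have sE : series a k.+2 = series a k.+1 + a k.+1 by rewrite /series /= big_nat_recr.
have th0 : 0 < (64^-1 : R) ^+ k.+1 by rewrite exprn_gt0 ?invr_gt0.
have sgnle (x y : R) : `|x| <= y -> - y <= (-1) ^+ k * x.
  move=> xy; have := ler_norm (- ((-1) ^+ k * x)).
  by rewrite normrN normrM normr_sign mul1r; lra.
rewrite fE.
(* In units of [64^-(k+1)] the deciding mode has at least 1/2, against 1/3 from the slower and 1/63
   from the faster modes. *)
have := sgnle _ _ (le_trans tail geo); have := sgnle _ _ head.
rewrite sE !mulrBr mulrDr; lra.
Qed.

End Lacunary.

(** * The adjoint state *)

Section Adjoint.
Context {R : realType}.
Notation mu := (@lebesgue_measure R).
Variable T : R.
Hypothesis T_gt0 : 0 < T.

Definition adjoint_mode j (t : R) : R := lcoef j * expR (- rate j * (T - t)).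

Definition adjoint_state : R -> R -> R := cosine_series freq adjoint_mode.

Let adjoint_mode_derive j (t : R) :
  is_derive t (1 : R) (adjoint_mode j) (rate j * adjoint_mode j t).
Proof.
have dl : is_derive t (1 : R) (fun t => - rate j * (T - t)) (rate j).
  have -> : (fun t => - rate j * (T - t)) = (fun t => rate j * t + - rate j * T).
    by apply/funext => y; ring.
  exact: der_affine.
apply: (is_derive_eq (derZ (lcoef j) (der_comp (is_derive_expR _) dl))).
by rewrite /adjoint_mode; ring.
Qed.

Let al_c j : continuous (adjoint_mode j).
Proof. exact: is_derive_continuous (adjoint_mode_derive j). Qed.

Let al_continuous j : {within `[0, T], continuous (adjoint_mode j)}.
Proof. exact: continuous_subspaceT. Qed.

Let al_le j (t : R) : 0 <= t <= T -> `|adjoint_mode j t| <= 64^-1 ^+ j.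
Proof. by move=> /andP[_ tT]; apply: decay_term_le; rewrite subr_ge0. Qed.

Let B j : R := pi * 4^-1 ^+ j.

Let B_cvg : cvgn (series B).
Proof.
have -> : B = geometric pi 4^-1 by [].
by apply: is_cvg_geometric_series; rewrite ger0_norm// invf_lt1// ltr1n.
Qed.

Let dmode_le j (t x : R) : 0 <= t <= T ->
  `|adjoint_mode j t * - ((freq j)%:R * pi * sin ((freq j)%:R * pi * x))| <= B j.
Proof.
move=> /(al_le j); move: (adjoint_mode j t) => a aj.
rewrite normrM normrN !normrM (ger0_norm (pi_ge0 R)) normr_nat.
apply: (@le_trans _ _ (64^-1 ^+ j * (16 ^+ j * pi * 1))).
  apply: ler_pM aj _; rewrite ?mulr_ge0 ?pi_ge0//.
  apply: ler_pM; rewrite ?mulr_ge0 ?pi_ge0//; last exact: sin_max.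
  rewrite ler_pM2r ?pi_gt0// /freq; case: j => [|j]; first by rewrite expr0.
  by rewrite natrX.
rewrite mulr1 mulrA -exprMn (_ : 64^-1 * 16 = 4^-1 :> R); last by field.
by rewrite mulrC.
Qed.

Let dp (t x : R) := limn (series (fun j =>
  adjoint_mode j t * - ((freq j)%:R * pi * sin ((freq j)%:R * pi * x)))).

Let dS_le N (t x : R) : 0 < t < T -> 0 < x < 1 ->
  `|series (fun j => adjoint_mode j t * - ((freq j)%:R * pi * sin ((freq j)%:R * pi * x))) N|
  <= limn (series B).
Proof.
move=> /andP[t0 tT] _; apply: series_norm_le B_cvg _ => j; apply: dmode_le.
by rewrite !ltW.
Qed.

Let dS_cvg (t x : R) : 0 < t < T -> 0 < x < 1 ->
  series (fun j => adjoint_mode j t * - ((freq j)%:R * pi * sin ((freq j)%:R * pi * x))) N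
    @[N --> \oo] --> dp t x.
Proof.
move=> /andP[t0 tT] _; apply: (series_dominated _ B_cvg) => j; apply: dmode_le.
by rewrite !ltW.
Qed.

Let al_weak j phi : test_function 0 T phi ->
  \int[mu]_(t in `]0, T[) (derive1 phi t * adjoint_mode j t) =
  - \int[mu]_(t in `]0, T[)
      (phi t * (- (-1) * ((freq j)%:R * pi) ^+ 2 * adjoint_mode j t + 0 * 0)).
Proof.
move=> tphi; have dphi := test_function_is_derive tphi.
have [f1 [df1 [f2 [df2 _]]]] := derive1n_ntimes_diff (proj1 tphi) 2.
have E : derive1 phi = f1 by exact: derive1_is_derive.
have cf1 : continuous (derive1 phi) by rewrite E; exact: is_derive_continuous df2.
have cphi := is_derive_continuous dphi.
have c1 : continuous (fun t => derive1 phi t * adjoint_mode j t).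
  by move=> t; apply: cvgM; [exact: cf1|exact: al_c].
have c2 : continuous (fun t => phi t * (rate j * adjoint_mode j t)).
  by move=> t; apply: cvgM; [exact: cphi|apply: cvgMr; exact: al_c].
have c3 : continuous (fun t => derive1 phi t * adjoint_mode j t +
    phi t * (rate j * adjoint_mode j t)).
  by move=> t; apply: cvgD; [exact: c1|exact: c2].
have := FTC2oo (ltW T_gt0) (fun t => derM (dphi t) (adjoint_mode_derive j t)) c3.
rewrite RintegralD//; try exact: continuous_integrable_oo.
rewrite !(test_function_out tphi) ?ltxx ?andbF// !mul0r subrr => /eqP.
rewrite addr_eq0 => /eqP ->; congr (- _); apply: eq_Rintegral => t _.
by rewrite /rate; ring.
Qed.

Let ka_cvg (v dv : R -> R) (c : R) : in_H1 v dv -> space_trace v 1 c ->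
  series (fun j => 0 * \int[mu]_(x in `]0, 1[) (v x * cos ((freq j)%:R * pi * x))) N
    @[N --> \oo] --> 0 * c.
Proof.
move=> _ _; rewrite mul0r (_ : series _ = fun=> 0); first exact: cvg_cst.
by apply/funext => N; rewrite /series /= big1// => j _; rewrite mul0r.
Qed.

Let h_L2 : in_L2 mu `]0, 1[ (fun=> limn (series B)).
Proof. by apply: in_L2_cst => //; exact: itvoo_lty. Qed.

Let u0_le (t : R) : 0 < t < T -> `|(0 : R)| <= 1.
Proof. by rewrite normr0. Qed.

Let m0 : measurable_fun `]0, T[ (fun _ : R => 0 : R).
Proof. exact: measurable_cst. Qed.

Lemma adjoint_state_equation : adjoint_equation T adjoint_state (adjoint_state T).
Proof.
split.
  apply: (cosine_series_time_trace freq T_gt0 al_continuous al_le cvg_geo64).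
  by rewrite lexx ltW.
exists dp, (cosine_series_dt freq adjoint_mode (-1) (fun=> 0) (fun=> 0)); split.
  exact: (cosine_series_in_W (nu := freq) (eps := -1) (delta := 0) (ka := fun=> 0)
    (u := fun=> 0) al_continuous al_le cvg_geo64 h_L2 dS_le dS_cvg al_weak m0 u0_le ka_cvg).
apply: aeW => t; rewrite in_itv /= => tT v dv vH1.
have [c vc] := H1_trace_exists vH1.
rewrite (cosine_series_dtE (nu := freq) (-1) (delta := 0) (ka := fun=> 0) (fun=> 0)
  h_L2 dS_le dS_cvg ka_cvg tT vH1 vc).
by rewrite !mul0r addr0 opprK mul1r addNr.
Qed.

Lemma adjoint_state_continuous t : 0 <= t <= T -> continuous (adjoint_state t).
Proof. by move=> tT; exact: (@cosine_series_continuous _ T freq adjoint_mode _ al_le cvg_geo64 t tT). Qed.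

Let cos_freq j : cos ((freq j)%:R * pi * 1) = 1 :> R.
Proof.
rewrite mulr1 cos_natpi -signr_odd /freq; case: j => [//|j].
by rewrite oddX.
Qed.

Lemma adjoint_state1 t : adjoint_state t 1 = lacunary (T - t).
Proof.
rewrite /adjoint_state /cosine_series /lacunary; congr (limn (series _)).
by apply/funext => j; rewrite cos_freq mulr1.
Qed.

Lemma adjoint_state_trace t : 0 < t < T ->
  space_trace (adjoint_state t) 1 (lacunary (T - t)).
Proof.
move=> /andP[t0 tT]; rewrite -adjoint_state1; apply: space_trace_continuous.
by apply: adjoint_state_continuous; rewrite !ltW.
Qed.

Let mode_cst j : adjoint_mode j T = lcoef j.
Proof. by rewrite /adjoint_mode subrr mulr0 expR0 mulr1. Qed.

Let final_pairing_series z N : in_L2 mu `]0, 1[ z ->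
  \int[mu]_(x in `]0, 1[) (z x * series (fun j => adjoint_mode j T *
     cos ((freq j)%:R * pi * x)) N) =
  series (fun j => lcoef j * \int[mu]_(x in `]0, 1[) (z x * cos ((freq j)%:R * pi * x))) N.
Proof.
move=> z2; have zi := in_L2_integrable01 z2.
have ci j : mu.-integrable `]0, 1[ (EFin \o (fun x => z x * cos ((freq j)%:R * pi * x))).
  by apply: integrable_mul_continuous => //; exact: continuous_cos_mul.
rewrite /series /=.
transitivity (\int[mu]_(x in `]0, 1[)
    (\sum_(0 <= j < N) lcoef j * (z x * cos ((freq j)%:R * pi * x)))).
  apply: eq_Rintegral => x _; rewrite mulr_sumr; apply: eq_bigr => j _.
  by rewrite mode_cst; ring.
rewrite Rintegral_sum//; last by move=> j; exact: integrable_fZ.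
by apply: eq_bigr => j _; rewrite RintegralZl.
Qed.

Lemma adjoint_pairing_cvg z : in_L2 mu `]0, 1[ z ->
  series (fun j => lcoef j * \int[mu]_(x in `]0, 1[) (z x * cos ((freq j)%:R * pi * x))) N
    @[N --> \oo] --> \int[mu]_(x in `]0, 1[) (z x * adjoint_state T x).
Proof.
move=> z2; have zi := in_L2_integrable01 z2; have [mz _] := z2.
have TT : 0 <= T <= T by rewrite lexx ltW.
under eq_fun do rewrite -(final_pairing_series _ z2).
have tl j x : `|adjoint_mode j T * cos ((freq j)%:R * pi * x)| <= 64^-1 ^+ j.
  rewrite normrM -[leRHS]mulr1; apply: ler_pM => //; first exact: al_le.
  by rewrite ler_norml cos_geN1 cos_le1.
have cS N : continuous (fun x => series (fun j => adjoint_mode j T *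
     cos ((freq j)%:R * pi * x)) N).
  elim: N => [|N IH].
    by move=> x; under eq_fun do rewrite series0; exact: cvg_cst.
  have -> : (fun x => series (fun j => adjoint_mode j T * cos ((freq j)%:R * pi * x)) N.+1) =
    (fun x => series (fun j => adjoint_mode j T * cos ((freq j)%:R * pi * x)) N +
       adjoint_mode N T * cos ((freq N)%:R * pi * x)).
    by apply/funext => x; rewrite /series /= big_nat_recr.
  move=> x; apply: cvgD; first exact: IH.
  by apply: cvgMr; exact: continuous_cos_mul.
apply: (@dominated_Rintegral _ _ R mu `]0, 1[ (fun N x => z x * series (fun j =>
    adjoint_mode j T * cos ((freq j)%:R * pi * x)) N)
  (fun x => z x * adjoint_state T x) (fun x => 64 / 63 * `|z x|) _ _ _ _ _).2 => //.
- move=> N; apply: measurable_funM => //; apply: measurable_funTS.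
  exact: continuous_measurable_fun.
- by move=> x _; apply: cvgMr; exact: (cosine_series_cvg al_le cvg_geo64 TT).
- by apply: integrable_fZ => //; exact: integrable_norm.
- move=> N x _; rewrite normrM mulrC ler_wpM2r// -lim_geo64.
  by apply: series_norm_le cvg_geo64 _ => j; exact: tl.
Qed.

Let decay_continuous j : continuous (fun s => expR (- rate j * (T - s))).
Proof.
move=> s; apply: continuous_cvg; first exact: continuous_expR.
by apply: cvgMr; apply: cvgB; [exact: cvg_cst|exact: cvg_id].
Qed.

Let mode_continuous_series N : continuous (fun t => series (adjoint_mode ^~ t) N).
Proof.
elim: N => [|N IH].
  by move=> x; under eq_fun do rewrite series0; exact: cvg_cst.
have -> : (fun t => series (adjoint_mode ^~ t) N.+1) =
    (fun t => series (adjoint_mode ^~ t) N + adjoint_mode N t).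
  by apply/funext => x; rewrite /series /= big_nat_recr.
by move=> x; apply: cvgD; [exact: IH|exact: al_c].
Qed.

Lemma lacunary_cvg t : 0 <= t <= T ->
  series (adjoint_mode ^~ t) N @[N --> \oo] --> lacunary (T - t).
Proof.
move=> tT; rewrite /lacunary; apply: (series_dominated _ cvg_geo64) => j.
exact: al_le.
Qed.

Lemma lacunary_le t : 0 <= t <= T -> `|lacunary (T - t)| <= 64 / 63.
Proof.
by move=> tT; rewrite -lim_geo64; apply: lim_series_norm_le cvg_geo64 => j; exact: al_le.
Qed.

Lemma measurable_lacunary :
  measurable_fun (`]0, T[%classic : set R) (fun t => lacunary (T - t)).
Proof.
apply: measurable_realfun.measurable_fun_cvg (fun N t => series (adjoint_mode ^~ t) N) _ _ _.
  by move=> N; apply: measurable_funTS; apply: continuous_measurable_fun.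
by move=> t /=; rewrite in_itv /= => /andP[/ltW t0 /ltW tT]; apply: lacunary_cvg; rewrite t0.
Qed.

(** The adjoint identity, obtained mode by mode: [state_coefficient] turns each cosine coefficient
    of [z] into an integral of [u] against a decaying exponential, the sign [(-1) ^+ n] being 1 for
    even frequencies. Summed with the weights [lcoef], the exponentials form [lacunary (T - t)]. *)
Lemma final_state_pairing y u z : state_equation T y u -> time_trace T y T z ->
  in_L2 mu `]0, T[ u ->
  \int[mu]_(x in `]0, 1[) (z x * adjoint_state T x) =
  \int[mu]_(t in `]0, T[) (u t * lacunary (T - t)).
Proof.
move=> yu yz u2; have z2 : in_L2 mu `]0, 1[ z by case: yz.
have ui : mu.-integrable `]0, T[ (EFin \o u).
  by apply: in_L2_integrable => //; exact: itvoo_lty.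
have mu_ : measurable_fun (`]0, T[%classic : set R) u by case: u2.
have c1 := adjoint_pairing_cvg z2.
have ji j : mu.-integrable `]0, T[ (EFin \o (fun s => u s * expR (- rate j * (T - s)))).
  by apply: integrable_mul_continuous => //; exact: decay_continuous.
have E N : series (fun j => lcoef j * \int[mu]_(x in `]0, 1[) (z x * cos ((freq j)%:R * pi * x))) N
  = \int[mu]_(t in `]0, T[) (u t * series (adjoint_mode ^~ t) N).
  transitivity (\int[mu]_(t in `]0, T[)
      (\sum_(0 <= j < N) lcoef j * (u t * expR (- rate j * (T - t))))); last first.
    apply: eq_Rintegral => t _; rewrite /series /= mulr_sumr.
    by apply: eq_bigr => j _; rewrite /adjoint_mode; ring.
  rewrite Rintegral_sum//; last by move=> j; exact: integrable_fZ.
  rewrite /series /=; apply: eq_bigr => j _; rewrite RintegralZl//.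
  rewrite (state_coefficient (freq j) T_gt0 yu yz u2); congr (_ * _).
  apply: eq_Rintegral => s _.
  by have := cos_freq j; rewrite mulr1 cos_natpi => ->; rewrite mul1r.
have c2 : series (fun j => lcoef j * \int[mu]_(x in `]0, 1[) (z x * cos ((freq j)%:R * pi * x))) N
    @[N --> \oo] --> \int[mu]_(t in `]0, T[) (u t * lacunary (T - t)).
  under eq_fun do rewrite E.
  apply: (@dominated_Rintegral _ _ R mu `]0, T[ (fun N t => u t * series (adjoint_mode ^~ t) N)
    (fun t => u t * lacunary (T - t)) (fun t => 64 / 63 * `|u t|) _ _ _ _ _).2 => //.
  - move=> N; apply: measurable_funM => //; apply: measurable_funTS.
    exact: continuous_measurable_fun.
  - move=> t /=; rewrite in_itv /= => /andP[/ltW t0 /ltW tT]; apply: cvgMr.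
    by apply: lacunary_cvg; rewrite t0.
  - by apply: integrable_fZ => //; exact: integrable_norm.
  - move=> N t /=; rewrite in_itv /= => /andP[/ltW t0 /ltW tT].
    rewrite normrM mulrC ler_wpM2r// -lim_geo64.
    by apply: series_norm_le cvg_geo64 _ => j; apply: al_le; rewrite t0.
exact: (cvg_unique _ c1 c2).
Qed.

(* The mean of the final adjoint state is its constant mode [65^-1]. *)
Lemma final_adjoint_norm_gt0 :
  0 < \int[mu]_(x in `]0, 1[) (adjoint_state T x ^+ 2).
Proof.
have TT : 0 <= T <= T by rewrite lexx ltW.
have p2 : in_L2 mu `]0, 1[ (adjoint_state T).
  by apply: in_L2_continuous; exact: adjoint_state_continuous.
have one2 : in_L2 mu `]0, 1[ (fun=> 1).
  by apply: in_L2_cst => //; exact: itvoo_lty.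
apply: lt_le_trans (sqr_Rintegral01 p2).
have := adjoint_pairing_cvg one2.
under [X in _ --> X]eq_Rintegral do rewrite mul1r.
move=> c1; rewrite exprn_even_gt0//=.
suff -> : \int[mu]_(x in `]0, 1[) adjoint_state T x = 65^-1 by rewrite invr_neq0.
apply: (cvg_unique _ c1) => //.
suff sE N : series (fun j => lcoef j *
    \int[mu]_(x in `]0, 1[) (1 * cos ((freq j)%:R * pi * x))) N.+1 = 65^-1.
  have : (series (fun j => lcoef j *
    \int[mu]_(x in `]0, 1[) (1 * cos ((freq j)%:R * pi * x))) : R^nat) @ \oo --> (65^-1 : R).
    by rewrite -cvg_shiftS /=; under eq_fun do rewrite sE; exact: cvg_cst.
  exact.
rewrite /series /= big_nat_recl//= big1 ?addr0.
  under eq_Rintegral do rewrite /freq mul0r mul0r cos0 mulr1.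
  by rewrite Rintegral_cst01 mulr1.
move=> j _.
have n0 : (freq j.+1)%:R * pi != 0 :> R.
  rewrite mulf_neq0//; last by rewrite gt_eqF// pi_gt0.
  by rewrite pnatr_eq0 /freq -lt0n expn_gt0.
suff -> : \int[mu]_(x in `]0, 1[) (1 * cos ((freq j.+1)%:R * pi * x)) = 0 by rewrite mulr0.
apply: (mulfI n0); rewrite -RintegralZl//; last first.
  apply: integrable_mul_continuous; last exact: continuous_cos_mul.
  exact: in_L2_integrable01.
under eq_Rintegral do rewrite mul1r.
rewrite (FTC2oo ler01 (der_sin _)); last first.
  by move=> x; apply: cvgMr; exact: continuous_cos_mul.
by rewrite mulr1 sin_natpi mulr0 sin0 subrr.
Qed.

End Adjoint.

(** * Power series and zeros *)

Section PowerSeries.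
Context {R : realType}.
Implicit Types (a : R^nat) (f : R -> R).

Lemma pseries_shift a m h N : (forall i, (i < m)%N -> a i = 0) ->
  pseries a h (N + m)%N = h ^+ m * pseries (fun n => a (n + m)%N) h N.
Proof.
move=> a0; rewrite /pseries /series /= (@big_cat_nat _ _ _ m)//= ?leq_addl//.
rewrite big_nat big1 ?add0r; last by move=> i /andP[_ im]; rewrite a0// mul0r.
rewrite -{1}[m]add0n big_addn addnK mulr_sumr; apply: eq_bigr => i _.
by rewrite exprD; ring.
Qed.

(** With [m] the least index of a nonzero coefficient, [h ^+ m] factors out and the quotient is a
    power series continuous at 0 with value [a m]. *)
Lemma pseries_leading_term a (r : R) f : 0 < r ->
  (forall h, `|h| < r -> pseries a h N @[N --> \oo] --> f h) ->
  (forall h, `|h| < r -> f h = 0) \/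
  exists m, exists2 c, c != 0 & f h / h ^+ m @[h --> (0 : R)^'] --> c.
Proof.
move=> r0 af.
have [a0|/existsNP a0] := pselect (forall n, a n = 0).
  left=> h hr; apply: (cvg_unique _ (af h hr)) => //.
  rewrite (_ : pseries a h = fun=> 0); first exact: cvg_cst.
  by apply/funext => N; rewrite /pseries /series /= big1// => i _; rewrite a0 mul0r.
have {}a0 : exists n, a n != 0 by case: a0 => n /eqP; exists n.
right; exists (ex_minn a0); case: ex_minnP => m am min_m; exists (a m) => //.
have a_small i : (i < m)%N -> a i = 0.
  move=> im; apply/eqP; apply: contraTT im => /min_m; by rewrite -leqNgt.
pose b n := a (n + m)%N.
have b_cvg h : h != 0 -> `|h| < r -> pseries b h N @[N --> \oo] --> f h / h ^+ m.
  move=> h0 hr; have hm : h ^+ m != 0 by rewrite expf_neq0.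
  rewrite (_ : pseries b h = fun N => pseries a h (N + m)%N / h ^+ m); last first.
    by apply/funext => N; rewrite pseries_shift// mulrC mulKf.
  by apply: cvgMl; have := af h hr; rewrite -(cvg_shiftn m).
(* Convergence at [r / 2] gives absolute convergence at [r / 4], the majorant for the limit in
   [h]. *)
have cb : cvgn (pseries (fun n => `|b n|) (r / 4)).
  apply: (@is_cvg_pseries_inside_norm _ b (r / 2)).
    by apply: cvgP (b_cvg _ _ _); rewrite ?gt_eqF ?divr_gt0// ger0_norm ?divr_ge0 ?ltW//; lra.
  by rewrite !ger0_norm ?divr_ge0 ?(ltW r0)//; lra.
have lim0 : limn (series (fun n => b n * 0 ^+ n)) = a m.
  apply/cvg_lim => //.
  have sE N : series (fun n => b n * 0 ^+ n) N.+1 = a m.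
    rewrite /series /= big_nat_recl//= big1 ?addr0 ?expr0 ?mulr1 /b ?add0n//.
    by move=> i _; rewrite expr0n mulr0.
  have : (series (fun n => b n * 0 ^+ n) : R^nat) @ \oo --> a m.
    by rewrite -cvg_shiftS /=; under eq_fun do rewrite sE; exact: cvg_cst.
  exact.
rewrite -lim0.
have near_r : \forall h \near (0 : R)^', `|h| < r / 4.
  by apply: dnbhs0_lt; rewrite divr_gt0.
apply: (@cvg_trans _ (limn (series (fun n => b n * h ^+ n)) @[h --> (0 : R)^'])).
  apply: near_eq_cvg; near=> h; apply/cvg_lim => //; apply: b_cvg.
    by near: h; exact: nbhs_dnbhs_neq.
  have : `|h| < r / 4 by near: h.
  by move/lt_trans; apply; lra.
apply: (series_dominated_cvg cb).
- near=> h => n; rewrite normrM normrX ler_wpM2l// lerXn2r// ?nnegrE ?divr_ge0 ?(ltW r0)//.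
  by apply: ltW; near: h.
- move=> n; rewrite normrM normrX normr0 ler_wpM2l// lerXn2r// ?nnegrE ?divr_ge0 ?(ltW r0)//.
- by move=> n; apply: cvgMr; apply/continuous_withinNx; exact: exprn_continuous.
Unshelve. all: by end_near. Qed.

End PowerSeries.

(** * Analyticity and isolated zeros of the lacunary series *)

Section LacunaryAnalytic.
Context {R : realType}.
Notation mu := (@lebesgue_measure R).

(** The coefficients of [lacunary (s - h)] in powers of [h]; with [s = T - t0] and [h = t - t0] this
    is the expansion in time, without alternating signs. *)
Definition taylor_coef (s : R) n : R :=
  limn (series (fun j => lcoef j * expR (- rate j * s) * (rate j ^+ n / n`!%:R))).

Lemma exp_term_le (x : R) N : 0 <= x -> series (exp_coeff x) N <= expR x.
Proof.
by move=> x0; apply: series_le_lim (is_cvg_series_exp_coeff x) => n; exact: exp_coeff_ge0.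
Qed.

Let taylor_term_le (s : R) n j : 0 < s ->
  `|lcoef j * expR (- rate j * s) * (rate j ^+ n / n`!%:R)| <= s ^- n * 64^-1 ^+ j.
Proof.
move=> s0; have r0 : 0 <= rate j :> R by exact: rate_ge0.
have rs0 : 0 <= rate j * s by rewrite mulr_ge0// ltW.
have h1 : (rate j * s) ^+ n / n`!%:R <= expR (rate j * s).
  apply: le_trans (exp_term_le n.+1 rs0).
  rewrite /series /= big_nat_recr//= lerDr; apply: sumr_ge0 => i _; exact: exp_coeff_ge0.
have sn : 0 < s ^+ n by rewrite exprn_gt0.
rewrite -mulrA normrM mulrC; apply: ler_pM => //; last exact: lcoef_le.
rewrite ger0_norm; last by apply: mulr_ge0; [exact: expR_ge0|apply: divr_ge0 => //; exact: exprn_ge0].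
rewrite mulNr expRN ler_pdivrMl ?expR_gt0// ler_pdivlMr//.
by move: h1; rewrite exprMn mulrAC.
Qed.

Let taylor_cvg (s : R) n : 0 < s ->
  cvgn (series (fun j => lcoef j * expR (- rate j * s) * (rate j ^+ n / n`!%:R))).
Proof.
move=> s0; apply: (series_dominated (fun j => taylor_term_le n j s0)).
by apply: is_cvg_seriesZ; exact: cvg_geo64.
Qed.

(** Exchanges the finite sum over powers with the sum over modes, so that only the limit in [N]
    remains, under a sum over modes. *)
Let taylor_partial (s h : R) N : 0 < s ->
  series (fun j => lcoef j * expR (- rate j * s) * series (exp_coeff (rate j * h)) N) M
    @[M --> \oo] --> pseries (taylor_coef s) h N.
Proof.
move=> s0; elim: N => [|N IH].
  rewrite /pseries series0 (_ : series _ = fun=> 0); first exact: cvg_cst.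
  by apply/funext => M; rewrite /series /= big1// => j _; rewrite big_geq// mulr0.
have c := @taylor_cvg s N s0.
have c1 : series (fun j => lcoef j * expR (- rate j * s) * (rate j ^+ N / N`!%:R)) M * h ^+ N
    @[M --> \oo] --> taylor_coef s N * h ^+ N by apply: cvgMl.
have -> : pseries (taylor_coef s) h N.+1 = pseries (taylor_coef s) h N + taylor_coef s N * h ^+ N.
  by rewrite /pseries /series /= big_nat_recr.
rewrite (_ : series _ = fun M =>
    series (fun j => lcoef j * expR (- rate j * s) * series (exp_coeff (rate j * h)) N) M +
    series (fun j => lcoef j * expR (- rate j * s) * (rate j ^+ N / N`!%:R)) M * h ^+ N).
  exact: cvgD.
apply/funext => M.
rewrite /series /= mulr_suml -big_split/=; apply: eq_bigr => j _.
by rewrite big_nat_recr//= /exp_coeff /= exprMn; ring.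
Qed.

(** Although the rates are unbounded, every partial exponential sum is at most
    [expR (rate j * |h|)], which the decay [expR (- rate j * s)] compensates. The disc of
    convergence therefore reaches the accumulation point [s - h = 0] of the oscillations. *)
Lemma lacunary_power_series (s h : R) : `|h| < s ->
  pseries (taylor_coef s) h N @[N --> \oo] --> lacunary (s - h).
Proof.
move=> hs; have s0 : 0 < s by apply: le_lt_trans hs.
have -> : pseries (taylor_coef s) h = fun N => limn (series (fun j =>
    lcoef j * expR (- rate j * s) * series (exp_coeff (rate j * h)) N)).
  by apply/funext => N; apply/esym/cvg_lim => //; exact: taylor_partial.
rewrite /lacunary.
have -> : (fun j => lcoef j * expR (- rate j * (s - h))) =
    (fun j => lcoef j * expR (- rate j * s) * expR (rate j * h)) :> R^nat.
  by apply/funext => j; rewrite -mulrA -expRD; congr (_ * expR _); ring.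
have key j (x : R) : `|x| <= expR (rate j * `|h|) ->
    `|lcoef j * expR (- rate j * s) * x| <= 64^-1 ^+ j.
  move=> xe; rewrite -mulrA normrM -[leRHS]mulr1; apply: ler_pM => //.
    exact: lcoef_le.
  rewrite normrM ger0_norm ?expR_ge0//.
  apply: le_trans (ler_wpM2l _ xe) _; first exact: expR_ge0.
  rewrite -expRD -expR0 ler_expR mulNr addrC subr_le0 ler_wpM2l ?rate_ge0//.
  exact: ltW.
have rh j : 0 <= rate j * `|h| by rewrite mulr_ge0 ?rate_ge0.
apply: (series_dominated_cvg cvg_geo64).
- apply: nearW => N j; apply: key.
  apply: le_trans (ler_norm_sum _ _ _) _; apply: le_trans (exp_term_le N (rh j)).
  apply: ler_sum => i _.
  rewrite /exp_coeff /= normrM normrX normrM (ger0_norm (rate_ge0 j)).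
  by rewrite normfV normr_nat.
- move=> j; apply: key; rewrite ger0_norm ?expR_ge0// ler_expR ler_wpM2l ?rate_ge0//.
  exact: ler_norm.
- by move=> j; apply: cvgMr; exact: is_cvg_series_exp_coeff.
Qed.

Lemma lacunary_continuous (s : R) : 0 < s -> {for s, continuous lacunary}.
Proof.
move=> s0; apply: (series_dominated_cvg cvg_geo64).
- near=> x => j; apply: decay_term_le; near: x.
  by apply: filterS (lt_nbhsr s0) => x /ltW.
- by move=> j; apply: decay_term_le; exact: ltW.
- move=> j; apply: cvgMr; apply: continuous_cvg; first exact: continuous_expR.
  by apply: cvgMr; exact: cvg_id.
Unshelve. all: by end_near. Qed.

Lemma osc_cvg0 : @osc R k @[k --> \oo] --> 0.
Proof.
have -> : @osc R = fun k => (pi ^+ 2 * 256)^-1 * 256^-1 ^+ k.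
  apply/funext => k; rewrite /osc [256 ^+ _]exprS mulrA invfM exprVn//.
rewrite -[X in _ --> X](mulr0 ((pi ^+ 2 * 256)^-1 : R)); apply: cvgMr.
by apply: cvg_expr; rewrite ger0_norm// invf_lt1// ltr1n.
Qed.

Lemma osc_lt (k : nat) : @osc R k.+1 < osc k.
Proof.
have p0 : 0 < pi ^+ 2 :> R by rewrite exprn_gt0// pi_gt0.
rewrite /osc ltf_pV2; last 2 first.
- by rewrite posrE mulr_gt0// exprn_gt0.
- by rewrite posrE mulr_gt0// exprn_gt0.
by rewrite ltr_pM2l// ltr_eXn2l ?ltr1n.
Qed.

Lemma lacunary_osc_neq0 k : lacunary (osc k : R) != 0.
Proof.
by apply: contraTneq (@lacunary_sign R k) => ->; rewrite mulr0 ltxx.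
Qed.

(* A Taylor expansion with vanishing coefficients is excluded by the
   oscillation at the end of the convergence interval. *)
Lemma lacunary_isolated_zeros (s : R) : 0 < s -> exists2 d, 0 < d &
  (forall h, 0 < `|h| < d -> lacunary (s - h) != 0) /\
  ((forall h, 0 < h < d -> 0 < lacunary (s - h)) \/
   (forall h, 0 < h < d -> lacunary (s - h) < 0)).
Proof.
move=> s0.
have [z|[m [c c0 lc]]] := pseries_leading_term s0 (@lacunary_power_series s).
  have [k ks] : exists k, osc k < s.
    have /cvgr0_norm_lt/(_ _ s0)[k _ /(_ k (leqnn k))] := osc_cvg0.
    by exists k; apply: le_lt_trans (ler_norm _) _.
  have : `|s - osc k| < s by rewrite ger0_norm ?subr_ge0 ?ltW// gtrBl osc_gt0.
  by move=> /z; rewrite subKr => /eqP; rewrite (negbTE (lacunary_osc_neq0 k)).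
(* Multiplying by [c] makes the limit positive whatever the sign of [c]. Positivity nearby gives
   both the absence of zeros and, for [h > 0], a constant sign. *)
have : c * (lacunary (s - h) / h ^+ m) @[h --> (0 : R)^'] --> c * c by exact: cvgMr.
move/(cvgr_gt (c * c)) => /(_ 0); rewrite -expr2 exprn_even_gt0//= => /(_ c0).
rewrite near_withinE => /nbhs_ballP[d /= d0 dP]; exists d => //.
have {}dP h : 0 < `|h| < d -> 0 < c * (lacunary (s - h) / h ^+ m).
  move=> /andP[h0 hd]; apply: dP; last by rewrite -normr_gt0.
  by rewrite /ball /= sub0r normrN.
split.
  move=> h /dP; apply: contraTneq => ->; by rewrite mul0r mulr0 ltxx.
have pos h : 0 < h < d -> 0 < c * lacunary (s - h).
  move=> /andP[h0 hd]; have := dP h; rewrite gtr0_norm// h0 hd => /(_ isT).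
  by rewrite mulrA pmulr_lgt0 // invr_gt0 exprn_gt0.
have [cp|cn] := ltP 0 c; [left|right] => h /pos.
  by rewrite pmulr_rgt0.
by rewrite nmulr_rgt0// lt_neqAle c0.
Qed.

End LacunaryAnalytic.

(** * Switching *)

Section Switching.
Context {R : realType}.
Notation mu := (@lebesgue_measure R).
Variable T : R.
Hypothesis T_gt0 : 0 < T.
Notation q := (fun t : R => lacunary (T - t)).

Lemma lacunary_analytic : analytic_on_0T T q.
Proof.
move=> t0; rewrite in_itv /= => /andP[_ tT].
have r0 : 0 < T - t0 by rewrite subr_gt0.
exists (taylor_coef (T - t0)), (T - t0); split=> // t _ /lacunary_power_series.
by rewrite (_ : T - t0 - (t - t0) = T - t) //; ring.
Qed.

Lemma lacunary_alternates : exists s : R^nat,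
  [/\ forall n, 0 < s n < T, forall n, s n < s n.+1 &
      forall n, 0 < (-1) ^+ n * q (s n)].
Proof.
have /cvgr0_norm_lt/(_ _ T_gt0)[k _ kT] := @osc_cvg0 R.
(* The shift brings the points into []0, T[]; it is even in order to preserve the signs. *)
exists (fun n => T - osc (k.*2 + n)%N); split=> n.
- rewrite subr_gt0 gtrBl osc_gt0 andbT.
  apply: le_lt_trans (ler_norm _) (kT _ _) => /=.
  by rewrite -addnn -addnA leq_addr.
- by rewrite addnS ltrD2l ltrN2; exact: osc_lt.
- have := @lacunary_sign R (k.*2 + n)%N.
  by rewrite /= subKr exprD -signr_odd odd_double mul1r.
Qed.

Lemma lacunary_sign_changes : infinitely_many_sign_changes T q.
Proof.
have [s [sT s_lt sgn]] := lacunary_alternates; exists s; split=> [n|//|k|k].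
- by rewrite in_itv /=; case/andP: (sT n) => /ltW -> ->.
- by have := sgn k.*2; rewrite -signr_odd odd_double mul1r.
- by have := sgn k.*2.+1; rewrite -signr_odd /= odd_double mulN1r oppr_gt0.
Qed.

Let isolated t : t < T -> exists2 d, 0 < d &
  (forall h, 0 < `|h| < d -> q (t + h) != 0) /\
  ((forall h, 0 < h < d -> 0 < q (t + h)) \/ (forall h, 0 < h < d -> q (t + h) < 0)).
Proof.
rewrite -subr_gt0 => /lacunary_isolated_zeros[d d0 H]; exists d => //.
have E h : T - t - h = T - (t + h) by ring.
case: H => H1 H2; split=> [h|]; first by rewrite -E; exact: H1.
by case: H2 => H2; [left|right] => h; rewrite -E; exact: H2.
Qed.

Let q_continuous t : t < T -> {for t, continuous q}.
Proof.
move=> tT; apply: (@continuous_comp _ _ _ (fun t => T - t) lacunary).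
  by apply: cvgB; [exact: cvg_cst|exact: cvg_id].
by apply: lacunary_continuous; rewrite subr_gt0.
Qed.

(** The zeros are countable: each is assigned a rational number to its right, inside its own
    zero-free neighbourhood, and two distinct zeros cannot share one. *)
Lemma lacunary_neq0_ae : {ae mu, forall t, t \in `]0, T[ -> q t != 0}.
Proof.
pose Z := [set t | t < T /\ q t = 0].
suff cZ : countable Z.
  exists Z; split.
  - by apply: countable_measurable => //; exact: measurable_set1.
  - exact: countable_lebesgue_measure0.
  - move=> t /= /not_implyP[]; rewrite in_itv /= => /andP[_ tT].
    by move=> /negP; rewrite negbK => /eqP.
have rP t : Z t -> exists r : rat, exists2 d, t < ratr r < t + d &
    forall h, 0 < `|h| < d -> q (t + h) != 0.
  move=> [tT _]; have [d d0 [H _]] := isolated tT.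
  have [|r] := @rat_in_itvoo R t (t + d); first by rewrite ltrDl.
  by rewrite in_itv /= => rt; exists r, d.
pose f t : rat := if pselect (Z t) is left Zt then projT1 (cid (rP t Zt)) else 0.
apply/countable_injP; exists (pickle \o f) => x y /set_mem Zx /set_mem Zy.
move=> /= /(pcan_inj pickleK).
have fP t : Z t -> exists2 d, t < ratr (f t) < t + d &
    forall h, 0 < `|h| < d -> q (t + h) != 0.
  by move=> Zt; rewrite /f; case: pselect => // Zt'; case: cid.
have lt_absurd u v : Z u -> Z v -> u < v -> f u = f v -> False.
  move=> Zu Zv uv fuv; have [d /andP[_ h1] H] := fP u Zu.
  have [d' /andP[h2 _] _] := fP v Zv.
  suff /H : 0 < `|v - u| < d by rewrite subrKC; case: Zv => _ ->; rewrite eqxx.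
  rewrite gtr0_norm ?subr_gt0// uv ltrBlDl.
  by rewrite fuv in h1; apply: lt_trans h2 h1.
move=> fxy; case: (ltgtP x y) => // xy.
  by case: (lt_absurd x y).
by case: (lt_absurd y x).
Qed.

(* The right limit of [- sgn q] at [t], also where [q] vanishes. *)
Definition right_sign (t : R) : R :=
  if `[< exists2 d, 0 < d & forall h, 0 < h < d -> 0 < q (t + h) >] then -1 else 1.

Let right_sign_pos t d : 0 < d -> (forall h, 0 < h < d -> 0 < q (t + h)) ->
  right_sign t = -1.
Proof. by move=> d0 H; rewrite /right_sign asboolT//; exists d. Qed.

Let right_sign_neg t d : 0 < d -> (forall h, 0 < h < d -> q (t + h) < 0) ->
  right_sign t = 1.
Proof.
move=> d0 H; rewrite /right_sign asboolF// => -[e e0 He].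
have m0 : 0 < Num.min e d by rewrite lt_min e0 d0.
have h0 : 0 < Num.min e d / 2 by rewrite divr_gt0.
have hm : Num.min e d / 2 < Num.min e d by move: m0; lra.
have := H (Num.min e d / 2); rewrite h0 (lt_le_trans hm) ?ge_min ?lexx ?orbT// => /(_ isT).
apply/negP; rewrite -leNgt ltW// He// h0 (lt_le_trans hm)// ge_min lexx//.
Qed.

(** On a small interval to the right of [t] the sign of [q] is constant, and every point of that
    interval sees the same sign on its right. *)
Let right_signP t : t < T ->
  exists2 d, 0 < d & forall s, t <= s < t + d -> right_sign s = right_sign t.
Proof.
move=> tT; have [d d0 [_ H]] := isolated tT; exists d => // s /andP[ts sd].
have sub h : 0 < h < t + d - s -> 0 < s - t + h < d.
  by move=> /andP[h0 hd]; apply/andP; split; lra.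
have E h : t + (s - t + h) = s + h by ring.
have ds : 0 < t + d - s by rewrite subr_gt0.
case: H => H.
  rewrite (right_sign_pos d0 H); apply: (right_sign_pos ds) => h /sub/H.
  by rewrite E.
rewrite (right_sign_neg d0 H); apply: (right_sign_neg ds) => h /sub/H.
by rewrite E.
Qed.

Lemma right_sign_right_continuous t : t < T ->
  right_sign s @[s --> t^'+] --> right_sign t.
Proof.
move=> /right_signP[d d0 H]; apply: cvg_near_cst.
near=> s; apply: H; apply/andP; split.
  by near: s; exact: nbhs_right_ge.
by near: s; apply: nbhs_right_lt; rewrite ltrDl.
Unshelve. all: by end_near. Qed.

(** If [q t] had the opposite sign, continuity would extend it to points slightly to the right of
    [t]. *)
Lemma right_signE t : t < T -> q t != 0 -> right_sign t = - Num.sg (q t).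
Proof.
move=> tT q0; have [d d0 [_ H]] := isolated tT.
case: H => H; [rewrite (right_sign_pos d0 H)|rewrite (right_sign_neg d0 H)].
  suff : 0 <= q t by rewrite le_eqVlt eq_sym (negbTE q0)/= => /gtr0_sg ->.
  rewrite leNgt; apply/negP => qt.
  have : \forall s \near t, q s < 0 by apply: cvgr_lt (q_continuous tT) _ qt.
  move=> /nbhs_ballP[e /= e0 He].
  have m0 : 0 < Num.min e d by rewrite lt_min e0 d0.
  have h0 : 0 < Num.min e d / 2 by rewrite divr_gt0.
  have hm : Num.min e d / 2 < Num.min e d by move: m0; lra.
  have := H (Num.min e d / 2).
  rewrite h0 (lt_le_trans hm) ?ge_min ?lexx ?orbT// => /(_ isT).
  apply/negP; rewrite -leNgt ltW//; apply: He.
  by rewrite /ball /= opprD addNKr normrN gtr0_norm// (lt_le_trans hm)// ge_min lexx.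
suff : q t <= 0 by rewrite le_eqVlt (negbTE q0)/= => /ltr0_sg ->; rewrite opprK.
rewrite leNgt; apply/negP => qt.
have : \forall s \near t, 0 < q s by apply: cvgr_gt (q_continuous tT) _ qt.
move=> /nbhs_ballP[e /= e0 He].
have m0 : 0 < Num.min e d by rewrite lt_min e0 d0.
have h0 : 0 < Num.min e d / 2 by rewrite divr_gt0.
have hm : Num.min e d / 2 < Num.min e d by move: m0; lra.
have := H (Num.min e d / 2).
rewrite h0 (lt_le_trans hm) ?ge_min ?lexx ?orbT// => /(_ isT).
apply/negP; rewrite -leNgt ltW//; apply: He.
by rewrite /ball /= opprD addNKr normrN gtr0_norm// (lt_le_trans hm)// ge_min lexx.
Qed.

Lemma right_sign_values t : right_sign t = -1 \/ right_sign t = 1.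
Proof. by rewrite /right_sign; case: ifP; [left|right]. Qed.

(** Without a switch [right_sign] would be continuous on the interval, and the intermediate value
    theorem would give it the value 0. *)
Let switch_between (s : R^nat) n : (forall n, 0 < s n < T) -> s n < s n.+1 ->
  (forall n, 0 < (-1) ^+ n * q (s n)) ->
  exists2 t, s n <= t <= s n.+1 & switching_points T right_sign t.
Proof.
move=> sT sn sgn; apply: contrapT => noswitch.
have cw t : s n <= t <= s n.+1 -> right_sign x @[x --> t] --> right_sign t.
  move=> tI; apply: contrapT => tN; apply: noswitch; exists t => //; split => //.
  have /andP[s0 _] := sT n; have /andP[_ s1] := sT n.+1; case/andP: tI => t0 t1.
  by rewrite (lt_le_trans s0)// (le_lt_trans t1).
have wE k : right_sign (s k) = - (-1) ^+ k.
  have /andP[_ kT] := sT k; have k0 := sgn k.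
  have q0 : q (s k) != 0 by apply: contraTneq k0 => ->; rewrite mulr0 ltxx.
  rewrite right_signE//; congr (- _).
  move: k0; rewrite -signr_odd; case: (odd k); rewrite ?mulN1r ?mul1r ?oppr_gt0.
    by move/ltr0_sg ->; rewrite expr1.
  by move/gtr0_sg ->.
have [c _ c0] : exists2 c, c \in `[s n, s n.+1] & right_sign c = 0.
  apply: IVT; first exact: ltW.
    apply: continuous_in_subspaceT => t; rewrite inE /= in_itv /=; exact: cw.
  rewrite !wE exprS mulN1r opprK -signr_odd.
  case: (odd n); rewrite ?expr1 ?expr0 ?opprK le_max ge_min; apply/andP; split; lra.
by case: (right_sign_values c) => /eqP; rewrite c0 eq_sym ?oppr_eq0 oner_eq0.
Qed.

Lemma right_sign_infinite_switching : infinite_set (switching_points T right_sign).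
Proof.
have [s [sT s_lt sgn]] := lacunary_alternates.
(* Only every second interval is used: these are disjoint, which makes the chosen points strictly
   increasing. *)
have tP k : exists t, s k.*2 <= t <= s k.*2.+1 /\ switching_points T right_sign t.
  by have [t tI tS] := @switch_between s k.*2 sT (s_lt _) sgn; exists t.
have [t {}tP] := choice tP.
apply/infiniteP/pcard_leP/injfunPex; exists t; first by move=> k _; case: (tP k).
have s_mono : {homo s : m n / (m < n)%N >-> m < n} by apply: homo_ltn => //; exact: lt_trans.
have t_lt m n : (m < n)%N -> t m < t n.
  move=> mn; have [/andP[_ h1] _] := tP m; have [/andP[h2 _] _] := tP n.
  apply: le_lt_trans h1 (lt_le_trans _ h2); apply: s_mono.
  by rewrite ltn_Sdouble.
move=> m n _ _ tmn; case: (ltngtP m n) => // /t_lt; by rewrite tmn ltxx.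
Qed.

End Switching.

(** * Optimality *)

Section Optimality.
Context {R : realType}.
Notation mu := (@lebesgue_measure R).
Variable T : R.
Hypothesis T_gt0 : 0 < T.
Notation q := (fun t : R => lacunary (T - t)).

(** Setting the value to 1 at the zeros of [q] keeps the absolute value equal to 1 everywhere; it
    agrees with [right_sign] almost everywhere. *)
Definition bang_bang (t : R) : R := if 0 < q t then -1 else 1.

Lemma bang_bangM t : bang_bang t * q t = - `|q t|.
Proof.
by rewrite /bang_bang; case: ltP => [/gtr0_norm ->|/ler0_norm ->]; rewrite ?mulN1r ?mul1r ?opprK.
Qed.

Lemma bang_bang_norm t : `|bang_bang t| = 1.
Proof. by rewrite /bang_bang; case: ifP; rewrite ?normrN normr1. Qed.

Lemma measurable_bang_bang : measurable_fun (`]0, T[%classic : set R) bang_bang.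
Proof.
have mq := @measurable_lacunary R T.
apply: measurable_fun_if => //.
by apply: measurable_realfun.measurable_fun_ltr.
Qed.

Lemma bang_bang_admissible : admissible_control T bang_bang.
Proof.
split.
  apply: (@in_L2_bounded _ _ _ _ _ _ 1) => //; first exact: itvoo_lty.
    exact: measurable_bang_bang.
  by move=> t _; rewrite bang_bang_norm.
by apply: aeW => t _; rewrite -ler_norml bang_bang_norm.
Qed.

Variables (ybar : R -> R -> R) (zbar : R -> R).
Hypothesis ybar_state : state_equation T ybar bang_bang.
Hypothesis ybar_final : time_trace T ybar T zbar.

Let yd := zbar \- adjoint_state T T.

(** By [bang_bangM] the integrand is the absolute value of [(u - bang_bang) * q]. The outer absolute
    value makes the gain nonnegative for every [u]; for admissible [u] it changes nothing almost
    everywhere. *)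
Definition gain (u : R -> R) : R := \int[mu]_(t in `]0, T[) `|u t * q t + `|q t| |.

Let q_mul_integrable u : in_L2 mu `]0, T[ u ->
  mu.-integrable `]0, T[ (EFin \o (fun t => u t * q t)).
Proof.
move=> u2; apply: (@integrable_mul_bounded _ _ _ _ _ _ _ (64 / 63)) => //.
- by apply: in_L2_integrable => //; exact: itvoo_lty.
- exact: measurable_lacunary.
- move=> t /=; rewrite in_itv /= => /andP[t0 tT]; apply: lacunary_le.
  by rewrite !ltW.
Qed.

Let gain_integrable u : in_L2 mu `]0, T[ u ->
  mu.-integrable `]0, T[ (EFin \o (fun t => u t * q t + `|q t|)).
Proof.
move=> u2.
have mq := @measurable_lacunary R T.
apply: integrable_fD => //; first exact: q_mul_integrable.
have : mu.-integrable `]0, T[ (EFin \o (fun t : R => 1 * q t)).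
  by apply: q_mul_integrable; apply: in_L2_cst => //; exact: itvoo_lty.
move=> /integrable_norm; apply: eq_integrable => // t _ /=.
by rewrite mul1r.
Qed.

Let gain_ae u : admissible_control T u ->
  {ae mu, forall t, t \in `]0, T[ -> `|u t * q t + `|q t| | = u t * q t + `|q t|}.
Proof.
move=> [_ u1]; apply: (ae_imply u1) => t /= H /H {}u1; apply: ger0_norm.
have h1 : `|u t * q t| <= `|q t| by rewrite normrM ler_piMl// ler_norml.
have := ler_norm (- (u t * q t)); rewrite normrN => h2.
by rewrite -[X in X + _]opprK addrC subr_ge0 (le_trans h2).
Qed.

(** Expand the square of [z - yd = (z - zbar) + p(T)]: the cross term pairs the difference of two
    final states with [p(T)], and [final_state_pairing] turns it into the gain. *)
Lemma objective_gain y u z : feasible T y u z ->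
  objective yd z = objective yd zbar +
    1 / 2 * \int[mu]_(x in `]0, 1[) ((z x - zbar x) ^+ 2) + gain u.
Proof.
move=> [yu ua yz]; have [u2 _] := ua; have z2 : in_L2 mu `]0, 1[ z by case: yz.
have zbar2 : in_L2 mu `]0, 1[ zbar by case: ybar_final.
have [b2 _] := bang_bang_admissible.
have p2 : in_L2 mu `]0, 1[ (adjoint_state T T).
  by apply: in_L2_continuous; apply: adjoint_state_continuous; rewrite lexx ltW.
have m01 : measurable (`]0, 1[%classic : set R) by exact: measurable_itv.
have d2 : in_L2 mu `]0, 1[ (z \- zbar) by apply: in_L2_B.
have ddi : mu.-integrable `]0, 1[ (EFin \o (fun x => (z \- zbar) x ^+ 2)).
  exact: in_L2_integrable_sqr.
have ppi : mu.-integrable `]0, 1[ (EFin \o (fun x => adjoint_state T T x ^+ 2)).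
  exact: in_L2_integrable_sqr.
have dpi : mu.-integrable `]0, 1[ (EFin \o (fun x => (z \- zbar) x * adjoint_state T T x)).
  exact: in_L2_mul.
have dpi2 : mu.-integrable `]0, 1[ (EFin \o (fun x => 2 * ((z \- zbar) x * adjoint_state T T x))).
  exact: integrable_fZ.
have pairing : \int[mu]_(x in `]0, 1[) ((z \- zbar) x * adjoint_state T T x) = gain u.
  transitivity (\int[mu]_(x in `]0, 1[) (z x * adjoint_state T T x) -
      \int[mu]_(x in `]0, 1[) (zbar x * adjoint_state T T x)).
    rewrite -RintegralB//; [|exact: in_L2_mul|exact: in_L2_mul].
    by apply: eq_Rintegral => x _; rewrite mulrBl.
  rewrite (final_state_pairing T_gt0 yu yz u2).
  rewrite (final_state_pairing T_gt0 ybar_state ybar_final b2).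
  rewrite -RintegralB//; [|exact: q_mul_integrable|exact: q_mul_integrable].
  transitivity (\int[mu]_(t in `]0, T[) (u t * q t + `|q t|)).
    by apply: eq_Rintegral => t _; rewrite bang_bangM opprK.
  have gi := gain_integrable u2.
  apply: ae_eq_Rintegral => //.
  - by apply/measurable_EFinP; exact: (measurable_int mu gi).
  - by apply/measurable_EFinP; exact: (measurable_int mu (integrable_norm gi)).
  - by apply: (ae_imply (gain_ae ua)) => t /= H tT; rewrite H.
have pE x : zbar x - yd x = adjoint_state T T x by rewrite /yd /= opprB addrC subrK.
have -> : objective yd zbar = 1 / 2 * \int[mu]_(x in `]0, 1[) (adjoint_state T T x ^+ 2).
  by rewrite /objective; under eq_Rintegral do rewrite pE.
rewrite /objective.
have -> : \int[mu]_(x in `]0, 1[) ((z x - yd x) ^+ 2) =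
    \int[mu]_(x in `]0, 1[) (((z \- zbar) x ^+ 2 +
       2 * ((z \- zbar) x * adjoint_state T T x)) + adjoint_state T T x ^+ 2).
  by apply: eq_Rintegral => x _; rewrite -pE /=; ring.
rewrite RintegralD//; last exact: integrable_fD.
rewrite RintegralD// RintegralZl// pairing /=.
by move: (\int[mu]_(x in _) _) => a; field.
Qed.

Lemma gain_eq0 u : admissible_control T u -> gain u = 0 ->
  {ae mu, forall t, t \in `]0, T[ -> u t = bang_bang t}.
Proof.
move=> ua g0; have [u2 _] := ua.
have H : {ae mu, forall t, `]0, T[%classic t -> `|u t * q t + `|q t| | = 0}.
  apply: (ge0_Rintegral_eq0 _ _ _ g0) => //.
  exact: integrable_norm (gain_integrable u2).
apply: (ae_imply2 H (@lacunary_neq0_ae R T)) => t H1 H2 tT.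
have q0 := H2 tT.
by have /normr0_eq0/eqP := H1 tT; rewrite addr_eq0 -bang_bangM => /eqP/(mulIf q0).
Qed.

End Optimality.

Theorem theorem4p5 (R : realType) (T : R) (hT : 0 < T) :
  exists yd : R -> R,
    [/\ in_L2 (@lebesgue_measure R) `]0, 1[ yd,
        (0 < optimal_value T yd)%E &
        exists (ybar : R -> R -> R) (ubar zbar : R -> R)
               (pbar : R -> R -> R) (q w : R -> R),
          [/\ optimal T yd ybar ubar zbar,
              forall y u z, optimal T yd y u z ->
                {ae (@lebesgue_measure R),
                  forall t, t \in `]0, T[ -> u t = ubar t},
              adjoint_equation T pbar (zbar \- yd),
              [/\ {ae (@lebesgue_measure R),
                     forall t, t \in `]0, T[ -> space_trace (pbar t) 1 (q t)},
                  analytic_on_0T T q &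
                  infinitely_many_sign_changes T q] &
              right_continuous_representative T ubar w /\
              infinite_set (switching_points T w)]].
Proof.
have bang_le t : 0 < t < T -> `|bang_bang T t| <= 1 by rewrite bang_bang_norm.
have [ybar [zbar [ys yz]]] := state_equation_exists hT (@measurable_bang_bang R T) bang_le.
have feas : feasible T ybar (bang_bang T) zbar.
  by split=> //; exact: bang_bang_admissible.
have p2 : in_L2 (@lebesgue_measure R) `]0, 1[ (adjoint_state T T).
  by apply: in_L2_continuous; apply: adjoint_state_continuous; rewrite lexx ltW.
have expand := objective_gain hT ys yz.
have pE : zbar \- (zbar \- adjoint_state T T) = adjoint_state T T.
  by apply/funext => x /=; rewrite opprB addrC subrK.
set yd := zbar \- adjoint_state T T in expand pE *.
have gain0 u : 0 <= gain T u by exact: Rintegral_ge0.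
have dist0 (z : R -> R) :
    0 <= 1 / 2 * \int[lebesgue_measure]_(x in `]0, 1[) ((z x - zbar x) ^+ 2).
  by rewrite mulr_ge0// Rintegral_ge0// => x _; exact: sqr_ge0.
have opt y u z : feasible T y u z -> objective yd zbar <= objective yd z.
  by move=> /expand ->; rewrite -addrA lerDl addr_ge0.
exists yd; split.
- by apply: in_L2_B => //; case: yz.
(* The minimum is half the squared norm of [p(T)], positive because [p(T)] has nonzero mean. *)
- have obj0 : 0 < objective yd zbar.
    rewrite /objective mulr_gt0//.
    have := final_adjoint_norm_gt0 hT; congr (_ < _).
    by apply: eq_Rintegral => x _; rewrite -pE.
  apply: (@lt_le_trans _ _ (objective yd zbar)%:E); first by rewrite lte_fin.
  by apply: le_ereal_inf_tmp => _ [y [u [z [f ->]]]]; rewrite lee_fin (opt y u).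
exists ybar, (bang_bang T), zbar, (adjoint_state T), (fun t => lacunary (T - t)), (right_sign T).
split.
- by split=> // y u z; exact: opt.
(* Comparison with the bang-bang control forces the nonnegative distance and gain to sum to at most
   zero. *)
- move=> y u z [f fmin]; have [_ ua _] := f; apply: (gain_eq0 ua).
  have := fmin _ _ _ feas; rewrite (expand _ _ _ f) -addrA gerDl => le0.
  have := dist0 z; have := gain0 u; lra.
- by rewrite pE; exact: adjoint_state_equation.
- split; [|exact: lacunary_analytic|exact: lacunary_sign_changes].
  by apply: aeW => t; rewrite in_itv /=; exact: adjoint_state_trace.
split; last exact: right_sign_infinite_switching.
split.
- apply: (ae_imply (@lacunary_neq0_ae R T)) => t H tT; have q0 := H tT.
  move: tT; rewrite in_itv /= => /andP[_ tT].
  rewrite right_signE// /bang_bang; case: ltgtP q0 => //.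
  + by move=> /gtr0_sg ->.
  + by move=> /ltr0_sg ->; rewrite opprK.
- by move=> t; rewrite in_itv /= => /andP[_]; exact: right_sign_right_continuous.
- by move=> t _; exact: right_sign_values.
Qed.
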